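(* Let $\Gamma$ be a strongly projectively convex cocompact subgroup of $\mathrm{SL}(n,\mathbb{R})$, and let $\xi^{sym}=(\xi,\xi^* ):\partial_\infty\Gamma\to \mathbf{P}(\mathbb{R}^n)\times\mathbf{P}({\mathbb{R}^n}^* )$ be its symmetric boundary map. Then \[2\,\delta_{1,n}(\Gamma)\;\leq\;\dim_H\big(\xi^{sym}(\partial_\infty\Gamma)\big)\;\leq\;\delta_{1,2}(\Gamma).\]
   Context: For $g\in\mathrm{SL}(n,\mathbb{R})$, $\mu_i(g)$ denotes the logarithm of the $i$-th eigenvalue (in decreasing order) of $\sqrt{gg^T}$. For a discrete subgroup $\Gamma$, $\delta_{1,2}(\Gamma)=\limsup_{R\to\infty}\frac1R\log\#\{\gamma\in\Gamma:\mu_1(\gamma)-\mu_2(\gamma)\le R\}$ and $\delta_{1,n}(\Gamma)=\limsup_{R\to\infty}\frac1R\log\#\{\gamma\in\Gamma:\mu_1(\gamma)-\mu_n(\gamma)\le R\}$. A properly convex open domain $\Omega\subset\mathbf{P}(\mathbb{R}^n)$ is a convex open set bounded in some affine chart; it carries the Hilbert distance $d_H(x,y)=\frac12\log\frac{xb\cdot ay}{ax\cdot yb}$, where $a,b$ are the points where the line through $x,y$ meets $\partial\Omega$ (with $a$ on the side of $x$). A discrete subgroup $\Gamma\subset\mathrm{SL}(n,\mathbb{R})$ is strongly projectively convex cocompact if it preserves a properly convex open domain $\Omega$ such that $(\Omega,d_H)$ is Gromov hyperbolic, and acts properly discontinuously and cocompactly on some non-empty $\Gamma$-invariant convex subset $C\subset\Omega$.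 Such a $\Gamma$ is Gromov hyperbolic and projective Anosov; its boundary maps $\xi:\partial_\infty\Gamma\to\mathbf{P}(\mathbb{R}^n)$ and $\xi^*:\partial_\infty\Gamma\to\mathbf{P}({\mathbb{R}^n}^* )$ are the continuous $\Gamma$-equivariant maps such that $\xi$ is a homeomorphism onto $\overline{C}\cap\partial\Omega$ and $\xi^*(x)$ is the hyperplane tangent to $\partial\Omega$ at $\xi(x)$. The Hausdorff dimension $\dim_H$ of a compact subset of a smooth manifold is computed with respect to (the distance induced by) any Riemannian metric; it does not depend on this choice. *)

(* Defs.v *)
From HB Require Import structures.
From mathcomp Require Import all_boot all_order all_algebra.
From mathcomp Require Import all_classical all_reals all_analysis.
Set Implicit Arguments. Unset Strict Implicit. Unset Printing Implicit Defensive.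
Import Order.TTheory GRing.Theory Num.Theory numFieldNormedType.Exports.
Local Open Scope classical_set_scope.
Local Open Scope ring_scope.

Section Defs.
Variable R : realType.

Section Hausdorff.
Variables (T : Type) (d : T -> T -> R).

Definition hdiam (U : set T) : \bar R :=
  ereal_sup [set (d p.1 p.2)%:E | p in U `*` U].

(* contribution diam(U)^s of a covering set (empty sets contribute 0, s > 0) *)
Definition hcontrib (s : R) (U : set T) : \bar R := (powR (fine (hdiam U)) s)%:E.

Definition hausdorff_pre (s delta : R) (A : set T) : \bar R :=
  ereal_inf [set (\sum_(i <oo) hcontrib s (U i))%E
            | U in [set U : nat -> set T |
                    A `<=` \bigcup_i U i /\ forall i, (hdiam (U i) <= delta%:E)%E]].

Definition hausdorff_measure (s : R) (A : set T) : \bar R :=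
  ereal_sup [set hausdorff_pre s delta A | delta in [set delta : R | 0 < delta]].

Definition hausdorff_dim (A : set T) : \bar R :=
  ereal_inf [set s%:E | s in [set s : R | 0 < s /\ hausdorff_measure s A = 0%E]].
End Hausdorff.

Variable n : nat.

Definition pairing (phi : 'rV[R]_n) (v : 'cV[R]_n) : R := (phi *m v) 0 0.
Definition dotc (v w : 'cV[R]_n) : R := (v^T *m w) 0 0.
Definition normc (v : 'cV[R]_n) : R := Num.sqrt (dotc v v).
Definition dotr (p q : 'rV[R]_n) : R := (p *m q^T) 0 0.
Definition normrow (p : 'rV[R]_n) : R := Num.sqrt (dotr p p).

(* Riemannian (Fubini-Study / round) distance on P(R^n) and P(dual of R^n),
   computed on nonzero representatives *)
Definition angle_c (v w : 'cV[R]_n) : R := acos (`|dotc v w| / (normc v * normc w)).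
Definition angle_r (p q : 'rV[R]_n) : R := acos (`|dotr p q| / (normrow p * normrow q)).
Definition dsym (a b : 'cV[R]_n * 'rV[R]_n) : R :=
  Num.sqrt (angle_c a.1 b.1 ^+ 2 + angle_r a.2 b.2 ^+ 2).

(* ---------- subsets of P(R^n), encoded by their cones of representatives --- *)
Definition proj_set (X : set 'cV[R]_n) : Prop :=
  ~ X 0 /\ forall v (t : R), X v -> t != 0 -> X (t *: v).

Definition proj_compact (K : set 'cV[R]_n) : Prop :=
  compact [set v | K v /\ normc v = 1].

Definition chart_slice (phi : 'rV[R]_n) (X : set 'cV[R]_n) : set 'cV[R]_n :=
  [set v | X v /\ pairing phi v = 1].

Definition good_chart (phi : 'rV[R]_n) (Om : set 'cV[R]_n) : Prop :=
  (forall v, Om v -> pairing phi v != 0) /\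
  (forall v w (t : R), chart_slice phi Om v -> chart_slice phi Om w ->
      0 <= t <= 1 -> Om ((1 - t) *: v + t *: w)) /\
  (exists M : R, forall v, chart_slice phi Om v -> normc v <= M).

Definition properly_convex_open (Om : set 'cV[R]_n) : Prop :=
  proj_set Om /\ open Om /\ (exists v, Om v) /\ exists phi, good_chart phi Om.

(* a chosen affine chart of Om (the Hilbert distance does not depend on it) *)
Definition chart (Om : set 'cV[R]_n) : 'rV[R]_n := xget 0 [set phi | good_chart phi Om].

Definition normalize (phi : 'rV[R]_n) (v : 'cV[R]_n) : 'cV[R]_n :=
  (pairing phi v)^-1 *: v.

(* Hilbert distance d_H(x,y) = 1/2 log (|xb| |ay| / (|ax| |yb|)),
   computed in the affine chart; a, b are the endpoints of the chord through x, y,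
   a on the side of x *)
Definition hilbert_dist (Om : set 'cV[R]_n) (x y : 'cV[R]_n) : R :=
  let phi := chart Om in
  let x' := normalize phi x in
  let y' := normalize phi y in
  if x' == y' then 0 else
  let I := [set t : R | Om (x' + t *: (y' - x'))] in
  let a := x' + inf I *: (y' - x') in
  let b := x' + sup I *: (y' - x') in
  ln ((normc (b - x') * normc (y' - a)) / (normc (a - x') * normc (b - y'))) / 2.

Definition gromov_product (T : Type) (d : T -> T -> R) (w x y : T) : R :=
  (d w x + d w y - d x y) / 2.

Definition gromov_hyperbolic (T : Type) (X : set T) (d : T -> T -> R) : Prop :=
  exists delta : R, 0 <= delta /\
    forall x y z w, X x -> X y -> X z -> X w ->
      Num.min (gromov_product d w x y) (gromov_product d w y z) - delta
        <= gromov_product d w x z.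

Definition SL_subgroup (G : set 'M[R]_n) : Prop :=
  G 1%:M /\ (forall g h, G g -> G h -> G (g *m h)) /\
  (forall g, G g -> G (invmx g)) /\ (forall g, G g -> \det g = 1).

Definition discrete_subgroup (G : set 'M[R]_n) : Prop :=
  SL_subgroup G /\
  exists eps : R, 0 < eps /\
    forall g, G g -> (forall i j, `|g i j - (1%:M : 'M[R]_n) i j| < eps) -> g = 1%:M.

Definition convex_in (Om C : set 'cV[R]_n) : Prop :=
  forall v w (t : R), chart_slice (chart Om) C v -> chart_slice (chart Om) C w ->
    0 <= t <= 1 -> C ((1 - t) *: v + t *: w).

Definition acts_properly_discontinuously (G : set 'M[R]_n) (C : set 'cV[R]_n) : Prop :=
  forall K, proj_set K -> K `<=` C -> proj_compact K ->
    finite_set [set g | G g /\ exists v, K v /\ K (g *m v)].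

Definition acts_cocompactly (G : set 'M[R]_n) (C : set 'cV[R]_n) : Prop :=
  exists K, proj_set K /\ K `<=` C /\ proj_compact K /\
    forall v, C v -> exists g k, G g /\ K k /\ v = g *m k.

Definition strongly_proj_convex_cocompact
    (G : set 'M[R]_n) (Om C : set 'cV[R]_n) : Prop :=
  discrete_subgroup G /\
  properly_convex_open Om /\
  (forall g v, G g -> Om v -> Om (g *m v)) /\
  gromov_hyperbolic Om (hilbert_dist Om) /\
  proj_set C /\ (exists v, C v) /\ C `<=` Om /\ convex_in Om C /\
  (forall g v, G g -> C v -> C (g *m v)) /\
  acts_properly_discontinuously G C /\ acts_cocompactly G C.

(* xi(boundary Gamma) = closure(C) cap boundary(Om); xi^*(x) = the tangent
   (= unique supporting) hyperplane of Om at xi(x) *)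
Definition limit_set (Om C : set 'cV[R]_n) : set 'cV[R]_n :=
  [set v | v != 0 /\ closure C v /\ ~ Om v].

Definition xi_sym_image (Om C : set 'cV[R]_n) : set ('cV[R]_n * 'rV[R]_n) :=
  [set p | limit_set Om C p.1 /\ p.2 != 0 /\ pairing p.2 p.1 = 0 /\
           forall v, Om v -> pairing p.2 v != 0].

Definition desc_eigs (A : 'M[R]_n) : seq R :=
  xget [::] [set s : seq R | size s = n /\ sorted >=%R s /\
                              char_poly A = \prod_(x <- s) ('X - x%:P)].

Definition psd_sqrt (A : 'M[R]_n) : 'M[R]_n :=
  xget 0 [set S : 'M[R]_n | S^T = S /\
            (forall v : 'cV[R]_n, 0 <= (v^T *m S *m v) 0 0) /\ S *m S = A].

(* mu g i = log of the (i+1)-th eigenvalue (decreasing) of sqrt(g g^T) *)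
Definition mu (g : 'M[R]_n) (i : nat) : R := ln (nth 0 (desc_eigs (psd_sqrt (g *m g^T))) i).

Definition elog (x : \bar R) : \bar R :=
  match x with EFin r => (ln r)%:E | EPInf => +oo%E | ENInf => -oo%E end.

Definition count_le (G : set 'M[R]_n) (f : 'M[R]_n -> R) (r : R) : \bar R :=
  \esum_(g in [set g | G g /\ f g <= r]) 1%E.

Definition crit_exp (G : set 'M[R]_n) (f : 'M[R]_n -> R) : \bar R :=
  ereal_inf [set ereal_sup [set ((r^-1)%:E * elog (count_le G f r))%E
                           | r in [set r : R | T <= r]] | T in [set: R]].

Definition delta12 (G : set 'M[R]_n) : \bar R := crit_exp G (fun g => mu g 0 - mu g 1).
Definition delta1n (G : set 'M[R]_n) : \bar R := crit_exp G (fun g => mu g 0 - mu g n.-1).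

End Defs.

(* Main.v *)
(** Everything takes place in the open convex cone [K] over [Om], where
    [d_H(x, y) = 1/2 ln (M(x, y) M(y, x))], with [M(x, y)] the least [a] such that
    [y <= a x] in the order of [K].

    Lower bound.  For flags [(x, p)], [(x', p')] in the image of [xi^sym] one has
    [p'(x) + p(x') = (p' - p)(x - x')], which is at most the square of their
    distance.  By hyperbolicity, the points [z] of [Om] with [p(z) <= k |p|] all
    lie behind the point of the ray [o, x) at distance [-1/2 ln k] from [o].  So a
    cover of the image by sets of diameters [r_i] with [sum r_i^s] small gives
    finitely many [h_i] in the group such that all but finitely many [g] satisfy
    [d_H(o, h_i^-1 g o) <= d_H(o, g o) + ln r_i + c] for some [i].  Summing over
    the group, each truncated Poincare series satisfies [S <= F + S / 2], and hence
    the series converges at [s]; finally [d_H(o, g o) <= (mu_1 - mu_n)(g) / 2 + c].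

    Upper bound.  If the ray from [o] to the flag [(x, p)] passes near [g o], then
    [|g| |g^-1 x|] and [|g^-1| |p g|] are bounded, so that [x] and [p] are close to
    the dominant singular directions of [g] and of the transpose of [g^-1].  These
    flags thus form a set of diameter at most
    [c (exp (- (mu_1 - mu_2)(g)) + exp (- (mu_1 - mu_2)(g^-1)))].  By cocompactness
    these sets cover the image, even after removing finitely many [g]. *)
Require Import Defs.
From mathcomp Require Import all_boot all_order all_algebra.
From mathcomp Require Import all_classical all_reals all_analysis.
From mathcomp Require Import ring lra zify.
Set Implicit Arguments. Unset Strict Implicit. Unset Printing Implicit Defensive.
Import Order.TTheory GRing.Theory Num.Theory numFieldNormedType.Exports.
Local Open Scope classical_set_scope.
Local Open Scope ring_scope.

(** * Euclidean norms *)

Section EuclideanNorm.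
Variables (R : realType) (n : nat).
Implicit Types (u v w : 'cV[R]_n) (p q : 'rV[R]_n) (t : R).

Lemma dotcE v w : dotc v w = \sum_i v i 0 * w i 0.
Proof. by rewrite /dotc mxE; apply: eq_bigr => i _; rewrite mxE. Qed.

Lemma dotcC v w : dotc v w = dotc w v.
Proof. by rewrite !dotcE; apply: eq_bigr => i _; rewrite mulrC. Qed.

Lemma dotcDl u v w : dotc (u + v) w = dotc u w + dotc v w.
Proof. by rewrite /dotc linearD /= mulmxDl mxE. Qed.

Lemma dotcZl t v w : dotc (t *: v) w = t * dotc v w.
Proof. by rewrite /dotc linearZ /= -scalemxAl mxE. Qed.

Lemma dotcNl v w : dotc (- v) w = - dotc v w.
Proof. by rewrite -scaleN1r dotcZl mulN1r. Qed.

Lemma dotcDr u v w : dotc w (u + v) = dotc w u + dotc w v.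
Proof. by rewrite dotcC dotcDl !(dotcC w). Qed.

Lemma dotcZr t v w : dotc w (t *: v) = t * dotc w v.
Proof. by rewrite dotcC dotcZl (dotcC w). Qed.

Lemma dotcNr v w : dotc w (- v) = - dotc w v.
Proof. by rewrite dotcC dotcNl (dotcC w). Qed.

Lemma dotc0 v : dotc v 0 = 0.
Proof. by rewrite /dotc mulmx0 mxE. Qed.

Definition dotc_linear := (dotcDl, dotcDr, dotcNl, dotcNr, dotcZl, dotcZr).

Lemma dotc_delta i v : dotc (delta_mx i 0) v = v i 0.
Proof.
rewrite dotcE (bigD1 i)//= mxE !eqxx mul1r big1 ?addr0// => j ji.
by rewrite mxE (negPf ji) mul0r.
Qed.

Lemma dotc_ge0 v : 0 <= dotc v v.
Proof. by rewrite dotcE sumr_ge0// => i _; rewrite -expr2 sqr_ge0. Qed.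

Lemma dotc_eq0 v : (dotc v v == 0) = (v == 0).
Proof.
apply/eqP/eqP => [|->]; last exact: dotc0.
rewrite dotcE => /psumr_eq0P vv0; apply/colP => i; rewrite mxE; apply/eqP.
by rewrite -sqrf_eq0 expr2 vv0// => j _; rewrite -expr2 sqr_ge0.
Qed.

Lemma dotc_gt0 v : (0 < dotc v v) = (v != 0).
Proof. by rewrite lt0r dotc_eq0 dotc_ge0 andbT. Qed.

Lemma normc_ge0 v : 0 <= normc v.
Proof. exact: sqrtr_ge0. Qed.

Lemma normc_sqr v : normc v ^+ 2 = dotc v v.
Proof. by rewrite /normc sqr_sqrtr ?dotc_ge0. Qed.

Lemma normc_eq0 v : (normc v == 0) = (v == 0).
Proof. by rewrite -dotc_eq0 -normc_sqr sqrf_eq0. Qed.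

Lemma normc0 : normc (0 : 'cV[R]_n) = 0.
Proof. by apply/eqP; rewrite normc_eq0. Qed.

Lemma normc_gt0 v : (0 < normc v) = (v != 0).
Proof. by rewrite lt0r normc_eq0 normc_ge0 andbT. Qed.

Lemma normcZ t v : normc (t *: v) = `|t| * normc v.
Proof. by rewrite /normc dotcZl dotcZr mulrA -expr2 sqrtrM ?sqr_ge0// sqrtr_sqr. Qed.

Lemma normcZ_ge0 t v : 0 <= t -> normc (t *: v) = t * normc v.
Proof. by move=> t0; rewrite normcZ ger0_norm. Qed.

Lemma normcN v : normc (- v) = normc v.
Proof. by rewrite -scaleN1r normcZ normrN1 mul1r. Qed.

Lemma normc_distC v w : normc (v - w) = normc (w - v).
Proof. by rewrite -normcN opprB. Qed.

Lemma normc_delta i : normc (delta_mx i 0 : 'cV[R]_n) = 1.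
Proof. by rewrite /normc dotc_delta mxE !eqxx sqrtr1. Qed.

Lemma normc_normalize v : v != 0 -> normc ((normc v)^-1 *: v) = 1.
Proof.
by move=> v0; rewrite normcZ_ge0 ?invr_ge0 ?normc_ge0// mulVf// normc_eq0.
Qed.

Lemma dotc_cauchy_schwarz_sqr v w : dotc v w ^+ 2 <= dotc v v * dotc w w.
Proof.
have [->|w0] := eqVneq w 0; first by rewrite !dotc0 expr0n mulr0.
have := dotc_ge0 (dotc w w *: v - dotc v w *: w).
rewrite !dotc_linear (dotcC w v).
set a := dotc v v; set b := dotc v w; set c := dotc w w.
rewrite (_ : _ + _ = c * (a * c - b ^+ 2)); last by ring.
by rewrite pmulr_rge0 ?dotc_gt0// subr_ge0.
Qed.

Lemma dotc_cauchy_schwarz v w : `|dotc v w| <= normc v * normc w.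
Proof.
rewrite -ler_sqr ?nnegrE ?normr_ge0 ?mulr_ge0 ?normc_ge0//.
by rewrite exprMn !normc_sqr real_normK ?num_real// dotc_cauchy_schwarz_sqr.
Qed.

Lemma normcD v w : normc (v + w) <= normc v + normc w.
Proof.
rewrite -ler_sqr ?nnegrE ?addr_ge0 ?normc_ge0//.
rewrite sqrrD !normc_sqr dotcDl !dotcDr (dotcC w v).
have := le_trans (ler_norm _) (dotc_cauchy_schwarz v w); lra.
Qed.

Lemma normcB v w : normc (v - w) <= normc v + normc w.
Proof. by rewrite -(normcN w) normcD. Qed.

Lemma normc_dist v w : `|normc v - normc w| <= normc (v - w).
Proof.
have le_distD (x y : 'cV[R]_n) : normc x <= normc (x - y) + normc y.
  by rewrite -{1}[x](subrK y) normcD.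
have := le_distD v w; have := le_distD w v; rewrite normc_distC ler_norml => wv vw.
by apply/andP; split; lra.
Qed.

Lemma normc_ge_coord v i : `|v i 0| <= normc v.
Proof.
by rewrite -dotc_delta -[leRHS]mul1r -(normc_delta i) dotc_cauchy_schwarz.
Qed.

Lemma mx_norm_le_normc v : `|v| <= normc v.
Proof.
rewrite [`|v|]/Num.norm /= mx_normrE; apply/bigmax_leP; split; first exact: normc_ge0.
by move=> [i j] _ /=; rewrite ord1 normc_ge_coord.
Qed.

Lemma normc_le_mx_norm v : normc v <= n.+1%:R * `|v|.
Proof.
rewrite -ler_sqr ?nnegrE ?normc_ge0 ?mulr_ge0// normc_sqr dotcE exprMn.
apply: (@le_trans _ _ (\sum_(i < n) `|v| ^+ 2)).
  apply: ler_sum => i _; rewrite -expr2 -(real_normK (num_real (v i 0))).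
  rewrite lerXn2r ?nnegrE// [`|v|]/Num.norm /= mx_normrE.
  exact: (le_bigmax _ (fun ij : 'I_n * 'I_1 => `|v ij.1 ij.2|) (i, ord0)).
rewrite sumr_const card_ord -[leLHS]mulr_natl ler_wpM2r ?sqr_ge0// -natrX ler_nat.
nia.
Qed.

Lemma pairingE p v : pairing p v = dotc p^T v.
Proof. by rewrite /pairing /dotc trmxK. Qed.

Lemma normrowE p : normrow p = normc p^T.
Proof. by rewrite /normrow /normc /dotr /dotc trmxK. Qed.

Lemma normrow_tr v : normrow v^T = normc v.
Proof. by rewrite normrowE trmxK. Qed.

Lemma normrow_ge0 p : 0 <= normrow p.
Proof. by rewrite normrowE normc_ge0. Qed.

Lemma normrow_gt0 p : (0 < normrow p) = (p != 0).
Proof. by rewrite normrowE normc_gt0 trmx_eq0. Qed.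

Lemma normrowZ t p : normrow (t *: p) = `|t| * normrow p.
Proof. by rewrite !normrowE linearZ normcZ. Qed.

Lemma normrow_normalize p : p != 0 -> normrow ((normrow p)^-1 *: p) = 1.
Proof.
move=> p0; rewrite normrowZ ger0_norm ?invr_ge0 ?normrow_ge0// mulVf//.
by rewrite gt_eqF// normrow_gt0.
Qed.

Lemma pairing0l v : pairing 0 v = 0.
Proof. by rewrite /pairing mul0mx mxE. Qed.
Lemma pairing0r p : pairing p 0 = 0.
Proof. by rewrite /pairing mulmx0 mxE. Qed.
Lemma pairingDr p v w : pairing p (v + w) = pairing p v + pairing p w.
Proof. by rewrite !pairingE dotcDr. Qed.
Lemma pairingZr p t v : pairing p (t *: v) = t * pairing p v.
Proof. by rewrite !pairingE dotcZr. Qed.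
Lemma pairingNr p v : pairing p (- v) = - pairing p v.
Proof. by rewrite !pairingE dotcNr. Qed.
Lemma pairingDl p q v : pairing (p + q) v = pairing p v + pairing q v.
Proof. by rewrite !pairingE linearD dotcDl. Qed.
Lemma pairingZl t p v : pairing (t *: p) v = t * pairing p v.
Proof. by rewrite !pairingE linearZ dotcZl. Qed.
Lemma pairingNl p v : pairing (- p) v = - pairing p v.
Proof. by rewrite !pairingE linearN dotcNl. Qed.

Definition pairing_linear :=
  (pairingDl, pairingDr, pairingNl, pairingNr, pairingZl, pairingZr).

Lemma pairing_mulmx m p (A : 'M[R]_(n, m)) x : pairing (p *m A) x = pairing p (A *m x).
Proof. by rewrite /pairing mulmxA. Qed.

Lemma ler_norm_pairing p v : `|pairing p v| <= normrow p * normc v.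
Proof. by rewrite pairingE normrowE dotc_cauchy_schwarz. Qed.

Lemma ler_pairing p v : pairing p v <= normrow p * normc v.
Proof. exact: le_trans (ler_norm _) (ler_norm_pairing p v). Qed.

Lemma pairing_perturb p v w : pairing p v - normrow p * normc (v - w) <= pairing p w.
Proof. by have := ler_pairing p (v - w); rewrite pairingDr pairingNr; lra. Qed.

End EuclideanNorm.

Lemma dotc_mulmxl (R : realType) m n (A : 'M[R]_(m, n)) v w :
  dotc (A *m v) w = dotc v (A^T *m w).
Proof. by rewrite /dotc trmx_mul mulmxA. Qed.

Section EuclideanTopology.
Variables (R : realType) (n : nat).
Implicit Types (v x y : 'cV[R]_n) (A : set 'cV[R]_n).

Lemma nbhs_normcP x A :
  nbhs x A <-> exists2 e : R, 0 < e & forall y, normc (y - x) < e -> A y.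
Proof.
split=> [/nbhs_normP[e /= e0 ballA]|[e e0 ballA]].
  exists e => // y yx; apply: ballA => /=.
  by rewrite -opprB normrN (le_lt_trans (mx_norm_le_normc _)).
apply/(nbhs_normP x A); exists (e / n.+1%:R) => /=; first by rewrite divr_gt0.
move=> y /= yx; apply: ballA; rewrite (le_lt_trans (normc_le_mx_norm _))//.
by rewrite mulrC -ltr_pdivlMr// -opprB normrN.
Qed.

Lemma closure_normcP A x :
  closure A x <-> forall e : R, 0 < e -> exists2 y, A y & normc (y - x) < e.
Proof.
split=> [cAx e e0|near_x B /nbhs_normcP[e e0 ballB]].
  have [|y [Ay yx]] := cAx [set y | normc (y - x) < e]; last by exists y.
  by apply/nbhs_normcP; exists e.
by have [y Ay yx] := near_x e e0; exists y; split=> //; exact: ballB.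
Qed.

Lemma locally_lipschitz_continuous (f : 'cV[R]_n -> R) x (L : R) : 0 <= L ->
  (forall y, normc (y - x) < 1 -> `|f y - f x| <= L * normc (y - x)) ->
  {for x, continuous f}.
Proof.
move=> L0 lipf B /nbhs_ballP[e /= e0 ballB].
apply/(nbhs_normcP x (f @^-1` B)); exists (Num.min 1 (e / (L + 1))).
  by rewrite lt_min ltr01 divr_gt0// ltr_wpDl.
move=> y; rewrite lt_min => /andP[y1 ye] /=; apply: ballB; rewrite /ball /= distrC.
rewrite (le_lt_trans (lipf y y1))//.
move: ye; rewrite ltr_pdivlMr ?ltr_wpDl//; have := normc_ge0 (y - x); lra.
Qed.

Lemma normc_continuous : continuous (@normc R n).
Proof.
move=> x; apply: (@locally_lipschitz_continuous _ _ 1) => // y _.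
by rewrite mul1r normc_dist.
Qed.

Lemma normcB_continuous x : continuous (fun v => normc (v - x)).
Proof.
move=> z; apply: (@locally_lipschitz_continuous _ _ 1) => // y _.
by rewrite mul1r (le_trans (normc_dist _ _))// opprB addrA subrK.
Qed.

Lemma pairing_continuous (p : 'rV[R]_n) : continuous (pairing p).
Proof.
move=> x; apply: (@locally_lipschitz_continuous _ _ (normrow p)) => [|y _].
  exact: normrow_ge0.
by rewrite -pairingNr -pairingDr ler_norm_pairing.
Qed.

Lemma mulmx_normc_bounded m (A : 'M[R]_(m, n)) :
  exists2 c : R, 0 <= c & forall v, normc (A *m v) <= c * normc v.
Proof.
exists (m.+1%:R * \sum_i \sum_j `|A i j|).
  by rewrite mulr_ge0// sumr_ge0// => i _; rewrite sumr_ge0.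
move=> v; rewrite (le_trans (normc_le_mx_norm _))// -mulrA ler_wpM2l//.
rewrite [X in X <= _]/Num.norm /= mx_normrE; apply/bigmax_leP; split.
  by rewrite mulr_ge0 ?normc_ge0// sumr_ge0// => i _; rewrite sumr_ge0.
move=> [i j] _ /=; rewrite ord1 mxE (le_trans (ler_norm_sum _ _ _))//.
rewrite [X in _ <= X * _](bigD1 i)//= mulrDl ler_wpDr//.
  by rewrite mulr_ge0 ?normc_ge0// sumr_ge0// => k _; rewrite sumr_ge0.
rewrite mulr_suml; apply: ler_sum => k _.
by rewrite normrM ler_wpM2l// normc_ge_coord.
Qed.

Lemma quadratic_form_continuous (A : 'M[R]_n) : continuous (fun v => dotc v (A *m v)).
Proof.
move=> x; have [c c0 opA] := mulmx_normc_bounded A.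
apply: (@locally_lipschitz_continuous _ _ (c * (1 + normc x) + normc x * c)).
  by rewrite addr_ge0 ?mulr_ge0 ?addr_ge0 ?normc_ge0.
move=> y yx.
have -> : dotc y (A *m y) - dotc x (A *m x) =
    dotc (y - x) (A *m y) + dotc x (A *m (y - x)).
  by rewrite mulmxBr !dotc_linear; ring.
rewrite (le_trans (ler_normD _ _))// mulrDl lerD//.
  rewrite (le_trans (dotc_cauchy_schwarz _ _))// mulrC ler_wpM2r ?normc_ge0//.
  rewrite (le_trans (opA _))// ler_wpM2l//.
  by have := normcD (y - x) x; rewrite subrK; lra.
by rewrite (le_trans (dotc_cauchy_schwarz _ _))// -mulrA ler_wpM2l ?normc_ge0.
Qed.

Lemma mx_norm_tr m k (A : 'M[R]_(m, k)) : `|A^T| <= `|A|.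
Proof.
rewrite [leLHS]/Num.norm /= mx_normrE; apply/bigmax_leP; split=> //.
move=> [i j] _ /=; rewrite mxE [leRHS]/Num.norm /= mx_normrE.
exact: (le_bigmax _ (fun ij => `|A ij.1 ij.2|) (j, i)).
Qed.

Lemma trmx_continuous m k : continuous (@trmx R m k).
Proof.
move=> A B /nbhs_normP[e /= e0 ballB].
apply/(nbhs_normP A); exists e => //= A' AA'; apply: ballB => /=.
by rewrite -linearB /= (le_lt_trans (mx_norm_tr _)).
Qed.

Lemma closed_normc_bounded_compact A (M : R) :
  closed A -> (forall v, A v -> normc v <= M) -> compact A.
Proof.
move=> cA bA.
have -> : A = trmx @` [set p : 'rV[R]_n | A p^T].
  by apply/seteqP; split=> [v Av|_ [p Ap <-]//]; exists v^T => /=; rewrite trmxK.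
apply: continuous_compact.
  by apply: continuous_subspaceT; exact: trmx_continuous.
apply: bounded_closed_compact.
  exists M; split; first exact: num_real.
  move=> N MN p /= Ap; rewrite -[p]trmxK (le_trans (mx_norm_tr _))//.
  by rewrite (le_trans (mx_norm_le_normc _))// (le_trans (bA _ Ap))// ltW.
by apply: closed_comp => // p _; exact: trmx_continuous.
Qed.

Lemma closed_unit_sphere : closed [set v : 'cV[R]_n | normc v = 1].
Proof.
rewrite (_ : [set _ | _] = (@normc R n) @^-1` [set 1])//.
by apply: closed_comp => [x _|]; [exact: normc_continuous|exact: closed_eq].
Qed.

End EuclideanTopology.

Lemma compact_increasing_cover (T : topologicalType) (A : set T) (P : nat -> set T) :
  compact A -> (forall i j, (i <= j)%N -> P i `<=` P j) ->
  (forall x, A x -> exists i, nbhs x (P i)) -> exists i, A `<=` P i.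
Proof.
move=> /compact_near_coveringP coverA monoP nbhsP.
have := coverA nat \oo P _; case.
  move=> x /nbhsP[i Pi]; exists (P i, [set j | (i <= j)%N]) => /=.
    by split=> //; exists i.
  by move=> [y j] /= [Piy ij]; exact: monoP Piy.
by move=> N _ subP; exists N; apply: subP => /=.
Qed.

(** * Singular values *)

Section OrthogonalMatrix.
Variables (R : realType) (n : nat).
Implicit Types (P Q : 'M[R]_n) (v w : 'cV[R]_n).

Definition orthogonal_mx P := P *m P^T = 1%:M.

Lemma orthogonal_mxC P : orthogonal_mx P -> P^T *m P = 1%:M.
Proof. exact: mulmx1C. Qed.

Lemma orthogonal_tr P : orthogonal_mx P -> orthogonal_mx P^T.
Proof. by rewrite /orthogonal_mx trmxK; exact: orthogonal_mxC. Qed.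

Lemma orthogonal_mul P Q : orthogonal_mx P -> orthogonal_mx Q -> orthogonal_mx (P *m Q).
Proof.
rewrite /orthogonal_mx => oP oQ.
by rewrite trmx_mul mulmxA -[_ *m Q *m _]mulmxA oQ mulmx1.
Qed.

Lemma dotc_orthogonal P v w : orthogonal_mx P -> dotc (P *m v) (P *m w) = dotc v w.
Proof. by move=> /orthogonal_mxC PP; rewrite dotc_mulmxl mulmxA PP mul1mx. Qed.

Lemma normc_orthogonal P v : orthogonal_mx P -> normc (P *m v) = normc v.
Proof. by move=> oP; rewrite /normc dotc_orthogonal. Qed.

Lemma det_orthogonal P : orthogonal_mx P -> `|\det P| = 1.
Proof.
move=> /(congr1 determinant); rewrite det_mulmx det_tr det1 => detP.
by apply/eqP; rewrite -sqrp_eq1// real_normK ?num_real// expr2 detP.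
Qed.

Lemma char_poly_orthogonal P (A : 'M[R]_n) : orthogonal_mx P ->
  char_poly (P *m A *m P^T) = char_poly A.
Proof.
move=> oP; have oPX : map_mx polyC P *m map_mx polyC P^T = 1%:M.
  by rewrite -map_mxM oP map_mx1.
rewrite /char_poly /char_poly_mx !map_mxM -[X in \det (X - _)]mulmx1 -oPX.
rewrite mulmxA -scalar_mxC -mulmxBl -mulmxBr det_mulmx mulrC -det_mulmx mulmxA.
by rewrite (mulmx1C oPX) mul1mx.
Qed.

End OrthogonalMatrix.

Section Reflection.
Variables (R : realType) (n : nat).
Implicit Types (u v w : 'cV[R]_n).

Definition reflection u : 'M[R]_n := 1%:M - (2 / dotc u u) *: (u *m u^T).

Lemma reflection_tr u : (reflection u)^T = reflection u.
Proof. by rewrite linearB linearZ /= trmx1 trmx_mul trmxK. Qed.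

Lemma reflectionE u w : reflection u *m w = w - (2 / dotc u u * dotc u w) *: u.
Proof.
rewrite mulmxBl mul1mx -scalemxAl -mulmxA [u^T *m w]mx11_scalar.
by rewrite mul_mx_scalar scalerA.
Qed.

(* At [u = 0] the coefficient is [2 / 0 = 0], so that the reflection is the identity. *)
Lemma reflection_orthogonal u : orthogonal_mx (reflection u).
Proof.
apply/row_matrixP => i; rewrite /orthogonal_mx reflection_tr -[RHS]trmxK.
apply/trmx_inj; rewrite tr_row trmx_mul reflection_tr trmxK colE -mulmxA.
rewrite tr_row trmx1 colE mul1mx; set e := delta_mx _ _.
have [->|u0] := eqVneq u 0; first by rewrite !reflectionE !scaler0 !subr0.
rewrite !reflectionE !dotc_linear -addrA -opprD -scalerDl.
rewrite [X in X *: u](_ : _ = 0) ?scale0r ?subr0//.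
by field; rewrite dotc_eq0.
Qed.

Lemma reflection_swap v w : normc v = normc w -> reflection (v - w) *m w = v.
Proof.
move=> nvw; have [->|vw] := eqVneq v w; first by rewrite reflectionE subrr scaler0 subr0.
have vv : dotc v v = dotc w w by rewrite -!normc_sqr nvw.
have d0 : dotc (v - w) (v - w) != 0 by rewrite dotc_eq0 subr_eq0.
rewrite reflectionE (_ : dotc (v - w) w = - (dotc (v - w) (v - w) / 2)); last first.
  by rewrite !dotc_linear vv (dotcC w v); field.
rewrite (_ : _ * _ = -1); last by field.
by rewrite scaleN1r opprK addrC subrK.
Qed.

End Reflection.

Section SpectralTheorem.
Variable R : realType.

Lemma mul_diag_mx_coord n (d : 'rV[R]_n) (v : 'cV[R]_n) i :
  (diag_mx d *m v) i 0 = d 0 i * v i 0.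
Proof. by rewrite mul_diag_mx mxE. Qed.

Definition nonincreasing_row n (d : 'rV[R]_n) :=
  forall i j : 'I_n, (i <= j)%N -> d 0 j <= d 0 i.

Definition eigendecomposition n (A P : 'M[R]_n) (d : 'rV[R]_n) :=
  [/\ orthogonal_mx P, nonincreasing_row d & A = P *m diag_mx d *m P^T].

Definition psd_mx n (A : 'M[R]_n) :=
  A^T = A /\ forall v, 0 <= dotc v (A *m v).

Lemma rayleigh_max n (A : 'M[R]_n.+1) : exists v, dotc v v = 1 /\
  forall w, dotc w (A *m w) <= dotc v (A *m v) * dotc w w.
Proof.
pose S := [set v : 'cV[R]_n.+1 | normc v = 1].
have cS : compact S.
  by apply: (@closed_normc_bounded_compact _ _ _ 1) => [|v ->//]; exact: closed_unit_sphere.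
have S0 : S !=set0 by exists (delta_mx 0 0); exact: normc_delta.
have [v Sv maxv] :=
  compact_EVT_max S0 cS (continuous_subspaceT (@quadratic_form_continuous _ _ A)).
have nv : normc v = 1 by move: Sv; rewrite inE.
exists v; split=> [|w]; first by rewrite -normc_sqr nv expr1n.
have [->|w0] := eqVneq w 0; first by rewrite mulmx0 !dotc0 mulr0.
have := maxv ((normc w)^-1 *: w); rewrite inE => /(_ (normc_normalize w0)).
rewrite -scalemxAr !dotc_linear mulrA -invfM -expr2 normc_sqr mulrC.
by rewrite ler_pdivrMr ?dotc_gt0.
Qed.

Lemma psd_form_eq0 n (B : 'M[R]_n) v : psd_mx B -> dotc v (B *m v) = 0 -> B *m v = 0.
Proof.
move=> [symB posB] vBv; set b := B *m v; set c := dotc b (B *m b).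
apply/eqP; rewrite -dotc_eq0 eq_le dotc_ge0 andbT leNgt; apply/negP => bb.
have c0 : 0 <= c by exact: posB.
have [t t0 tc] : exists2 t : R, 0 < t & t * (c + 1) = dotc b b.
  exists (dotc b b / (c + 1)); first by rewrite divr_gt0// ltr_wpDl.
  by rewrite divfK// gt_eqF// ltr_wpDl.
have := posB (v - t *: b); rewrite mulmxBr -scalemxAr !dotc_linear vBv -/b -/c.
rewrite (_ : dotc v (B *m b) = dotc b b); last by rewrite -[in RHS]/b dotc_mulmxl symB.
by rewrite -tc => form_ge0; clear -c0 t0 form_ge0; nra.
Qed.

Lemma max_eigenvector n (A : 'M[R]_n.+1) : A^T = A ->
  exists lam v, [/\ dotc v v = 1, A *m v = lam *: v &
    forall w, dotc w (A *m w) <= lam * dotc w w].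
Proof.
move=> symA; have [v [vv maxv]] := rayleigh_max A.
exists (dotc v (A *m v)), v; split=> //; set lam := dotc v (A *m v).
have psdB : psd_mx (lam%:M - A).
  split; first by rewrite linearB /= tr_scalar_mx symA.
  by move=> w; rewrite mulmxBl mul_scalar_mx !dotc_linear subr_ge0 maxv.
have := @psd_form_eq0 _ _ v psdB; rewrite mulmxBl mul_scalar_mx !dotc_linear.
by rewrite vv mulr1 subrr => /(_ erefl)/eqP; rewrite subr_eq0 => /eqP.
Qed.

Lemma sym_mx_block n (B : 'M[R]_(1 + n)) (lam : R) : B^T = B ->
  B *m delta_mx 0 0 = lam *: (delta_mx 0 0 : 'cV_(1 + n)) ->
  B = block_mx lam%:M 0 0 (drsubmx B).
Proof.
move=> symB Be.
have Bi0 i (j : 'I_(1 + n)) : j = 0%N :> nat -> B i j = lam *+ (i == 0%N :> nat).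
  move=> j0; rewrite (_ : j = 0); last exact/val_inj.
  have := congr1 (fun M : 'cV_(1 + n) => M i 0) Be.
  by rewrite -colE !mxE eqxx andbT mulr_natr.
rewrite -[LHS]submxK; congr block_mx; apply/matrixP => i j; rewrite !mxE.
- by rewrite !ord1 Bi0.
- by rewrite -symB mxE Bi0// ord1.
- by rewrite Bi0// ord1.
Qed.

Lemma dotc_col_mx m n (v1 w1 : 'cV[R]_m) (v2 w2 : 'cV[R]_n) :
  dotc (col_mx v1 v2) (col_mx w1 w2) = dotc v1 w1 + dotc v2 w2.
Proof. by rewrite /dotc tr_col_mx mul_row_col mxE. Qed.

Lemma eigendecomposition_rayleigh n (A P : 'M[R]_n) (d : 'rV[R]_n) i : eigendecomposition A P d ->
  d 0 i = dotc (P *m delta_mx i 0) (A *m (P *m delta_mx i 0)).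
Proof.
move=> [oP _ ->]; rewrite -!mulmxA (mulmxA P^T) (orthogonal_mxC oP) mul1mx.
by rewrite dotc_orthogonal// dotc_delta -colE !mxE eqxx.
Qed.

Lemma eigendecomposition_conj n (A H P : 'M[R]_n) (d : 'rV[R]_n) : orthogonal_mx H ->
  eigendecomposition A P d -> eigendecomposition (H *m A *m H^T) (H *m P) d.
Proof.
move=> oH [oP decrd ->]; split=> //; first exact: orthogonal_mul.
by rewrite trmx_mul !mulmxA.
Qed.

Lemma eigendecomposition_block n (A P : 'M[R]_n) (d : 'rV[R]_n) (lam : R) :
  (forall i, d 0 i <= lam) -> eigendecomposition A P d ->
  eigendecomposition (block_mx (lam%:M : 'M[R]_1) 0 0 A) (block_mx 1%:M 0 0 P)
    (row_mx lam%:M d).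
Proof.
move=> d_le [oP decrd ->]; split.
- rewrite /orthogonal_mx tr_block_mx !trmx0 trmx1 mulmx_block.
  by rewrite !mulmx0 !mul0mx !mulmx1 !addr0 !add0r oP -scalar_mx_block.
- move=> i j ij; rewrite !mxE.
  case: (splitP j) ij => j' ->; case: (splitP i) => i' -> ij.
  + by rewrite !ord1.
  + by move: ij; rewrite ord1.
  + by rewrite ord1 mxE d_le.
  + by move: ij; rewrite leq_add2l; exact: decrd.
- rewrite tr_block_mx !trmx0 trmx1 diag_mx_row !mulmx_block.
  rewrite !mulmx0 !mul0mx !mulmx1 !mul1mx !addr0 !add0r.
  congr block_mx; rewrite ?mul0mx//.
  by apply/matrixP => i j; rewrite !ord1 !mxE.
Qed.

Theorem symmetric_eigendecomposition n (A : 'M[R]_n) : A^T = A ->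
  exists P d, eigendecomposition A P d.
Proof.
elim: n A => [|n IH] A symA.
  exists 1%:M, 0; split=> [|[]//|]; last by rewrite [A]thinmx0 [RHS]thinmx0.
  by rewrite /orthogonal_mx trmx1 mulmx1.
have [lam [v [vv Av maxA]]] := max_eigenvector symA.
pose e : 'cV[R]_n.+1 := delta_mx 0 0; pose H := reflection (v - e).
have He : H *m e = v by apply: reflection_swap; rewrite normc_delta /normc vv sqrtr1.
have oH : orthogonal_mx H by exact: reflection_orthogonal.
have HH : H *m H = 1%:M by rewrite -[in RHS]oH reflection_tr.
pose B : 'M[R]_(1 + n) := H *m A *m H.
have symB : B^T = B by rewrite !trmx_mul symA reflection_tr mulmxA.
have Be : B *m e = lam *: e by rewrite -!mulmxA He Av -scalemxAr -He mulmxA HH mul1mx.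
have blockB := sym_mx_block symB Be.
have [P [d decompA']] : exists P d, eigendecomposition (drsubmx B) P d.
  by apply: IH; rewrite trmx_drsub symB.
have d_le i : d 0 i <= lam.
  rewrite (eigendecomposition_rayleigh i decompA'); set w := P *m _.
  pose u : 'cV[R]_(1 + n) := col_mx 0 w; have [oP _ _] := decompA'.
  have uu : dotc u u = 1.
    by rewrite dotc_col_mx dotc0 add0r -normc_sqr normc_orthogonal// normc_delta expr1n.
  have uBu : dotc u (B *m u) = dotc w (drsubmx B *m w).
    by rewrite {1}blockB mul_block_col !mul0mx mulmx0 !add0r dotc_col_mx dotc0 add0r.
  rewrite -uBu; have := maxA (H *m u); rewrite dotc_orthogonal// uu mulr1.
  by rewrite dotc_mulmxl reflection_tr !mulmxA.
exists (H *m (block_mx 1%:M 0 0 P : 'M[R]_(1 + n))), (row_mx lam%:M d).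
have := eigendecomposition_conj oH (eigendecomposition_block d_le decompA').
by rewrite -blockB reflection_tr {1}/B !mulmxA HH mul1mx -mulmxA HH mulmx1.
Qed.

Lemma desc_eigs_eigendecomposition n (A P : 'M[R]_n) (d : 'rV[R]_n) : eigendecomposition A P d ->
  desc_eigs A = [seq d 0 i | i <- enum 'I_n].
Proof.
move=> [oP decrd ->]; set s := [seq _ | _ <- _].
have char_polyA : char_poly (P *m diag_mx d *m P^T) = \prod_(x <- s) ('X - x%:P).
  rewrite char_poly_orthogonal// char_poly_trig.
    by rewrite /s big_map big_enum; apply: eq_bigr => i _; rewrite mxE eqxx mulr1n.
  by apply/is_trig_mxP => i j ij; rewrite mxE -val_eqE ltn_eqF.
have sorted_s : sorted >=%R s.
  rewrite sorted_map; apply: (@sub_sorted _ (fun i j : 'I_n => (i <= j)%N)).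
    by move=> i j ij /=; exact: decrd.
  by have := iota_sorted 0 n; rewrite -val_enum_ord sorted_map.
apply: xget_unique => [|t [_ [sorted_t char_polyt]]].
  by rewrite /= size_map size_enum_ord.
apply: (@sorted_eq _ >=%R) => //.
- by move=> x y z /= yx zy; exact: le_trans zy yx.
- by move=> x y /=; rewrite andbC => /le_anti.
- by apply: prod_XsubC_eq; rewrite -char_polyt char_polyA.
Qed.

Lemma nth_desc_eigs n (A P : 'M[R]_n) (d : 'rV[R]_n) (i : 'I_n) : eigendecomposition A P d ->
  nth 0 (desc_eigs A) i = d 0 i.
Proof.
move=> /desc_eigs_eigendecomposition ->.
by rewrite (nth_map i) ?size_enum_ord// nth_ord_enum.
Qed.

Lemma psd_eigenvalue_ge0 n (A P : 'M[R]_n) (d : 'rV[R]_n) i : psd_mx A ->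
  eigendecomposition A P d -> 0 <= d 0 i.
Proof. by move=> [_ posA] /eigendecomposition_rayleigh ->; exact: posA. Qed.

Lemma eigendecomposition_sqr n (A P : 'M[R]_n) (d : 'rV[R]_n) : eigendecomposition A P d ->
  (forall i, 0 <= d 0 i) -> eigendecomposition (A *m A) P (\row_i d 0 i ^+ 2).
Proof.
move=> [oP decrd ->] d0; split=> // [i j ij|].
  by rewrite !mxE lerXn2r ?nnegrE ?d0 ?decrd.
rewrite !mulmxA -[_ *m P^T *m P]mulmxA (orthogonal_mxC oP) mulmx1 -[P *m _ *m _]mulmxA.
by rewrite mulmx_diag; congr (_ *m diag_mx _ *m _); apply/rowP => i; rewrite !mxE.
Qed.

Lemma psd_sqrtP n (A : 'M[R]_n) : psd_mx A ->
  psd_mx (psd_sqrt A) /\ psd_sqrt A *m psd_sqrt A = A.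
Proof.
move=> psdA.
suff [symS [posS sqrS]] : [set S : 'M[R]_n | S^T = S /\
    (forall v : 'cV[R]_n, 0 <= (v^T *m S *m v) 0 0) /\ S *m S = A] (psd_sqrt A).
  by split=> //; split=> // v; rewrite /dotc mulmxA.
apply: (xgetPex 0); have [P [d decompA]] := symmetric_eigendecomposition psdA.1.
have d0 i := psd_eigenvalue_ge0 i psdA decompA; have [oP _ AE] := decompA.
pose r : 'rV[R]_n := \row_i Num.sqrt (d 0 i).
exists (P *m diag_mx r *m P^T); split; first by rewrite !trmx_mul trmxK tr_diag_mx mulmxA.
split=> [v|].
  rewrite (_ : _ *m v = (P^T *m v)^T *m (diag_mx r *m (P^T *m v))); last first.
    by rewrite trmx_mul trmxK !mulmxA.
  rewrite -/(dotc _ _) dotcE sumr_ge0// => i _; rewrite mul_diag_mx_coord mulrCA.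
  by rewrite mulr_ge0 -?expr2 ?sqr_ge0// mxE sqrtr_ge0.
rewrite !mulmxA -[_ *m P^T *m P]mulmxA (orthogonal_mxC oP) mulmx1 -[P *m _ *m _]mulmxA.
rewrite mulmx_diag AE; congr (_ *m diag_mx _ *m _).
by apply/rowP => i; rewrite !mxE -expr2 sqr_sqrtr.
Qed.

End SpectralTheorem.

Section SingularValueDecomposition.
Variables (R : realType) (n : nat).
Implicit Types (g P Q : 'M[R]_n) (d : 'rV[R]_n) (v : 'cV[R]_n).

Definition svd g P d Q :=
  [/\ orthogonal_mx P, orthogonal_mx Q, nonincreasing_row d, forall i, 0 < d 0 i
    & g = P *m diag_mx d *m Q].

Lemma psd_gram g : psd_mx (g *m g^T).
Proof.
split; first by rewrite trmx_mul trmxK.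
by move=> v; rewrite -mulmxA dotcC dotc_mulmxl dotc_ge0.
Qed.

Lemma svd_gram g P d Q : svd g P d Q ->
  eigendecomposition (g *m g^T) P (\row_i d 0 i ^+ 2).
Proof.
move=> [oP oQ decrd d0 ->]; split=> // [i j ij|].
  by rewrite !mxE lerXn2r ?nnegrE ?(ltW (d0 _))// decrd.
rewrite !trmx_mul tr_diag_mx !mulmxA -[_ *m Q *m Q^T]mulmxA oQ mulmx1.
by rewrite -[P *m _ *m _]mulmxA mulmx_diag.
Qed.

Lemma svd_exists g : g \in unitmx -> exists P d Q, svd g P d Q.
Proof.
move=> gu; have [P [e decomp_e]] := symmetric_eigendecomposition (psd_gram g).1.
have [oP decre ggE] := decomp_e.
have e_gt0 i : 0 < e 0 i.
  rewrite (eigendecomposition_rayleigh i decomp_e) -mulmxA dotcC dotc_mulmxl dotc_gt0.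
  rewrite -normc_gt0 lt0r normc_ge0 andbT; apply/eqP => /eqP.
  rewrite normc_eq0 => /eqP/(congr1 (mulmx (invmx g^T))).
  rewrite mulKmx ?unitmx_tr// mulmx0 => /(congr1 (@normc R n))/eqP.
  by rewrite normc_orthogonal// normc_delta normc0 oner_eq0.
pose d : 'rV[R]_n := \row_i Num.sqrt (e 0 i).
pose d' : 'rV[R]_n := \row_i (Num.sqrt (e 0 i))^-1.
have dd' : diag_mx d *m diag_mx d' = 1%:M.
  rewrite mulmx_diag -diag_const_mx; congr diag_mx; apply/rowP => i; rewrite !mxE.
  by rewrite divff// gt_eqF// sqrtr_gt0.
exists P, d, (diag_mx d' *m P^T *m g); split=> //.
- rewrite /orthogonal_mx !trmx_mul trmxK tr_diag_mx !mulmxA -[_ *m g *m g^T]mulmxA ggE.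
  rewrite !mulmxA -(mulmxA _ P^T P) (orthogonal_mxC oP) mulmx1.
  rewrite -(mulmxA _ P^T P) (orthogonal_mxC oP) mulmx1.
  rewrite (_ : diag_mx e = diag_mx d *m diag_mx d); last first.
    by rewrite mulmx_diag; congr diag_mx; apply/rowP => i; rewrite !mxE -expr2 sqr_sqrtr// ltW.
  by rewrite mulmxA (mulmx1C dd') mul1mx dd'.
- by move=> i j ij; rewrite !mxE ler_wsqrtr// decre.
- by move=> i; rewrite mxE sqrtr_gt0.
by rewrite !mulmxA -(mulmxA P) dd' mulmx1 oP mul1mx.
Qed.

Lemma mu_svd g P d Q (i : 'I_n) : svd g P d Q -> mu g i = ln (d 0 i).
Proof.
move=> svdg; have [_ _ _ d0 _] := svdg.
have [psdS SS] := psd_sqrtP (psd_gram g).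
have [P' [d' decompS]] := symmetric_eigendecomposition psdS.1.
have d'0 j := psd_eigenvalue_ge0 j psdS decompS.
have := eigendecomposition_sqr decompS d'0; rewrite SS => decomp_gram'.
rewrite /mu (nth_desc_eigs _ decompS); congr ln.
apply/eqP; rewrite -(@eqrXn2 _ 2)//; last exact: ltW.
by have := nth_desc_eigs i (svd_gram svdg); rewrite (nth_desc_eigs i decomp_gram') !mxE => ->.
Qed.

(* Indices beyond the dimension give [ln 0 = 0]. *)
Lemma mu_default g i : (n <= i)%N -> mu g i = 0.
Proof.
move=> ni; rewrite /mu nth_default ?ln0// /desc_eigs.
by case: xgetP => [s _ [-> _]|].
Qed.

Lemma muN g i : mu (- g) i = mu g i.
Proof. by rewrite /mu linearN /= mulNmx mulmxN opprK. Qed.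

Lemma svd_tr g P d Q : svd g P d Q -> svd g^T Q^T d P^T.
Proof.
move=> [oP oQ decrd d0 ->]; split=> //; [exact: orthogonal_tr..|].
by rewrite !trmx_mul tr_diag_mx mulmxA.
Qed.

Lemma mu_tr g i : g \in unitmx -> mu g^T i = mu g i.
Proof.
move=> /svd_exists[P [d [Q svdg]]].
have [ni|i_lt_n] := leqP n i; first by rewrite !mu_default.
by rewrite (mu_svd (Ordinal i_lt_n) (svd_tr svdg)) (mu_svd (Ordinal i_lt_n) svdg).
Qed.

Lemma svd_det g P d Q : svd g P d Q -> \prod_i d 0 i = `|\det g|.
Proof.
move=> [oP oQ _ d0 ->]; rewrite !det_mulmx !normrM (det_orthogonal oP) (det_orthogonal oQ).
by rewrite mul1r mulr1 det_diag ger0_norm// prodr_ge0// => i _; exact: ltW.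
Qed.

Lemma normc_diag_mx_le d (a : R) v : 0 <= a -> (forall i, `|d 0 i| <= a) ->
  normc (diag_mx d *m v) <= a * normc v.
Proof.
move=> a0 d_le; rewrite -ler_sqr ?nnegrE ?mulr_ge0 ?normc_ge0//.
rewrite exprMn !normc_sqr !dotcE mulr_sumr; apply: ler_sum => i _.
rewrite mul_diag_mx_coord -!expr2 exprMn ler_wpM2r ?sqr_ge0//.
by rewrite -(real_normK (num_real (d 0 i))) ler_sqr ?nnegrE.
Qed.

Lemma normc_svd g P d Q v : svd g P d Q -> normc (g *m v) = normc (diag_mx d *m (Q *m v)).
Proof. by move=> [oP _ _ _ ->]; rewrite -!mulmxA normc_orthogonal. Qed.

End SingularValueDecomposition.

Section OperatorNorm.
Variables (R : realType) (n : nat).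
Hypothesis n_gt0 : (0 < n)%N.
Implicit Types (g : 'M[R]_n) (v : 'cV[R]_n).

Let first_index := Ordinal n_gt0.

Lemma expR_mu0_svd g P d Q : svd g P d Q -> expR (mu g 0) = d 0 first_index.
Proof.
by move=> svdg; rewrite (mu_svd first_index svdg) lnK// posrE; case: svdg.
Qed.

Lemma normc_mulmx_le g v : g \in unitmx -> normc (g *m v) <= expR (mu g 0) * normc v.
Proof.
move=> /svd_exists[P [d [Q svdg]]]; have [_ oQ decrd d0 _] := svdg.
rewrite (normc_svd _ svdg) (expR_mu0_svd svdg) -(normc_orthogonal v oQ).
apply: normc_diag_mx_le => [|i]; first exact: ltW.
by rewrite gtr0_norm// decrd.
Qed.

Lemma normc_mulmx_attained g : g \in unitmx ->
  exists2 u, normc u = 1 & normc (g *m u) = expR (mu g 0).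
Proof.
move=> /svd_exists[P [d [Q svdg]]]; have [_ oQ _ d0 _] := svdg.
pose e : 'cV[R]_n := delta_mx first_index 0.
exists (Q^T *m e); first by rewrite normc_orthogonal ?normc_delta//; exact: orthogonal_tr.
rewrite (normc_svd _ svdg) (expR_mu0_svd svdg) (mulmxA Q) oQ mul1mx.
rewrite (_ : diag_mx d *m e = d 0 first_index *: e); last first.
  apply/colP => i; rewrite mul_diag_mx_coord !mxE.
  by have [->//|_] := eqVneq i first_index; rewrite !mulr0.
by rewrite normcZ normc_delta mulr1 gtr0_norm.
Qed.

Lemma mu_invmx g : g \in unitmx -> mu (invmx g) 0 = - mu g n.-1.
Proof.
move=> gu; have [P [d [Q svdg]]] := svd_exists gu; have [oP oQ decrd d0 gE] := svdg.
have last_lt : (n.-1 < n)%N by rewrite prednK.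
pose l := Ordinal last_lt; have giu : invmx g \in unitmx by rewrite unitmx_inv.
rewrite [mu g _](mu_svd l svdg); apply: expR_inj; rewrite expRN lnK ?posrE//.
apply/le_anti/andP; split.
  have [u u1 <-] := normc_mulmx_attained giu; set w := invmx g *m u.
  rewrite -[leRHS]mulr1 -u1 (_ : u = g *m w); last by rewrite mulKVmx.
  rewrite ler_pdivlMl// (normc_svd _ svdg) -(normc_orthogonal w oQ).
  rewrite -ler_sqr ?nnegrE ?mulr_ge0 ?normc_ge0 ?(ltW (d0 l))// exprMn !normc_sqr !dotcE.
  rewrite mulr_sumr; apply: ler_sum => i _; rewrite mul_diag_mx_coord -!expr2 exprMn.
  rewrite ler_wpM2r ?sqr_ge0// lerXn2r ?nnegrE ?(ltW (d0 _))// decrd//=.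
  by rewrite -ltnS prednK.
pose w : 'cV[R]_n := Q^T *m delta_mx l 0.
have w1 : normc w = 1 by rewrite normc_orthogonal ?normc_delta//; exact: orthogonal_tr.
have gw : normc (g *m w) = d 0 l.
  rewrite (normc_svd _ svdg) /w (mulmxA Q) oQ mul1mx -colE.
  rewrite (_ : col l _ = d 0 l *: delta_mx l 0).
    by rewrite normcZ normc_delta mulr1 gtr0_norm.
  by apply/colP => i; rewrite !mxE eqxx andbT mulr_natr; have [->|] := eqVneq.
have := normc_mulmx_le (g *m w) giu; rewrite mulKmx// w1 gw.
by rewrite -ler_pdivrMr// mul1r.
Qed.

Lemma mu0_ge0 g : `|\det g| = 1 -> 0 <= mu g 0.
Proof.
move=> detg; have gu : g \in unitmx by rewrite unitmxE unitfE -normr_eq0 detg oner_eq0.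
have [P [d [Q svdg]]] := svd_exists gu; have [_ _ decrd d0 _] := svdg.
rewrite -ler_expR expR0 (expR_mu0_svd svdg) leNgt; apply/negP => d_lt1.
have := svd_det svdg; rewrite detg (bigD1 first_index)//= => prod_d.
suff : d 0 first_index * \prod_(i < n | i != first_index) d 0 i <= d 0 first_index.
  by rewrite prod_d leNgt d_lt1.
rewrite ler_piMr ?(ltW (d0 _))//; apply: prodr_ile1 => i _.
by rewrite ltW//= (le_trans _ (ltW d_lt1))// decrd.
Qed.

(* In dimension one the error vanishes and [mu g 1 = 0]. *)
Lemma rank_one_approximation g : g \in unitmx -> exists (x : 'cV[R]_n) (p : 'rV[R]_n),
  forall v, normc (g *m v - pairing p v *: x) <= expR (mu g 1) * normc v.
Proof.
move=> /svd_exists[P [d [Q svdg]]]; have [oP oQ decrd d0 gE] := svdg.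
pose e : 'cV[R]_n := delta_mx first_index 0.
exists (P *m e), (d 0 first_index *: (e^T *m Q)) => v.
pose tail : 'rV[R]_n := \row_i if i == first_index then 0 else d 0 i.
have -> : g *m v - pairing (d 0 first_index *: (e^T *m Q)) v *: (P *m e) =
    P *m (diag_mx tail *m (Q *m v)).
  rewrite pairingZl pairing_mulmx pairingE trmxK dotc_delta gE -!mulmxA.
  rewrite scalemxAr -mulmxBr; congr (P *m _).
  move: (Q *m v) => y; apply/colP => i; rewrite !mul_diag_mx !mxE eqxx andbT.
  by have [->|_] := eqVneq; rewrite ?mulr1 ?mulr0 ?mul0r ?subrr ?subr0.
rewrite normc_orthogonal// -(normc_orthogonal v oQ).
apply: normc_diag_mx_le => [|i]; first exact: expR_ge0.
rewrite mxE; have [_|i_neq] := eqVneq i first_index; first by rewrite normr0 expR_ge0.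
have i_gt0 : (0 < i)%N by rewrite lt0n.
have n_gt1 : (1 < n)%N := leq_ltn_trans i_gt0 (ltn_ord i).
by rewrite gtr0_norm// (mu_svd (Ordinal n_gt1) svdg) lnK ?posrE// decrd.
Qed.

End OperatorNorm.

(** * Angles *)

Section Trigonometry.
Variable R : realType.
Implicit Types x y : R.

Lemma sin_mean_value y : 0 <= y -> exists2 c, 0 <= c <= y & sin y = y * cos c.
Proof.
move=> y0; have [c c_itv] := @MVT_segment R sin cos 0 y y0
  (fun x _ => is_derive_sin x) (continuous_subspaceT (@continuous_sin R)).
by rewrite sin0 !subr0 mulrC => siny; exists c.
Qed.

Lemma sin_le_id y : 0 <= y -> sin y <= y.
Proof. by move=> y0; have [c _ ->] := sin_mean_value y0; rewrite ler_piMr ?cos_le1. Qed.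

Lemma cos_half_angle y : cos y = 1 - 2 * sin (y / 2) ^+ 2.
Proof.
rewrite {1}(_ : y = (y / 2) *+ 2); last by rewrite -mulr_natr divfK.
rewrite cos_mulr2n -mulr_natl; have := cos2Dsin2 (y / 2); lra.
Qed.

Lemma sin_half_angle y : sin y = 2 * sin (y / 2) * cos (y / 2).
Proof.
rewrite {1}(_ : y = (y / 2) *+ 2); last by rewrite -mulr_natr divfK.
by rewrite sin_mulr2n -mulr_natl mulrA [RHS]mulrAC.
Qed.

Lemma acos_sqr_ge x : 0 <= x <= 1 -> 2 - 2 * x <= acos x ^+ 2.
Proof.
move=> /andP[x0 x1]; have x_itv : -1 <= x <= 1 by rewrite x1 andbT; lra.
have acos0 := acos_ge0 x_itv.
have {1}-> : x = cos (acos x) by rewrite acosK// in_itv.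
rewrite cos_half_angle; have half0 : 0 <= acos x / 2 by rewrite divr_ge0.
have sin_le : sin (acos x / 2) <= acos x / 2 by exact: sin_le_id.
have : 0 <= sin (acos x / 2).
  by apply: sin_ge0_pi; rewrite half0 /=; have := acos_lepi x_itv; lra.
nra.
Qed.

(* For [a = acos x] in [[0, pi/2]], [sin a = 2 sin (a/2) cos (a/2)] with
   [sin (a/2) >= (a/2) cos (a/2)] and [2 cos (a/2)^2 >= 1]. *)
Lemma acos_le_sin x : 0 <= x <= 1 -> acos x <= 2 * Num.sqrt (1 - x ^+ 2).
Proof.
move=> /andP[x0 x1]; have x_itv : -1 <= x <= 1 by rewrite x1 andbT; lra.
have a0 := acos_ge0 x_itv; have a_pi := acos_lepi x_itv.
have xE : x = cos (acos x) by rewrite acosK// in_itv.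
rewrite -[Num.sqrt _](sin_acos x_itv); set a := acos x in a0 a_pi xE *.
have half0 : 0 <= a / 2 by rewrite divr_ge0.
have [c /andP[c0 c_half] sin_half] := sin_mean_value half0.
have half_pi : a / 2 <= pi / 2 by rewrite ler_pM2r.
have pi0 := pi_gt0 R.
have cos_half0 : 0 <= cos (a / 2) by apply: cos_ge0_pihalf; rewrite half_pi andbT; lra.
have cos_sqr : 1 <= 2 * cos (a / 2) ^+ 2.
  have := cos_half_angle a; rewrite -xE; have := cos2Dsin2 (a / 2); lra.
have cos_le : cos (a / 2) <= cos c by rewrite leNgt ltr_cos ?in_itv/= -?leNgt//; lra.
rewrite sin_half_angle sin_half.
have : 1 <= 2 * (cos c * cos (a / 2)).
  by rewrite (le_trans cos_sqr)// ler_pM2l// expr2 ler_wpM2r.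
by move=> /(ler_wpM2l a0); lra.
Qed.

End Trigonometry.

Section Angle.
Variables (R : realType) (n : nat).
Implicit Types (u v w x : 'cV[R]_n) (p q : 'rV[R]_n).

Lemma angle_rE p q : angle_r p q = angle_c p^T q^T.
Proof. by rewrite /angle_r /angle_c !normrowE /dotr /dotc trmxK. Qed.

Lemma cosine_itv v w : 0 <= `|dotc v w| / (normc v * normc w) <= 1.
Proof.
rewrite divr_ge0 ?mulr_ge0 ?normc_ge0//=.
have [->|vw0] := eqVneq (normc v * normc w) 0; first by rewrite invr0 mulr0.
by rewrite ler_pdivrMr ?mul1r ?dotc_cauchy_schwarz// lt0r vw0 mulr_ge0 ?normc_ge0.
Qed.

Lemma angle_c_ge0 v w : 0 <= angle_c v w.
Proof.
by have /andP[cos0 cos1] := cosine_itv v w; apply: acos_ge0; rewrite cos1 andbT; lra.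
Qed.

Lemma angle_c_le2 v w : angle_c v w <= 2.
Proof.
rewrite /angle_c (le_trans (acos_le_sin (cosine_itv v w)))// -[leRHS]mulr1 ler_pM2l//.
by rewrite -[leRHS]sqrtr1 ler_wsqrtr// gerBl sqr_ge0.
Qed.

Lemma angle_c_scale (a b : R) v w : a != 0 -> b != 0 ->
  angle_c (a *: v) (b *: w) = angle_c v w.
Proof.
move=> a0 b0; rewrite /angle_c !normcZ dotcZl dotcZr !normrM; congr acos.
have [->|v0] := eqVneq (normc v) 0; first by rewrite !(mulr0, mul0r) invr0 !mulr0.
have [->|w0] := eqVneq (normc w) 0; first by rewrite !(mulr0, mul0r) invr0 !mulr0.
by field; rewrite v0 w0 !normr_eq0 a0 b0.
Qed.

Lemma angle_cNr v w : angle_c v (- w) = angle_c v w.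
Proof.
by rewrite -[v in LHS]scale1r -scaleN1r angle_c_scale ?oppr_eq0 ?oner_eq0.
Qed.

Lemma angle_c_le_residual v w u (t : R) : v != 0 -> w != 0 ->
  v = t *: w + u -> angle_c v w <= 2 * (normc u / normc v).
Proof.
move=> v0 w0 vE; rewrite /angle_c (le_trans (acos_le_sin (cosine_itv v w)))// ler_pM2l//.
have /andP[cos0 cos1] := cosine_itv v w.
rewrite -ler_sqr ?nnegrE ?sqrtr_ge0 ?divr_ge0 ?normc_ge0// sqr_sqrtr; last first.
  by rewrite subr_ge0 -[leRHS](expr1n _ 2) ler_sqr ?nnegrE.
rewrite !expr_div_n exprMn real_normK ?num_real// !normc_sqr.
have vv : 0 < dotc v v by rewrite dotc_gt0.
have ww : 0 < dotc w w by rewrite dotc_gt0.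
rewrite -(ler_pM2r (mulr_gt0 vv ww)) mulrBl mul1r divfK ?gt_eqF ?mulr_gt0//.
rewrite mulrA divfK ?gt_eqF//.
have -> : dotc v v * dotc w w - dotc v w ^+ 2 = dotc u u * dotc w w - dotc u w ^+ 2.
  by rewrite vE !dotc_linear (dotcC w u); ring.
by rewrite gerBl sqr_ge0.
Qed.

Lemma angle_c_near_line x v w (a b eps : R) : v != 0 -> w != 0 ->
  normc (v - a *: x) <= eps * normc v -> normc (w - b *: x) <= eps * normc w ->
  angle_c v w <= 8 * eps.
Proof.
move=> v0 w0 v_ax w_bx; have nv : 0 < normc v by rewrite normc_gt0.
have nw : 0 < normc w by rewrite normc_gt0.
have [eps_large|eps_small] := leP (1 / 2) eps.
  by rewrite (le_trans (angle_c_le2 v w))//; lra.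
have eps0 : 0 <= eps by rewrite -(pmulr_lge0 _ nv) (le_trans (normc_ge0 _) v_ax).
have half_eps (z : 'cV[R]_n) : eps * normc z <= 1 / 2 * normc z.
  by rewrite ler_wpM2r ?normc_ge0 ?ltW.
have b_large : normc w / 2 <= normc (b *: x).
  have := normc_dist w (b *: x); rewrite ler_norml => /andP[_].
  by have := half_eps w; lra.
have a_small : normc (a *: x) <= 3 / 2 * normc v.
  have := normc_dist v (a *: x); rewrite ler_norml => /andP[+ _].
  by have := half_eps v; lra.
have b0 : b != 0.
  by apply: contraTneq b_large => ->; rewrite scale0r normc0 -ltNge divr_gt0.
have x0 : 0 < normc x.
  rewrite normc_gt0; apply: contraTneq b_large => ->.
  by rewrite scaler0 normc0 -ltNge divr_gt0.
have ab_le : `|a / b| * normc w <= 3 * normc v.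
  rewrite normcZ in b_large; rewrite normcZ in a_small.
  rewrite normrM normfV mulrAC ler_pdivrMr ?normr_gt0// -(ler_pM2r x0).
  have : `|a| * normc x * normc w <= 3 / 2 * normc v * (2 * (`|b| * normc x)).
    by rewrite ler_pM ?mulr_ge0 ?normc_ge0//; lra.
  by lra.
set u := (v - a *: x) - (a / b) *: (w - b *: x).
have vE : v = (a / b) *: w + u.
  rewrite addrC (_ : u = v - (a / b) *: w) ?subrK//.
  by rewrite /u scalerBr scalerA divfK// opprB addrA subrK.
rewrite (le_trans (angle_c_le_residual v0 w0 vE))//.
rewrite (_ : 8 * eps = 2 * (4 * eps)); last by ring.
rewrite ler_pM2l// ler_pdivrMr// (le_trans (normcB _ _))// normcZ {u vE}.
have : `|a / b| * normc (w - b *: x) <= `|a / b| * normc w * eps.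
  by rewrite -mulrA [normc w * _]mulrC ler_wpM2l.
by have := ler_wpM2r eps0 ab_le; lra.
Qed.

Lemma normc_dist_le_angle v w : normc v = 1 -> normc w = 1 -> 0 <= dotc v w ->
  normc (v - w) <= angle_c v w.
Proof.
move=> v1 w1 vw; rewrite -ler_sqr ?nnegrE ?normc_ge0 ?angle_c_ge0//.
have := acos_sqr_ge (cosine_itv v w); rewrite -/(angle_c v w) v1 w1 mulr1 divr1 ger0_norm//.
by rewrite normc_sqr !dotc_linear (dotcC w v) -!normc_sqr v1 w1; lra.
Qed.

(* The half-space condition rules out that [v] is close to [- w]. *)
Lemma normc_dist_le_angle_halfspace p v w (c : R) : normc v = 1 -> normc w = 1 ->
  c <= pairing p v -> c <= pairing p w -> normrow p * angle_c v w < 2 * c ->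
  normc (v - w) <= angle_c v w.
Proof.
move=> v1 w1 pv pw small; apply: normc_dist_le_angle => //.
rewrite leNgt; apply/negP => vw.
have := @normc_dist_le_angle v (- w) v1; rewrite normcN dotcNr oppr_ge0 => /(_ w1 (ltW vw)).
rewrite opprK angle_cNr => vDw.
have := le_trans (ler_pairing p (v + w)) (ler_wpM2l (normrow_ge0 p) vDw).
by rewrite pairingDr; move: small; lra.
Qed.

End Angle.

Lemma angle_c_le_gap (R : realType) n (g : 'M[R]_n) (c : R) x y :
  (0 < n)%N -> g \in unitmx -> x != 0 -> y != 0 ->
  expR (mu g 0) * normc (invmx g *m x) <= c * normc x ->
  expR (mu g 0) * normc (invmx g *m y) <= c * normc y ->
  angle_c x y <= 8 * c * expR (- (mu g 0 - mu g 1)).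
Proof.
move=> n0 gu x0 y0 gx gy; have [w [p approx]] := rank_one_approximation n0 gu.
have residual z : expR (mu g 0) * normc (invmx g *m z) <= c * normc z ->
    normc (z - pairing p (invmx g *m z) *: w) <= c * expR (- (mu g 0 - mu g 1)) * normc z.
  move=> gz; have := approx (invmx g *m z); rewrite mulKVmx// => /le_trans; apply.
  rewrite [leRHS](_ : _ = expR (mu g 1) * (expR (- mu g 0) * (c * normc z))); last first.
    by rewrite opprB expRD; ring.
  by rewrite ler_pM2l ?expR_gt0// expRN ler_pdivlMl ?expR_gt0.
rewrite -mulrA; exact: (angle_c_near_line x0 y0 (residual x gx) (residual y gy)).
Qed.

Section FlagDistance.
Variables (R : realType) (n : nat).
Implicit Types q : 'cV[R]_n * 'rV[R]_n.

Lemma angle_r_ge0 (p q : 'rV[R]_n) : 0 <= angle_r p q.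
Proof. by rewrite angle_rE angle_c_ge0. Qed.

Lemma angle_c_le_dsym q q' : angle_c q.1 q'.1 <= dsym q q'.
Proof.
rewrite /dsym -{1}(ger0_norm (angle_c_ge0 q.1 q'.1)) -sqrtr_sqr ler_wsqrtr//.
by rewrite lerDl sqr_ge0.
Qed.

Lemma angle_r_le_dsym q q' : angle_r q.2 q'.2 <= dsym q q'.
Proof.
rewrite /dsym -{1}(ger0_norm (angle_r_ge0 q.2 q'.2)) -sqrtr_sqr ler_wsqrtr//.
by rewrite lerDr sqr_ge0.
Qed.

Lemma dsym_le q q' : dsym q q' <= angle_c q.1 q'.1 + angle_r q.2 q'.2.
Proof.
have angle1_ge0 := angle_c_ge0 q.1 q'.1; have angle2_ge0 := angle_r_ge0 q.2 q'.2.
rewrite /dsym -[leRHS](ger0_norm (addr_ge0 angle1_ge0 angle2_ge0)) -sqrtr_sqr ler_wsqrtr//.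
by rewrite sqrrD lerD2r lerDl mulrn_wge0// mulr_ge0.
Qed.

Lemma dsym_ge0 q q' : 0 <= dsym q q'.
Proof. exact: sqrtr_ge0. Qed.

Lemma dsym_scale q q' (a b a' b' : R) : a != 0 -> b != 0 -> a' != 0 -> b' != 0 ->
  dsym (a *: q.1, b *: q.2) (a' *: q'.1, b' *: q'.2) = dsym q q'.
Proof.
move=> a0 b0 a'0 b'0; rewrite /dsym /= angle_c_scale// !angle_rE !linearZ /=.
by rewrite angle_c_scale.
Qed.

End FlagDistance.

(** * Open cones and their projective metric *)

Section ConvexCone.
Variables (R : realType) (n : nat).
Implicit Types (v w x y : 'cV[R]_n) (K : set 'cV[R]_n).

Definition convex_cone K :=
  (forall (t : R) v, 0 < t -> K v -> K (t *: v)) /\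
  (forall v w, K v -> K w -> K (v + w)).

Definition dual_cone K : set 'rV[R]_n :=
  [set p | forall v, K v -> 0 <= pairing p v].

Lemma convex_cone_segment K (s : R) x y : convex_cone K -> 0 <= s <= 1 -> K x -> K y ->
  K ((1 - s) *: x + s *: y).
Proof.
move=> [scaleK addK] /andP[s0 s1] Kx Ky.
have [->|s_neq0] := eqVneq s 0; first by rewrite subr0 scale1r scale0r addr0.
have [->|s_neq1] := eqVneq s 1; first by rewrite subrr scale1r scale0r add0r.
apply: addK; apply: scaleK => //; last by rewrite lt0r s_neq0.
by rewrite subr_gt0 lt_neqAle s_neq1.
Qed.

Lemma convex_cone_closure K : convex_cone K -> convex_cone (closure K).
Proof.
move=> [scaleK addK]; split=> [t v t0 /closure_normcP cv|v w /closure_normcP cv /closure_normcP cw].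
  apply/closure_normcP => e e0; have [v' Kv' v'v] := cv (e / t) (divr_gt0 e0 t0).
  exists (t *: v'); first exact: scaleK.
  by rewrite -scalerBr normcZ gtr0_norm// mulrC -ltr_pdivlMr.
apply/closure_normcP => e e0; have e2 : 0 < e / 2 by rewrite divr_gt0.
have [[v' Kv' v'v] [w' Kw' w'w]] := (cv _ e2, cw _ e2); exists (v' + w'); first exact: addK.
by rewrite opprD addrACA (le_lt_trans (normcD _ _))// [ltRHS]splitr ltrD.
Qed.

Lemma closure_cone0 K v : convex_cone K -> closure K v -> closure K 0.
Proof.
move=> [scaleK _] /closure_normcP cv; have [w Kw _] := cv 1 ltr01.
apply/closure_normcP => e e0; have w0 : 0 < normc w + 1 by rewrite ltr_wpDl// normc_ge0.
exists ((e / (normc w + 1)) *: w); first by apply: scaleK => //; rewrite divr_gt0.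
rewrite subr0 normcZ gtr0_norm ?divr_gt0// mulrAC ltr_pdivrMr// ltr_pM2l//.
by rewrite ltrDl ltr01.
Qed.

Lemma closure_cone_scale_ge0 K (t : R) v : convex_cone K -> 0 <= t ->
  closure K v -> closure K (t *: v).
Proof.
move=> coneK; rewrite le0r => /orP[/eqP ->|t0] cv; last exact: (convex_cone_closure coneK).1.
by rewrite scale0r; exact: closure_cone0 cv.
Qed.

Lemma closure_mulmx m (A : 'M[R]_(m, n)) K (L : set 'cV[R]_m) v :
  (forall w, K w -> L (A *m w)) -> closure K v -> closure L (A *m v).
Proof.
move=> KL /closure_normcP cv; apply/closure_normcP => e e0.
have [c c0 opA] := mulmx_normc_bounded A; have c1 : 0 < c + 1 by rewrite ltr_wpDl.
have [w Kw] := cv (e / (c + 1)) (divr_gt0 e0 c1); rewrite ltr_pdivlMr// => wv.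
exists (A *m w); first exact: KL.
rewrite -mulmxBr (le_lt_trans (opA _))//; have := normc_ge0 (w - v); lra.
Qed.

Lemma dual_closure_ge0 K p v : dual_cone K p -> closure K v -> 0 <= pairing p v.
Proof.
move=> Kp /closure_normcP cv; rewrite leNgt; apply/negP => pv.
have p0 : 0 < normrow p + 1 by rewrite ltr_wpDl// normrow_ge0.
have [|w Kw] := cv (- pairing p v / (normrow p + 1)).
  by rewrite divr_gt0// oppr_gt0.
rewrite ltr_pdivlMr// => wv; have := Kp _ Kw; have := pairing_perturb p w v.
by have := normc_ge0 (w - v); lra.
Qed.

Lemma dual_ball_ge K p v (r : R) : dual_cone K p -> 0 < r ->
  (forall u, normc u <= r -> K (v + u)) -> r * normrow p <= pairing p v.
Proof.
move=> Kp r0 ballK; have [->|p0] := eqVneq p 0.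
  by rewrite normrowE trmx0 normc0 mulr0 pairing0l.
have np : 0 < normrow p by rewrite normrow_gt0.
have := Kp _ (ballK (- ((r / normrow p) *: p^T)) _).
rewrite normcN normcZ -normrowE gtr0_norm ?divr_gt0// divfK ?gt_eqF// => /(_ (lexx _)).
rewrite pairingDr pairingNr pairingZr [pairing p p^T]pairingE -normc_sqr -normrowE subr_ge0.
by move=> /(le_trans _); apply; rewrite expr2 mulrA divfK ?gt_eqF.
Qed.

(* If [pairing p] took both signs, it would vanish at a convex combination. *)
Lemma nonvanishing_functional_sign K (p : 'rV[R]_n) : convex_cone K ->
  (forall v, K v -> pairing p v != 0) ->
  (forall v, K v -> 0 < pairing p v) \/ (forall v, K v -> 0 < pairing (- p) v).
Proof.
move=> [scaleK addK] p_neq0; have [[v [Kv pv]]|no_neg] := pselect (exists v, K v /\ pairing p v < 0).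
  right=> w Kw; rewrite pairingNl oppr_gt0 ltNge le0r negb_or p_neq0//=.
  apply/negP => pw; have /p_neq0 : K (pairing p w *: v + (- pairing p v) *: w).
    by apply: addK; apply: scaleK; rewrite ?oppr_gt0.
  by rewrite pairingDr !pairingZr mulrC mulNr subrr eqxx.
left=> v Kv; rewrite ltNge le_eqVlt negb_or p_neq0//=.
by apply/negP => pv; apply: no_neg; exists v.
Qed.

Definition proper_open_cone (phi : 'rV[R]_n) K :=
  [/\ convex_cone K, open K, ~ K 0
    & exists2 B : R, 0 < B & forall v, K v -> normc v <= B * pairing phi v].

(* [gauge K x y] is the least [a] with [y <= a x] in the order of [closure K]. *)
Definition gauge K x y : R := inf [set a | K (a *: x - y)].

Definition cone_dist K x y : R := ln (gauge K x y * gauge K y x) / 2.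

End ConvexCone.

Section ProperOpenCone.
Variables (R : realType) (n : nat) (phi : 'rV[R]_n) (K : set 'cV[R]_n).
Hypothesis properK : proper_open_cone phi K.
Implicit Types (u v w x y z : 'cV[R]_n) (p : 'rV[R]_n) (a s t : R).
Local Notation M := (gauge K).

Lemma cone_convex : convex_cone K. Proof. by case: properK. Qed.

Lemma cone_scale t v : 0 < t -> K v -> K (t *: v).
Proof. exact: cone_convex.1. Qed.

Lemma cone_add v w : K v -> K w -> K (v + w).
Proof. exact: cone_convex.2. Qed.

Lemma cone_segment s x y : 0 <= s <= 1 -> K x -> K y -> K ((1 - s) *: x + s *: y).
Proof. exact: convex_cone_segment cone_convex. Qed.

Lemma cone_neq0 v : K v -> v != 0.
Proof. by move=> Kv; have [_ _ nK0 _] := properK; apply: contra_notN nK0 => /eqP <-. Qed.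

Lemma cone_closure_bounded :
  exists2 B : R, 0 < B & forall v, closure K v -> normc v <= B * pairing phi v.
Proof.
have [_ _ _ [B B0 boundB]] := properK; exists B => // v /closure_normcP cv.
apply/ler_addgt0Pr => e e0; have k0 : 0 < 1 + B * normrow phi.
  by rewrite ltr_wpDr// mulr_ge0 ?normrow_ge0// ltW.
have [w Kw] := cv _ (divr_gt0 e0 k0); rewrite ltr_pdivlMr// => wv.
have := normc_dist v w; rewrite ler_norml normc_distC => /andP[_ v_le].
have := ler_wpM2l (ltW B0) (pairing_perturb phi w v).
have := boundB _ Kw; move: wv v_le; lra.
Qed.

Lemma cone_pairing_gt0 v : K v -> 0 < pairing phi v.
Proof.
move=> Kv; have [B B0 boundB] := cone_closure_bounded.
rewrite -(pmulr_rgt0 _ B0) (lt_le_trans _ (boundB _ (subset_closure Kv)))//.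
by rewrite normc_gt0 cone_neq0.
Qed.

Lemma cone_functional_dual : dual_cone K phi.
Proof. by move=> v /cone_pairing_gt0/ltW. Qed.

Lemma cone_ball v : K v -> exists2 r : R, 0 < r & forall u, normc u <= r -> K (v + u).
Proof.
move=> Kv; have [_ openK _ _] := properK.
have /nbhs_normcP[e e0 ballK] : nbhs v K by exact: open_nbhs_nbhs.
exists (e / 2); first by rewrite divr_gt0.
by move=> u ue; apply: ballK; rewrite addrC addKr; lra.
Qed.

Lemma cone_add_closure v w : K v -> closure K w -> K (v + w).
Proof.
move=> Kv /closure_normcP cw; have [r r0 ballK] := cone_ball Kv.
have [w' Kw' w'w] := cw r r0.
rewrite -[w](subrK w') addrA; apply: cone_add => //; apply: ballK.
by rewrite normc_distC ltW.
Qed.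

Lemma dual_gt0 p v : p != 0 -> dual_cone K p -> K v -> 0 < pairing p v.
Proof.
move=> p0 Kp /cone_ball[r r0 ballK]; apply: lt_le_trans (dual_ball_ge Kp r0 ballK).
by rewrite mulr_gt0// normrow_gt0.
Qed.

Lemma gauge_pairing_lbound x y a : K x -> K (a *: x - y) ->
  pairing phi y / pairing phi x <= a.
Proof.
move=> /cone_pairing_gt0 px /cone_pairing_gt0.
by rewrite pairingDr pairingNr pairingZr subr_gt0 => /ltW; rewrite ler_pdivrMr.
Qed.

Lemma gauge_has_inf x y : K x -> has_inf [set a | K (a *: x - y)].
Proof.
move=> Kx; split; last first.
  by exists (pairing phi y / pairing phi x) => a; exact: gauge_pairing_lbound.
have [r r0 ballK] := cone_ball Kx.
have e0 : 0 < r / (normc y + 1) by rewrite divr_gt0// ltr_wpDl ?normc_ge0.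
exists (r / (normc y + 1))^-1 => /=; set e := r / _ in e0 *.
rewrite (_ : _ - y = e^-1 *: (x - e *: y)); last first.
  by rewrite scalerBr scalerA mulVf ?scale1r// gt_eqF.
apply: cone_scale; first by rewrite invr_gt0.
apply: ballK; rewrite normcN normcZ gtr0_norm// /e mulrAC.
by rewrite ler_pdivrMr ?ltr_wpDl ?normc_ge0// ler_wpM2l ?(ltW r0)// lerDl.
Qed.

Lemma gauge_ltP x y a : K x -> M x y < a <-> K (a *: x - y).
Proof.
move=> Kx; have inf_xy := gauge_has_inf y Kx; split=> [/(inf_lt inf_xy.1)[b /= Kb ba]|Ka].
  rewrite (_ : a *: x - y = (b *: x - y) + (a - b) *: x); last by rewrite scalerBl addrAC subrKC.
  by apply: cone_add => //; apply: cone_scale; rewrite ?subr_gt0.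
have [r r0 ballK] := cone_ball Ka; have nx : 0 < normc x by rewrite normc_gt0 cone_neq0.
have : K ((a - r / normc x) *: x - y).
  rewrite scalerBl addrAC; apply: ballK.
  by rewrite normcN normcZ gtr0_norm ?divr_gt0// divfK// gt_eqF.
move=> /(ge_inf inf_xy.2) /le_lt_trans; apply.
by rewrite ltrBlDr ltrDl divr_gt0.
Qed.

Lemma gauge_leP x y a : K x -> M x y <= a <-> closure K (a *: x - y).
Proof.
move=> Kx; have nx : 0 < normc x by rewrite normc_gt0 cone_neq0.
split=> [le_a|cl_a]; last first.
  apply/ler_addgt0Pl => e e0; apply/ltW/(gauge_ltP _ _ Kx).
  by rewrite scalerDl -addrA; apply: cone_add_closure => //; exact: cone_scale.
apply/closure_normcP => e e0; exists ((a + e / 2 / normc x) *: x - y).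
  by apply/(gauge_ltP _ _ Kx); rewrite (le_lt_trans le_a)// ltrDl !divr_gt0.
rewrite scalerDl opprB addrA subrK addrC addKr normcZ gtr0_norm ?divr_gt0// divfK ?gt_eqF//; lra.
Qed.

Lemma closure_gauge x y : K x -> closure K (M x y *: x - y).
Proof. by move=> Kx; exact/(gauge_leP _ _ Kx). Qed.

Lemma gauge_pairing p x y : dual_cone K p -> K x -> pairing p y <= M x y * pairing p x.
Proof.
move=> Kp Kx; have := dual_closure_ge0 Kp (@closure_gauge x y Kx).
by rewrite !pairing_linear subr_ge0.
Qed.

Lemma gauge_gt0 x y : K x -> K y -> 0 < M x y.
Proof.
move=> Kx Ky; have px := cone_pairing_gt0 Kx; rewrite -(pmulr_lgt0 _ px).
exact: lt_le_trans (cone_pairing_gt0 Ky) (gauge_pairing _ cone_functional_dual Kx).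
Qed.

Lemma gauge_triangle x y z : K x -> K y -> K z -> M x z <= M x y * M y z.
Proof.
move=> Kx Ky Kz; apply/(gauge_leP _ _ Kx).
rewrite (_ : _ - z = M y z *: (M x y *: x - y) + (M y z *: y - z)); last first.
  by rewrite scalerBr scalerA addrA subrK mulrC.
apply: (convex_cone_closure cone_convex).2; last exact: closure_gauge.
by apply: (convex_cone_closure cone_convex).1; [exact: gauge_gt0|exact: closure_gauge].
Qed.

Lemma gauge_scale s t x y : 0 < s -> 0 < t -> K x -> K y ->
  M (s *: x) (t *: y) = t / s * M x y.
Proof.
move=> s0 t0 Kx Ky; have le_scale s' t' x' y' : 0 < s' -> 0 < t' -> K x' -> K y' ->
    M (s' *: x') (t' *: y') <= t' / s' * M x' y'.
  move=> s'0 t'0 Kx' Ky'; apply/gauge_leP; first exact: cone_scale.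
  rewrite scalerA mulrAC divfK ?gt_eqF// -scalerA -scalerBr.
  apply: (convex_cone_closure cone_convex).1 => //.
  exact: closure_gauge.
apply/le_anti; rewrite le_scale//=.
have := le_scale s^-1 t^-1 (s *: x) (t *: y).
rewrite !scalerA !mulVf ?gt_eqF// !scale1r !invr_gt0 invrK.
move=> /(_ s0 t0 (cone_scale s0 Kx) (cone_scale t0 Ky)).
by rewrite [_ * s]mulrC -ler_pdivrMl ?divr_gt0// invf_div.
Qed.

Lemma gaugexx x : K x -> M x x = 1.
Proof.
move=> Kx; apply/le_anti/andP; split.
  by apply/gauge_leP => //; rewrite scale1r subrr; exact: closure_cone0 cone_convex (subset_closure Kx).
have := gauge_pairing x cone_functional_dual Kx.
by rewrite -ler_pdivrMr ?cone_pairing_gt0// divff// gt_eqF// cone_pairing_gt0.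
Qed.

(* The product of the two values is [M x y]: segments are geodesic. *)
Lemma gauge_segment s x y : 0 <= s <= 1 -> K x -> K y ->
  let p := (1 - s) *: x + s *: y in let a := M x y in
  M x p = 1 - s + s * a /\ M p y = a / (1 - s + s * a).
Proof.
move=> s01 Kx Ky p a; have Kp : K p by exact: cone_segment.
have a0 : 0 < a by exact: gauge_gt0.
move: (s01) => /andP[s0 s1]; set c := 1 - s + s * a.
have c0 : 0 < c.
  rewrite /c; have [->|s_neq0] := eqVneq s 0; first by rewrite subr0 mul0r addr0 ltr01.
  by rewrite ltr_wpDl ?subr_ge0// mulr_gt0// lt0r s_neq0.
have xp : M x p <= c.
  apply/gauge_leP => //; rewrite (_ : _ - p = s *: (a *: x - y)).
    exact/(closure_cone_scale_ge0 cone_convex s0)/closure_gauge.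
  by apply/colP => i; rewrite !mxE /c; ring.
have py : M p y <= a / c.
  apply/gauge_leP => //; rewrite (_ : _ - y = ((1 - s) / c) *: (a *: x - y)).
    apply/(closure_cone_scale_ge0 cone_convex)/closure_gauge => //.
    by rewrite divr_ge0 ?subr_ge0// ltW.
  by apply/colP => i; rewrite !mxE /c; field; rewrite gt_eqF.
have a_le : a <= M x p * M p y by exact: gauge_triangle.
have ca0 : 0 < a / c by rewrite divr_gt0.
split; apply/le_anti/andP; split=> //.
  rewrite -(ler_pM2r ca0) mulrCA divff ?gt_eqF// mulr1 (le_trans a_le)//.
  by rewrite ler_pM2l// gauge_gt0.
by rewrite ler_pdivrMr// mulrC (le_trans a_le)// ler_pM2r// gauge_gt0.
Qed.

End ProperOpenCone.

Section ConeAutomorphism.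
Variables (R : realType) (n : nat) (K : set 'cV[R]_n).
Implicit Types (g h : 'M[R]_n) (x y : 'cV[R]_n).

Definition cone_aut g := g \in unitmx /\ forall v, K (g *m v) <-> K v.

Lemma cone_aut_inv g : cone_aut g -> cone_aut (invmx g).
Proof.
move=> [gu Kg]; split; first by rewrite unitmx_inv.
by move=> v; rewrite -[X in _ <-> K X](mulKVmx gu) Kg.
Qed.

Lemma cone_aut_mul g h : cone_aut g -> cone_aut h -> cone_aut (g *m h).
Proof.
move=> [gu Kg] [hu Kh]; split; first by rewrite unitmx_mul gu.
by move=> v; rewrite -mulmxA Kg Kh.
Qed.

Lemma gauge_aut g x y : cone_aut g -> gauge K (g *m x) (g *m y) = gauge K x y.
Proof.
move=> [_ Kg]; rewrite /gauge; congr inf; apply/seteqP.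
by split=> a /=; rewrite scalemxAr -mulmxBr Kg.
Qed.

Lemma cone_dist_aut g x y : cone_aut g -> cone_dist K (g *m x) (g *m y) = cone_dist K x y.
Proof. by move=> autg; rewrite /cone_dist !gauge_aut. Qed.

Lemma cone_dist_aut_inv g x y : cone_aut g ->
  cone_dist K (g *m x) y = cone_dist K x (invmx g *m y).
Proof. by move=> autg; rewrite -[in LHS](mulKVmx autg.1 y) cone_dist_aut. Qed.

End ConeAutomorphism.

Section ProjectiveMetric.
Variables (R : realType) (n : nat) (phi : 'rV[R]_n) (K : set 'cV[R]_n).
Hypothesis properK : proper_open_cone phi K.
Implicit Types (v w x y z o : 'cV[R]_n) (p q : 'rV[R]_n) (a b k s t : R).
Local Notation M := (gauge K).
Local Notation d := (cone_dist K).

Lemma expR_cone_dist x y : K x -> K y -> expR (2 * d x y) = M x y * M y x.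
Proof.
move=> Kx Ky; rewrite /cone_dist mulrC divfK// lnK// posrE.
by rewrite mulr_gt0// (gauge_gt0 properK).
Qed.

Lemma cone_dist_leE x y a : K x -> K y -> (d x y <= a) = (M x y * M y x <= expR (2 * a)).
Proof. by move=> Kx Ky; rewrite -expR_cone_dist// ler_expR ler_pM2l. Qed.

Lemma cone_distxx x : K x -> d x x = 0.
Proof. by move=> Kx; rewrite /cone_dist (gaugexx properK Kx) mulr1 ln1 mul0r. Qed.

Lemma cone_distC x y : d x y = d y x.
Proof. by rewrite /cone_dist [M x y * _]mulrC. Qed.

Lemma cone_dist_scale s t x y : 0 < s -> 0 < t -> K x -> K y ->
  d (s *: x) (t *: y) = d x y.
Proof.
move=> s0 t0 Kx Ky; rewrite /cone_dist !(gauge_scale properK)//; congr (ln _ / 2).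
by field; rewrite !gt_eqF.
Qed.

Lemma cone_dist_triangle x y z : K x -> K y -> K z -> d x z <= d x y + d y z.
Proof.
move=> Kx Ky Kz; rewrite cone_dist_leE// mulrDr expRD !expR_cone_dist//.
rewrite mulrACA (mulrC (M y x)).
by rewrite ler_pM ?(gauge_triangle properK) ?ltW ?(gauge_gt0 properK).
Qed.

Lemma gauge_segment_rev s x y : 0 <= s <= 1 -> K x -> K y ->
  let p := (1 - s) *: x + s *: y in let b := M y x in
  M y p = s + (1 - s) * b /\ M p x = b / (s + (1 - s) * b).
Proof.
move=> /andP[s0 s1] Kx Ky; have s01 : 0 <= 1 - s <= 1 by rewrite subr_ge0 s1 gerBl.
have := gauge_segment properK s01 Ky Kx.
by rewrite /= subKr addrC.
Qed.

Lemma cone_dist_segmentD s x y : 0 <= s <= 1 -> K x -> K y ->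
  let p := (1 - s) *: x + s *: y in d x p + d p y = d x y.
Proof.
move=> s01 Kx Ky p; have Kp : K p by exact: (cone_segment properK).
apply: (mulfI (lt0r_neq0 (ltr0n R 2))); apply: expR_inj.
rewrite mulrDr expRD !expR_cone_dist//.
have [xp py] := gauge_segment properK s01 Kx Ky.
have [yp px] := gauge_segment_rev s01 Kx Ky.
have c0 : 0 < 1 - s + s * M x y by rewrite -xp (gauge_gt0 properK).
have c'0 : 0 < s + (1 - s) * M y x by rewrite -yp (gauge_gt0 properK).
by rewrite /p xp py yp px; field; rewrite !gt_eqF.
Qed.

Lemma cone_dist_segment_surj x y t : K x -> K y -> 0 <= t <= d x y ->
  exists2 s, 0 <= s <= 1 & d x ((1 - s) *: x + s *: y) = t.
Proof.
move=> Kx Ky /andP[]; rewrite le0r => /orP[/eqP-> _|t0 td].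
  by exists 0; rewrite ?lexx ?ler01// subr0 scale1r scale0r addr0 cone_distxx.
have a0 := gauge_gt0 properK Kx Ky; have b0 := gauge_gt0 properK Ky Kx.
have E1 : 1 < expR (2 * t) by rewrite -expR0 ltr_expR mulr_gt0.
have Eab : expR (2 * t) <= M x y * M y x by rewrite -expR_cone_dist// ler_expR ler_pM2l.
set E := expR (2 * t) in E1 Eab; set a := M x y in a0 Eab; set b := M y x in b0 Eab.
(* [s] solves [(1 - s + s a) b = E (s + (1 - s) b)]. *)
pose D := (a * b - E) + b * (E - 1); pose s := b * (E - 1) / D.
have D0 : 0 < D by rewrite ltr_wpDl ?subr_ge0// mulr_gt0// subr_gt0.
have s01 : 0 <= s <= 1.
  rewrite divr_ge0 ?mulr_ge0 ?subr_ge0 ?(ltW b0) ?(ltW D0) ?(ltW E1)//= ler_pdivrMr// mul1r.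
  by rewrite /D lerDr subr_ge0.
exists s => //; have Kp : K ((1 - s) *: x + s *: y) by exact: (cone_segment properK).
apply: (mulfI (lt0r_neq0 (ltr0n R 2))); apply: expR_inj; rewrite expR_cone_dist//.
have [xp _] := gauge_segment properK s01 Kx Ky.
have [yp px] := gauge_segment_rev s01 Kx Ky.
have c0 : 0 < s + (1 - s) * b by rewrite -yp (gauge_gt0 properK).
rewrite xp px -/a -/b -/E mulrA; apply: (mulIf (lt0r_neq0 c0)); rewrite divfK ?gt_eqF//.
have sD : s * D = b * (E - 1) by rewrite /s divfK// gt_eqF.
by move: sD; rewrite /D; clear; lra.
Qed.

Lemma cone_dist_cross_ratio p q x y : dual_cone K p -> dual_cone K q -> K x -> K y ->
  pairing p x * pairing q y <= expR (2 * d x y) * (pairing p y * pairing q x).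
Proof.
move=> Kp Kq Kx Ky; rewrite expR_cone_dist// [M x y * _]mulrC mulrACA.
by rewrite ler_pM ?Kp ?Kq// (gauge_pairing properK).
Qed.

Lemma cone_dist_locally_le1 w : K w -> exists2 r : R, 0 < r &
  forall v, normc (v - w) <= r -> K v /\ d w v <= 1.
Proof.
move=> Kw; have [r r0 ballK] := cone_ball properK Kw.
exists (r / 2) => [|v vw]; first by rewrite divr_gt0.
have Kv : K v by rewrite -[v](subrK w) addrC; apply: ballK; lra.
have gauge_wv : M w v <= 2.
  apply/(gauge_leP properK)/subset_closure => //.
  rewrite (_ : 2 *: w - v = w + (w - v)); last by rewrite scaler_nat mulr2n addrA.
  by apply: ballK; rewrite normc_distC; lra.
have gauge_vw : M v w <= 2.
  apply/(gauge_leP properK)/subset_closure => //.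
  rewrite (_ : 2 *: v - w = w + 2 *: (v - w)); last first.
    by apply/colP => i; rewrite !mxE; ring.
  by apply: ballK; rewrite normcZ gtr0_norm//; lra.
split=> //; rewrite cone_dist_leE// mulr1.
have /le_trans : M w v * M v w <= 2 * 2 by rewrite ler_pM// ltW// (gauge_gt0 properK).
apply; rewrite (_ : 2 = 1 + 1 :> R)// expRD ler_pM//; have := expR_ge1Dx (1 : R); lra.
Qed.

Lemma cone_dist_locally_bounded o w : K o -> K w ->
  exists N : nat, nbhs w [set v | K v /\ d o v <= N%:R].
Proof.
move=> Ko Kw; have [r r0 ballK] := cone_dist_locally_le1 Kw.
exists (Num.truncn (d o w + 1)).+1; apply/nbhs_normcP; exists r => // v /ltW/ballK[Kv wv].
split=> //; have := cone_dist_triangle Ko Kw Kv.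
by have := truncnS_gt (d o w + 1); move: wv; lra.
Qed.

(* The part of the cone where [p / phi] is at most [k] times its value at [o]. *)
Definition cap o p k : set 'cV[R]_n :=
  [set w | K w /\ pairing p w * pairing phi o <= k * (pairing p o * pairing phi w)].

Lemma cap_segment o p k s x y : 0 <= s <= 1 -> cap o p k x -> cap o p k y ->
  cap o p k ((1 - s) *: x + s *: y).
Proof.
move=> s01 [Kx px] [Ky py]; split; first exact: (cone_segment properK).
move: s01 => /andP[s0]; rewrite -subr_ge0 => s1.
have := lerD (ler_wpM2l s1 px) (ler_wpM2l s0 py).
by rewrite !pairingDr !pairingZr; lra.
Qed.

Lemma cap_dist_ge o p k w : K o -> p != 0 -> dual_cone K p -> 0 < k -> cap o p k w ->
  - ln k / 2 <= d o w.
Proof.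
move=> Ko p0 Kp k0 [Kw cap_w]; have po := dual_gt0 properK p0 Kp Ko.
have fw := cone_pairing_gt0 properK Kw; set c := pairing p o * pairing phi w in cap_w.
have c0 : 0 < c by rewrite mulr_gt0.
have := cone_dist_cross_ratio Kp (cone_functional_dual properK) Ko Kw.
move=> /le_trans/(_ (ler_wpM2l (expR_ge0 _) cap_w)).
rewrite mulrA -[leLHS]mul1r ler_pM2r// -{1}[k]lnK ?posrE// -expRD -expR0 ler_expR.
by rewrite ler_pdivrMr//; lra.
Qed.

End ProjectiveMetric.

Section SupportingFunctional.
Variables (R : realType) (n : nat).
Implicit Types (u v x q : 'cV[R]_n) (K L : set 'cV[R]_n).

Lemma closed_closest_point L x : closed L -> L !=set0 ->
  exists2 q, L q & forall v, L v -> normc (q - x) <= normc (v - x).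
Proof.
move=> closedL [a La]; pose A := L `&` [set v | normc (v - x) <= normc (a - x)].
have compactA : compact A.
  apply: (@closed_normc_bounded_compact _ _ _ (normc (a - x) + normc x)) => [|v [_ /= vx]].
    apply: closedI => //.
    rewrite (_ : [set _ | _] = (fun v => normc (v - x)) @^-1` [set y | y <= normc (a - x)])//.
    by apply: closed_comp => [z _|]; [exact: normcB_continuous|exact: closed_le].
  by rewrite -[v](subrK x) (le_trans (normcD _ _))// lerD2r.
have [|q] := compact_EVT_min _ compactA (continuous_subspaceT (@normcB_continuous _ _ x)).
  by exists a; split=> //=.
rewrite inE => -[Lq /= qa] minq; exists q => // v Lv.
have [vx|/ltW vx] := leP (normc (v - x)) (normc (a - x)); last exact: le_trans vx.
by apply: minq; rewrite inE.
Qed.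

Lemma dotc_ge0_of_minimum u v :
  (forall t : R, 0 < t -> t <= 1 -> normc u <= normc (u + t *: v)) -> 0 <= dotc u v.
Proof.
move=> minu; rewrite leNgt; apply/negP => uv; have vv := dotc_ge0 v.
have b0 : 0 < dotc v v + 1 by rewrite ltr_wpDl.
pose t := Num.min 1 (- dotc u v / (dotc v v + 1)).
have t0 : 0 < t by rewrite lt_min ltr01 divr_gt0// oppr_gt0.
have t1 : t <= 1 by rewrite ge_min lexx.
have tb : t * (dotc v v + 1) <= - dotc u v by rewrite -ler_pdivlMr// ge_min lexx orbT.
have := minu t t0 t1; rewrite -ler_sqr ?nnegrE ?normc_ge0// !normc_sqr !dotc_linear.
rewrite (dotcC v u) => min_t.
have : 0 <= t * (2 * dotc u v + t * dotc v v) by move: min_t; lra.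
by rewrite pmulr_rge0//; move: tb uv t0; lra.
Qed.

Lemma closed_cone_separation L x : closed L -> convex_cone L -> L 0 -> ~ L x ->
  exists2 p, dual_cone L p & pairing p x < 0.
Proof.
move=> closedL coneL L0 Lx; have [|q Lq minq] := closed_closest_point x closedL; first by exists 0.
have u0 : q - x != 0 by rewrite subr_eq0; apply: contra_notN Lx => /eqP <-.
have dotc_u v : (forall t : R, 0 < t -> t <= 1 -> L (q + t *: v)) -> 0 <= dotc (q - x) v.
  move=> Lqv; apply: dotc_ge0_of_minimum => t t0 t1.
  by rewrite addrAC; exact/minq/Lqv.
exists (q - x)^T => [v Lv|]; rewrite pairingE trmxK.
  by apply: dotc_u => t t0 _; apply: coneL.2 => //; exact: coneL.1.
have : 0 <= dotc (q - x) (- q).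
  apply: dotc_u => t t0; rewrite le_eqVlt => /orP[/eqP->|t1].
    by rewrite scale1r subrr.
  by rewrite scalerN -[X in X - _]scale1r -scalerBl; apply: coneL.1; rewrite ?subr_gt0.
rewrite dotcNr oppr_ge0 -[X in dotc _ X < 0](subKr q) dotcDr dotcNr => uq.
by have := u0; rewrite -dotc_gt0; lra.
Qed.

Lemma unit_dual_compact K : compact [set v | normc v = 1 /\ dual_cone K v^T].
Proof.
rewrite (_ : [set _ | _] = [set v | normc v = 1] `&`
  \bigcap_(w in K) (pairing w^T @^-1` [set r | 0 <= r])).
  apply: (@closed_normc_bounded_compact _ _ _ 1); last by move=> v [-> _].
  apply: closedI; first exact: closed_unit_sphere.
  apply: closed_bigI => w _; apply: closed_comp => [z _|]; last exact: closed_ge.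
  exact: pairing_continuous.
by apply/seteqP; split=> v [v1 Kv]; split=> // w Kw; have := Kv w Kw;
  rewrite /= !pairingE !trmxK dotcC.
Qed.

(* If every unit dual functional were at least [e |o|] at [x], then [x - e o]
   would still lie in the closed cone, and [x] in the open one. *)
Lemma supporting_functional phi K x : proper_open_cone phi K -> closure K x -> ~ K x ->
  exists p, [/\ dual_cone K p, normrow p = 1 & pairing p x = 0].
Proof.
move=> properK cx nKx; have coneK := cone_convex properK.
have [ o Ko] : exists o, K o by have [ o []] := cx setT filterT; exists o.
have no : 0 < normc o by rewrite normc_gt0 (cone_neq0 properK).
have small_unit_dual e : 0 < e ->
    exists v, [/\ normc v = 1, dual_cone K v^T & pairing x^T v < e].
  move=> e0; pose c := e / normc o; have c0 : 0 < c by rewrite divr_gt0.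
  have ncx : ~ closure K (x - c *: o).
    move=> /(cone_add_closure properK (cone_scale properK c0 Ko)).
    by rewrite addrC subrK.
  have [|p dual_p px] := closed_cone_separation (@closed_closure _ K)
    (convex_cone_closure coneK) _ ncx.
    exact: closure_cone0 cx.
  have p0 : p != 0 by apply: contraTneq px => ->; rewrite pairing0l ltxx.
  exists ((normrow p)^-1 *: p^T); split.
  - by rewrite -normrow_tr linearZ /= trmxK normrow_normalize.
  - move=> v Kv; rewrite linearZ /= trmxK pairingZl mulr_ge0 ?invr_ge0 ?normrow_ge0//.
    exact/dual_p/subset_closure.
  rewrite pairingZr pairingE trmxK dotcC -pairingE ltr_pdivrMl ?normrow_gt0//.
  move: px; rewrite pairingDr pairingNr pairingZr subr_lt0 => /lt_le_trans; apply.
  have := ler_wpM2l (ltW c0) (ler_pairing p o).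
  by rewrite /c mulrCA divfK ?gt_eqF// mulrC [normrow p * _]mulrC.
have [|v] := compact_EVT_min _ (@unit_dual_compact K)
  (continuous_subspaceT (@pairing_continuous _ _ x^T)).
  by have [v [v1 Kv _]] := small_unit_dual 1 ltr01; exists v.
rewrite inE => -[v1 Kv] minv; exists v^T; split; rewrite ?normrow_tr//.
have xvE w : pairing x^T w = pairing w^T x by rewrite !pairingE !trmxK dotcC.
apply/le_anti/andP; split; last exact: dual_closure_ge0 Kv cx.
apply/ler_addgt0Pr => e e0; rewrite add0r -xvE.
have [w [w1 Kw /ltW xw]] := small_unit_dual e e0.
by apply: le_trans xw; apply: minv; rewrite inE.
Qed.

End SupportingFunctional.

Section GromovHyperbolicity.
Variables (R : realType) (T : Type) (X : set T) (d : T -> T -> R) (delta : R).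
Implicit Types o m w x y z : T.

Definition delta_hyperbolic := forall x y z w, X x -> X y -> X z -> X w ->
  Num.min (gromov_product d w x y) (gromov_product d w y z) - delta <= gromov_product d w x z.

Hypothesis hypX : delta_hyperbolic.
Hypothesis d_sym : forall x y, d x y = d y x.

(* [w] is the point of the side [y, z] facing [o] in the comparison tripod. *)
Lemma internal_point_dist_le o w y z : X o -> X w -> X y -> X z ->
  d y w = gromov_product d y o z -> d y w + d w z = d y z ->
  d o w <= gromov_product d o y z + 2 * delta.
Proof.
move=> Xo Xw Xy Xz yw wz; have := hypX Xy Xo Xz Xw.
move: yw wz; rewrite /gromov_product !(d_sym w) !(d_sym y) !(d_sym z) => yw wz.
by rewrite lerBlDr ge_min => /orP[]; lra.
Qed.

Lemma geodesic_point_dist_le o m y z (e : R) : X o -> X m -> X y -> X z ->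
  d o m + d m y = d o y -> 0 <= e -> d o m - e <= gromov_product d o y z ->
  d m z <= d o z - d o m + 2 * e + 2 * delta.
Proof.
move=> Xo Xm Xy Xz omy e0; have := hypX Xm Xy Xz Xo.
by rewrite /gromov_product lerBlDr ge_min => /orP[]; lra.
Qed.

End GromovHyperbolicity.

(** * The Hilbert distance *)

Lemma sup_reflect (R : realType) (J : set R) (c : R) : has_inf J ->
  sup [set c - t | t in J] = c - inf J.
Proof.
move=> /has_inf_supN supN.
rewrite (_ : [set _ | _ in _] = [set x + y | x in [set c] & y in -%R @` J]).
  by rewrite sup_sumE// ?sup1 /inf ?opprK//; exact: has_sup1.
apply/seteqP; split=> [_ [t Jt <-]|_ [_ -> [_ [t Jt <-]] <-]]; last by exists t.
by exists c => //; exists (- t) => //; exists t.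
Qed.

Section PositiveCone.
Variables (R : realType) (n : nat) (Om : set 'cV[R]_n).
Hypothesis convexOm : properly_convex_open Om.
Implicit Types (x y v w : 'cV[R]_n) (t : R).
Local Notation phi := (chart Om).

Definition positive_part (p : 'rV[R]_n) (X : set 'cV[R]_n) : set 'cV[R]_n :=
  [set v | X v /\ 0 < pairing p v].

Lemma positive_part_convex_cone p (X : set 'cV[R]_n) :
  (forall v t, X v -> t != 0 -> X (t *: v)) ->
  (forall v w t, chart_slice p X v -> chart_slice p X w -> 0 <= t <= 1 ->
    X ((1 - t) *: v + t *: w)) ->
  convex_cone (positive_part p X).
Proof.
move=> scaleX convX; split=> [t v t0 [Xv pv]|v w [Xv pv] [Xw pw]].
  by split; [apply: scaleX; rewrite ?gt_eqF|rewrite pairingZr mulr_gt0].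
have slice u : X u -> 0 < pairing p u -> chart_slice p X ((pairing p u)^-1 *: u).
  move=> Xu pu; split; last by rewrite pairingZr mulVf// gt_eqF.
  by apply: scaleX; rewrite // invr_eq0 gt_eqF.
set c := pairing p v + pairing p w; have c0 : 0 < c by rewrite addr_gt0.
split; last by rewrite pairingDr.
have := convX _ _ (pairing p w / c) (slice v Xv pv) (slice w Xw pw).
rewrite divr_ge0 ?(ltW pw) ?(ltW c0)//= ler_pdivrMr// mul1r lerDr (ltW pv) => /(_ isT) Xvw.
have := scaleX _ c Xvw (lt0r_neq0 c0); rewrite scalerDr !scalerA.
by congr (X (_ + _)); rewrite -[RHS]scale1r; congr (_ *: _); rewrite /c; field; rewrite !gt_eqF.
Qed.

Definition positive_cone := positive_part phi Om.
Local Notation K := positive_cone.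
Local Notation M := (gauge K).

Lemma chartP : good_chart phi Om.
Proof. by case: convexOm => _ [_ [_ ex_chart]]; exact: (xgetPex 0 ex_chart). Qed.

Lemma chart_neq0 v : Om v -> pairing phi v != 0.
Proof. by case: chartP => + _; apply. Qed.

Lemma domain_scale v t : Om v -> t != 0 -> Om (t *: v).
Proof. by case: convexOm => -[_ scaleOm] _; exact: scaleOm. Qed.

Lemma domainN v : Om v -> Om (- v).
Proof.
by rewrite -scaleN1r => Ov; apply: domain_scale => //; rewrite oppr_eq0 oner_eq0.
Qed.

Lemma positive_cone_proper : proper_open_cone phi K.
Proof.
have [_ [convOm [B boundB]]] := chartP; have [_ [openOm _]] := convexOm.
split; first exact: positive_part_convex_cone domain_scale convOm.
- rewrite (_ : K = Om `&` (pairing phi @^-1` [set r | 0 < r]))//; apply: openI => //.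
  by apply: open_comp => [x _|]; [exact: pairing_continuous|exact: open_gt].
- by move=> [_]; rewrite pairing0r ltxx.
exists (`|B| + 1) => [|v [Ov pv]]; first by rewrite ltr_wpDl.
have := boundB ((pairing phi v)^-1 *: v).
rewrite normcZ ger0_norm ?invr_ge0 ?(ltW pv)// ler_pdivrMl// mulrC => /(_ _)/le_trans; apply.
  split; last by rewrite pairingZr mulVf// gt_eqF.
  by apply: domain_scale; rewrite // invr_eq0 gt_eqF.
by rewrite ler_wpM2r ?(ltW pv)// (le_trans (ler_norm B))// lerDl.
Qed.

Lemma domain_positive_cone v : Om v -> K v \/ K (- v).
Proof.
move=> Ov; have := chart_neq0 Ov; rewrite neq_lt => /orP[pv|pv]; [right|left]; split=> //.
  exact: domainN.
by rewrite pairingNr oppr_gt0.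
Qed.

Lemma chart_slice_normalize v : K v -> chart_slice phi K (normalize phi v).
Proof.
move=> Kv; have pv := Kv.2; rewrite /normalize; split.
  by apply: (cone_scale positive_cone_proper); rewrite ?invr_gt0.
by rewrite pairingZr mulVf// gt_eqF.
Qed.

Section Chord.
Variables x y : 'cV[R]_n.
Hypotheses (slice_x : chart_slice phi K x) (slice_y : chart_slice phi K y) (x_neq_y : x != y).

Lemma gauge_slice_gt1 : 1 < M x y.
Proof.
have [[Kx px] [Ky py]] := (slice_x, slice_y).
rewrite ltNge; apply: contra x_neq_y => /(gauge_leP positive_cone_proper _ _ Kx).
rewrite scale1r -subr_eq0 -normc_eq0 => cxy.
have [B B0 /(_ _ cxy)] := cone_closure_bounded positive_cone_proper.
rewrite pairingDr pairingNr px py subrr mulr0 => xy_le0.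
by apply/eqP/le_anti; rewrite xy_le0 normc_ge0.
Qed.

Lemma chordE t : Om (x + t *: (y - x)) <-> K (x + t *: (y - x)).
Proof.
split=> [Omt|[]//]; split=> //; have [[_ px] [_ py]] := (slice_x, slice_y).
by rewrite pairingDr pairingZr pairingDr pairingNr px py subrr mulr0 addr0.
Qed.

Lemma chord_negative t : t < 0 -> Om (x + t *: (y - x)) <-> - (M x y - 1)^-1 < t.
Proof.
move=> t0; have [Kx _] := slice_x; have m1 := gauge_slice_gt1.
have properK := positive_cone_proper; have Nt0 : 0 < - t by rewrite oppr_gt0.
have pointE : x + t *: (y - x) = (- t) *: (((1 - t) / - t) *: x - y).
  by apply/colP => i; rewrite !mxE; field; rewrite ?oppr_eq0 lt_eqF.
rewrite chordE pointE (_ : (- _ < t) = (M x y < (1 - t) / - t)); last first.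
  rewrite ltr_pdivlMr// ltrNl -[(_ - 1)^-1]mul1r ltr_pdivlMr ?subr_gt0//.
  by apply/idP/idP; lra.
rewrite (gauge_ltP properK)//; split=> [Kt|]; last exact: (cone_scale properK).
have Vt0 : 0 < (- t)^-1 by rewrite invr_gt0.
by have := cone_scale properK Vt0 Kt; rewrite scalerA mulVf ?scale1r// gt_eqF.
Qed.

Lemma chord_lbound : lbound [set t | Om (x + t *: (y - x))] (- (M x y - 1)^-1).
Proof.
move=> t Omt; have [t0|t0] := leP 0 t; last exact/ltW/(chord_negative t0).
by rewrite (le_trans _ t0)// oppr_le0 invr_ge0 subr_ge0 ltW// gauge_slice_gt1.
Qed.

Lemma chord_inf : inf [set t | Om (x + t *: (y - x))] = - (M x y - 1)^-1.
Proof.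
set I := [set _ | _]; have V0 : 0 < (M x y - 1)^-1 by rewrite invr_gt0 subr_gt0 gauge_slice_gt1.
have lbI : lbound I (- (M x y - 1)^-1) by exact: chord_lbound.
have I0 : I !=set0 by exists 0; rewrite /I /= scale0r addr0; case: slice_x => -[].
apply/le_anti; rewrite lb_le_inf// andbT leNgt; apply/negP => lt_inf.
pose t := (- (M x y - 1)^-1 + Num.min (inf I) 0) / 2.
have V_min : - (M x y - 1)^-1 < Num.min (inf I) 0 by rewrite lt_min lt_inf oppr_lt0.
have /andP[t_inf t0] : (t < inf I) && (t < 0) by rewrite -lt_min /t; lra.
have It : I t by apply/(chord_negative t0); rewrite /t; lra.
have : inf I <= t by apply: ge_inf => //; exists (- (M x y - 1)^-1).
by rewrite leNgt t_inf.
Qed.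

End Chord.

Lemma chord_sup x y : chart_slice phi K x -> chart_slice phi K y -> x != y ->
  sup [set t | Om (x + t *: (y - x))] = 1 + (M y x - 1)^-1.
Proof.
move=> slice_x slice_y x_neq_y; have y_neq_x : y != x by rewrite eq_sym.
rewrite -[_^-1]opprK -(chord_inf slice_y slice_x y_neq_x); set J := [set t | Om (y + _)].
rewrite (_ : [set t | _] = [set 1 - t | t in J]); last first.
  have reflect t : x + t *: (y - x) = y + (1 - t) *: (x - y).
    by apply/colP => i; rewrite !mxE; ring.
  apply/seteqP; split=> [t /= Omt|_ [t Jt <-] /=]; last by rewrite reflect subKr.
  by exists (1 - t); rewrite ?subKr// /J /= -reflect.
rewrite sup_reflect//; split; first by exists 0; rewrite /J /= scale0r addr0; case: slice_y => -[].
by exists (- (M y x - 1)^-1); exact: chord_lbound.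
Qed.

Lemma hilbert_distE x y : K x -> K y -> hilbert_dist Om x y = cone_dist K x y.
Proof.
move=> Kx Ky; have properK := positive_cone_proper.
have slice_x := chart_slice_normalize Kx; have slice_y := chart_slice_normalize Ky.
rewrite -(@cone_dist_scale _ _ _ _ properK (pairing phi x)^-1 (pairing phi y)^-1 x y)
  ?invr_gt0//; last first.
- by case: Ky.
- by case: Kx.
rewrite -/(normalize phi x) -/(normalize phi y) /hilbert_dist /cone_dist.
move: (normalize phi x) (normalize phi y) slice_x slice_y => {Kx Ky x}x {y}y slice_x slice_y.
case: eqP => [<-|/eqP x_neq_y]; first by rewrite (gaugexx properK slice_x.1) mulr1 ln1 mul0r.
have y_neq_x : y != x by rewrite eq_sym.
rewrite chord_inf// chord_sup//; congr (ln _ / 2).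
have a1 := gauge_slice_gt1 slice_x slice_y x_neq_y.
have b1 := gauge_slice_gt1 slice_y slice_x y_neq_x.
set a := M x y in a1 *; set b := M y x in b1 *.
have nxy : 0 < normc (y - x) by rewrite normc_gt0 subr_eq0.
have A0 : 0 < (a - 1)^-1 by rewrite invr_gt0 subr_gt0.
have B0 : 0 < (b - 1)^-1 by rewrite invr_gt0 subr_gt0.
have -> : x + (1 + (b - 1)^-1) *: (y - x) - x = (1 + (b - 1)^-1) *: (y - x).
  by rewrite addrC addKr.
have -> : y - (x + - (a - 1)^-1 *: (y - x)) = (1 + (a - 1)^-1) *: (y - x).
  by apply/colP => i; rewrite !mxE; ring.
have -> : x + - (a - 1)^-1 *: (y - x) - x = - (a - 1)^-1 *: (y - x).
  by rewrite addrC addKr.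
have -> : x + (1 + (b - 1)^-1) *: (y - x) - y = (b - 1)^-1 *: (y - x).
  by apply/colP => i; rewrite !mxE; ring.
rewrite !normcZ normrN !gtr0_norm ?addr_gt0//.
by field; rewrite !gt_eqF// ?subr_gt0//; lra.
Qed.

End PositiveCone.

(** * Singular values of cone automorphisms *)

Section SingularValuesOfConeAutomorphisms.
Variables (R : realType) (n : nat) (phi : 'rV[R]_n) (K : set 'cV[R]_n) (o : 'cV[R]_n).
Hypotheses (properK : proper_open_cone phi K) (Ko : K o).
Implicit Types (u v : 'cV[R]_n) (g : 'M[R]_n).
Local Notation M := (gauge K).
Local Notation d := (cone_dist K).

Lemma cone_dim_gt0 : (0 < n)%N.
Proof.
rewrite lt0n; apply/eqP => n0; case: properK => _ _ + _; apply.
by congr (K _) : Ko; apply/colP => i; have := ltn_ord i; rewrite {2}n0.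
Qed.

Lemma normc_cone_aut_le : exists2 c : R, 0 < c & forall g u, cone_aut K g ->
  normc (g *m u) <= c * pairing phi (g *m o) * normc u.
Proof.
have [r r0 ballK] := cone_ball properK Ko.
have [B B0 boundB] := cone_closure_bounded properK.
exists (B / r) => [|g u [_ Kg]]; first by rewrite divr_gt0.
have [->|u0] := eqVneq u 0; first by rewrite mulmx0 normc0 mulr0.
have nu : 0 < normc u by rewrite normc_gt0.
pose w := (r / normc u) *: u.
have nw : normc w <= r by rewrite normcZ gtr0_norm ?divr_gt0// divfK// gt_eqF.
have Kow : K (g *m (o + w)) by apply/Kg/ballK.
have Ko_w : K (g *m (o - w)) by apply/Kg/ballK; rewrite normcN.
have sumE : (o + w) + (o - w) = 2 *: o by apply/colP => i; rewrite !mxE; ring.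
have diffE : (o + w) - (o - w) = 2 *: w by apply/colP => i; rewrite !mxE; ring.
have := lerD (boundB _ (subset_closure Kow)) (boundB _ (subset_closure Ko_w)).
rewrite -mulrDr -pairingDr -mulmxDr sumE -scalemxAr pairingZr.
move=> /(le_trans (normcB _ _)); rewrite -mulmxBr diffE -!scalemxAr !normcZ.
rewrite gtr0_norm// (gtr0_norm (divr_gt0 r0 nu)) => two_gu.
rewrite -(ler_pM2l (divr_gt0 r0 nu)) -(ler_pM2l (ltr0n R 2)) (le_trans two_gu)//.
by rewrite le_eqVlt; apply/orP; left; apply/eqP; field; rewrite !gt_eqF.
Qed.

Lemma expR_mu0_le_pairing : exists2 c : R, 0 < c &
  forall g, cone_aut K g -> expR (mu g 0) <= c * pairing phi (g *m o).
Proof.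
have [c c0 norm_le] := normc_cone_aut_le; exists c => // g autg.
have [u u1 <-] := normc_mulmx_attained cone_dim_gt0 autg.1.
by rewrite (le_trans (norm_le g u autg))// u1 mulr1.
Qed.

Lemma gauge_base_le_normc : exists2 c : R, 0 < c & forall v, K v -> M o v <= c * normc v.
Proof.
have [r r0 ballK] := cone_ball properK Ko.
exists r^-1 => [|v Kv]; first by rewrite invr_gt0.
have nv : 0 < normc v by rewrite normc_gt0 (cone_neq0 properK).
apply/(gauge_leP properK)/subset_closure => //.
have a0 : 0 < r^-1 * normc v by rewrite mulr_gt0// invr_gt0.
rewrite (_ : _ - v = (r^-1 * normc v) *: (o - (r^-1 * normc v)^-1 *: v)); last first.
  by rewrite scalerBr scalerA divff ?scale1r// gt_eqF.
apply: (cone_scale properK a0); apply: ballK.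
by rewrite normcN normcZ gtr0_norm ?invr_gt0// invfM invrK divfK// gt_eqF.
Qed.

Lemma cone_dist_le_mu : exists c : R, forall g, cone_aut K g ->
  d o (g *m o) <= (mu g 0 - mu g n.-1) / 2 + c.
Proof.
have [c c0 gauge_le] := gauge_base_le_normc.
have no : 0 < normc o by rewrite normc_gt0 (cone_neq0 properK).
exists (ln (c * normc o)) => g autg.
have gauge_aut_le h : cone_aut K h -> M o (h *m o) <= c * normc o * expR (mu h 0).
  move=> [hu Kh]; rewrite (le_trans (gauge_le _ _))//; first exact/Kh.
  by rewrite -mulrA ler_pM2l// mulrC (normc_mulmx_le cone_dim_gt0).
have autgi := cone_aut_inv autg; have Kgo : K (g *m o) by apply/autg.2.
rewrite (cone_dist_leE properK)//.
have -> : M (g *m o) o = M o (invmx g *m o).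
  by rewrite -(gauge_aut _ _ autgi) mulKmx// autg.1.
apply: le_trans (_ : (c * normc o * expR (mu g 0)) * (c * normc o * expR (- mu g n.-1)) <= _).
  rewrite -(mu_invmx cone_dim_gt0 autg.1) ler_pM ?gauge_aut_le ?ltW// (gauge_gt0 properK)//.
  exact/autgi.2.
rewrite -[c * _]lnK ?posrE ?mulr_gt0// -!expRD ler_expR expRK; lra.
Qed.

Lemma mu_le_cone_dist : exists c : R, forall g, cone_aut K g ->
  mu g 0 + mu (invmx g) 0 <= 2 * d o (g *m o) + c.
Proof.
have [c c0 expR_mu_le] := expR_mu0_le_pairing.
have po := cone_pairing_gt0 properK Ko; have k0 : 0 < c * pairing phi o by rewrite mulr_gt0.
exists (2 * ln (c * pairing phi o)) => g autg.
have autgi := cone_aut_inv autg; have Kgo : K (g *m o) by apply/autg.2.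
have expR_mu_gauge h : cone_aut K h -> expR (mu h 0) <= c * pairing phi o * M o (h *m o).
  move=> auth; apply: le_trans (expR_mu_le h auth) _; rewrite -mulrA ler_pM2l// mulrC.
  exact: (gauge_pairing properK _ (cone_functional_dual properK)).
rewrite -ler_expR !expRD (expR_cone_dist properK)//.
have -> : M (g *m o) o = M o (invmx g *m o).
  by rewrite -(gauge_aut _ _ autgi) mulKmx// autg.1.
have := ler_pM (expR_ge0 _) (expR_ge0 _) (expR_mu_gauge g autg) (expR_mu_gauge _ autgi).
rewrite mulrACA => /le_trans; apply; rewrite mulrC ler_wpM2l//.
  by rewrite mulr_ge0// ltW// (gauge_gt0 properK)//; exact/autgi.2.
by rewrite mulr_natl mulr2n expRD lnK.
Qed.

End SingularValuesOfConeAutomorphisms.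

Section DiscreteGroup.
Variables (R : realType) (n : nat).
Implicit Types (A g : 'M[R]_n) (G : set 'M[R]_n).

Lemma finite_set_inj_in (T : Type) (F : finType) (E : set T) (f : T -> F) :
  {in E &, injective f} -> finite_set E.
Proof. by move=> /inj_card_eq/eq_finite_set <-; exact: finite_finset. Qed.

Lemma bounded_separated_finite (T eps : R) (E : set 'M[R]_n) : 0 < eps ->
  (forall A, E A -> forall i j, `|A i j| <= T) ->
  (forall A A', E A -> E A' -> (forall i j, `|A i j - A' i j| < eps) -> A = A') ->
  finite_set E.
Proof.
move=> eps0 boundE sepE; pose m := Num.truncn (2 * T / eps).
pose cell A : {ffun 'I_n * 'I_n -> 'I_m.+1} :=
  [ffun ij => inord (Num.truncn ((A ij.1 ij.2 + T) / eps))].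
have cellP A i j : E A ->
    let k := (cell A (i, j) : nat) in k%:R * eps <= A i j + T < k.+1%:R * eps.
  move=> EA; rewrite ffunE /=; have := boundE A EA i j; rewrite ler_norml => /andP[A_ge A_le].
  have AT0 : 0 <= (A i j + T) / eps by rewrite divr_ge0 ?(ltW eps0)//; lra.
  rewrite inordK; first by have := truncn_itv AT0; rewrite ler_pdivlMr// ltr_pdivrMr.
  by rewrite ltnS; apply: le_truncn; rewrite ler_pM2r ?invr_gt0//; lra.
apply: (@finite_set_inj_in _ _ _ cell) => A A'; rewrite !inE => EA EA' cellE.
apply: sepE => // i j; have := cellP A i j EA; have := cellP A' i j EA'.
rewrite cellE /= -natr1 ltr_norml; move: (nat_of_ord _) => k.
rewrite mulrDl mul1r; move: (k%:R * eps) => x; clear => /andP[? ?] /andP[? ?].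
by apply/andP; split; lra.
Qed.

Lemma coord_le_of_normc_le A (a : R) i j : (forall v, normc (A *m v) <= a * normc v) ->
  `|A i j| <= a.
Proof.
move=> /(_ (delta_mx j 0)); rewrite normc_delta mulr1 -colE.
by apply: le_trans; rewrite (_ : A i j = col j A i 0) ?normc_ge_coord// mxE.
Qed.

Lemma subgroup_unitmx G g : SL_subgroup G -> G g -> g \in unitmx.
Proof. by move=> [_ [_ [_ det1G]]] Gg; rewrite unitmxE det1G ?unitr1. Qed.

Lemma discrete_mu_bounded_finite G (T : R) : (0 < n)%N -> discrete_subgroup G ->
  finite_set [set g | [/\ G g, mu g 0 <= T & mu (invmx g) 0 <= T]].
Proof.
move=> n0 [groupG [eps [eps0 sepG]]]; have unitG g := @subgroup_unitmx G g groupG.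
have [_ [mulG [invG _]]] := groupG.
have coord_le g i j : G g -> mu g 0 <= T -> `|g i j| <= expR T.
  move=> Gg gT; apply: coord_le_of_normc_le => v.
  rewrite (le_trans (normc_mulmx_le n0 v (unitG _ Gg)))// ler_wpM2r ?normc_ge0//.
  by rewrite ler_expR.
have k0 : 0 < n%:R * expR T + 1 by rewrite ltr_wpDl// mulr_ge0// expR_ge0.
apply: (@bounded_separated_finite (expR T) (eps / (n%:R * expR T + 1))).
- by rewrite divr_gt0.
- by move=> g [Gg gT _] i j; exact: coord_le.
move=> g h [Gg _ giT] [Gh _ _] gh; have gu := unitG _ Gg.
suff /(congr1 (mulmx g)) : invmx g *m h = 1%:M by rewrite mulKVmx// mulmx1.
apply: sepG => [|i j]; first by apply: mulG => //; exact: invG.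
rewrite -(mulVmx gu) -[X in `|X|]opprB normrN.
rewrite (_ : _ - _ = (invmx g *m (g - h)) i j); last by rewrite mulmxBr [RHS]mxE [X in _ = _ + X]mxE.
rewrite mxE (le_lt_trans (ler_norm_sum _ _ _))//.
apply: (@le_lt_trans _ _ (\sum_(k < n) expR T * (eps / (n%:R * expR T + 1)))).
  apply: ler_sum => k _; rewrite normrM ler_pM ?coord_le//; first exact: invG.
  by rewrite !mxE ltW.
rewrite sumr_const card_ord -[ltLHS]mulr_natl mulrA mulrA ltr_pdivrMr// mulrC ltr_pM2l//.
by rewrite ltrDl ltr01.
Qed.

End DiscreteGroup.

(** * Caps and flags *)

Section CapGeometry.
Variables (R : realType) (n : nat) (phi : 'rV[R]_n) (K : set 'cV[R]_n) (o : 'cV[R]_n).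
Hypotheses (properK : proper_open_cone phi K) (Ko : K o).
Variable delta : R.
Hypothesis hypK : delta_hyperbolic K (cone_dist K) delta.
Implicit Types (y z : 'cV[R]_n) (p : 'rV[R]_n) (k : R).
Local Notation d := (cone_dist K).
Local Notation cap := (cap phi K).

(* The cap is convex, so a geodesic between two of its points stays at distance
   at least [- ln k / 2] from [o]. *)
Lemma gromov_product_cap_ge p k y z : p != 0 -> dual_cone K p -> 0 < k ->
  cap o p k y -> cap o p k z -> - ln k / 2 - 2 * delta <= gromov_product d o y z.
Proof.
move=> p0 Kp k0 cap_y cap_z; have [[Ky _] [Kz _]] := (cap_y, cap_z).
have [|s s01 yw] := @cone_dist_segment_surj _ _ _ _ properK y z (gromov_product d y o z) Ky Kz.
  have := cone_dist_triangle properK Ko Ky Kz; have := cone_dist_triangle properK Ky Kz Ko.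
  have := cone_dist_triangle properK Ky Ko Kz.
  rewrite /gromov_product (cone_distC K o y) (cone_distC K z o).
  by move: (d y o) (d o z) (d y z) => *; apply/andP; split; lra.
set w := _ + _ in yw; have cap_w : cap o p k w by exact: (cap_segment properK).
have wz : d y w + d w z = d y z by exact: (cone_dist_segmentD properK).
have := internal_point_dist_le hypK (cone_distC K) Ko cap_w.1 Ky Kz yw wz.
have := cap_dist_ge properK Ko p0 Kp k0 cap_w; lra.
Qed.

(* [m] is the point of the segment [o, y] at distance [- ln k / 2] from [o]. *)
Lemma cap_center p k y : p != 0 -> dual_cone K p -> 0 < k -> k <= 1 -> cap o p k y ->
  exists2 s, 0 <= s <= 1 & let m := (1 - s) *: o + s *: y in
    forall z, cap o p k z -> d m z <= d o z + ln k / 2 + 6 * delta.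
Proof.
move=> p0 Kp k0 k1 cap_y; have Ky := cap_y.1; have delta0 : 0 <= delta.
  have := hypK Ko Ko Ko Ko; rewrite /gromov_product (cone_distxx properK)//.
  by rewrite addr0 subr0 mul0r minxx sub0r oppr_le0.
have [|s s01 om] := @cone_dist_segment_surj _ _ _ _ properK o y (- ln k / 2) Ko Ky.
  by rewrite (cap_dist_ge properK Ko p0 Kp)// andbT divr_ge0// oppr_ge0 ln_le0.
exists s => // m z cap_z; have Km : K m by exact: (cone_segment properK).
have := gromov_product_cap_ge p0 Kp k0 cap_y cap_z; rewrite -om => product_ge.
have delta2 : 0 <= 2 * delta by rewrite mulr_ge0.
have := geodesic_point_dist_le hypK Ko Km Ky cap_z.1
  (cone_dist_segmentD properK s01 Ko Ky) delta2 product_ge.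
rewrite om -/m; lra.
Qed.

End CapGeometry.

Section Flags.
Variables (R : realType) (n : nat) (phi : 'rV[R]_n) (K : set 'cV[R]_n) (o : 'cV[R]_n).
Hypotheses (properK : proper_open_cone phi K) (Ko : K o).
Implicit Types (x : 'cV[R]_n) (p : 'rV[R]_n) (q : 'cV[R]_n * 'rV[R]_n).

Definition flags : set ('cV[R]_n * 'rV[R]_n) :=
  [set q | [/\ normc q.1 = 1, normrow q.2 = 1, closure K q.1, dual_cone K q.2
             & pairing q.2 q.1 = 0]].

Lemma flag_dual_neq0 q : flags q -> q.2 != 0.
Proof. by move=> [_ p1 _ _ _]; rewrite -normrow_gt0 p1. Qed.

Lemma closure_functional_gt0 x : closure K x -> x != 0 -> 0 < pairing phi x.
Proof.
have [B B0 boundB] := cone_closure_bounded properK => cx x0.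
by rewrite -(pmulr_rgt0 _ B0) (lt_le_trans _ (boundB x cx))// normc_gt0.
Qed.

Lemma flag_functional_gt0 q : flags q -> 0 < pairing phi q.1.
Proof.
by move=> [x1 _ cx _ _]; apply: closure_functional_gt0; rewrite -?normc_gt0 ?x1.
Qed.

Lemma normc_flag_dist_le : exists2 r0 : R, 0 < r0 & forall q q' (rho : R), flags q -> flags q' ->
  dsym q q' <= rho -> rho < r0 -> normc (q.1 - q'.1) <= rho /\ normrow (q'.2 - q.2) <= rho.
Proof.
have [B B0 boundB] := cone_closure_bounded properK; have [r r0 ballK] := cone_ball properK Ko.
have no : 0 < normc o by rewrite normc_gt0 (cone_neq0 properK).
have f0 : 0 < normrow phi + 1 by rewrite ltr_wpDl// normrow_ge0.
exists (Num.min (2 / (B * (normrow phi + 1))) (2 * r / normc o)).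
  by rewrite lt_min !divr_gt0 ?mulr_gt0.
move=> q q' rho [x1 p1 cx Kp _] [x1' p1' cx' Kp' _] q_rho; rewrite lt_min => /andP[rho_B rho_r].
have angle_x := le_trans (angle_c_le_dsym q q') q_rho.
have angle_p := le_trans (angle_r_le_dsym q q') q_rho; rewrite angle_rE in angle_p.
split.
  apply: (le_trans _ angle_x); apply: (@normc_dist_le_angle_halfspace _ _ phi _ _ B^-1) => //.
  - by rewrite -(ler_pM2l B0) divff ?gt_eqF// -x1 boundB.
  - by rewrite -(ler_pM2l B0) divff ?gt_eqF// -x1' boundB.
  have := ler_pM (normrow_ge0 phi) (angle_c_ge0 q.1 q'.1) (lexx _) angle_x.
  move: rho_B; rewrite invfM mulrA ltr_pdivlMr// => rho_B /le_lt_trans; apply.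
  by have := le_trans (angle_c_ge0 _ _) angle_x; move: rho_B; lra.
rewrite normrowE linearB normc_distC; apply: le_trans angle_p.
have np p : normrow p = 1 -> dual_cone K p -> r <= pairing o^T p^T.
  move=> np1 dual_p; rewrite pairingE trmxK dotcC -pairingE -[r]mulr1 -np1.
  exact: dual_ball_ge dual_p r0 ballK.
apply: (@normc_dist_le_angle_halfspace _ _ o^T _ _ r); rewrite -?normrowE ?np//.
rewrite normrow_tr mulrC -ltr_pdivlMr//.
by move: rho_r; apply: le_lt_trans; rewrite -angle_rE; exact: le_trans (angle_r_le_dsym q q') q_rho.
Qed.

(* Since [p x = p' x' = 0], [p' x + p x' = (p' - p) (x - x')] is quadratic in the
   distance of the flags. *)
Lemma flag_pairing_le : exists2 r0 : R, 0 < r0 & exists2 c : R, 0 < c &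
  forall q q' (rho : R), flags q -> flags q' -> dsym q q' <= rho -> rho < r0 ->
    pairing q'.2 q.1 * pairing phi o <= c * rho ^+ 2 * (pairing q'.2 o * pairing phi q.1).
Proof.
have [r0 r00 dist_le] := normc_flag_dist_le; exists r0 => //.
have [B B0 boundB] := cone_closure_bounded properK; have [r r_gt0 ballK] := cone_ball properK Ko.
have po := cone_pairing_gt0 properK Ko.
exists (pairing phi o * B / r) => [|q q' rho flag_q flag_q' q_rho rho_r0].
  by rewrite divr_gt0// mulr_gt0.
have [nx np] := dist_le q q' rho flag_q flag_q' q_rho rho_r0.
have [x1 p1 cx Kp px] := flag_q; have [x1' p1' cx' Kp' px'] := flag_q'.
have sumE : pairing q'.2 q.1 + pairing q.2 q'.1 = pairing (q'.2 - q.2) (q.1 - q'.1).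
  by rewrite !pairing_linear px px'; ring.
have sum_le : pairing q'.2 q.1 <= rho ^+ 2.
  have := le_trans (ler_pairing _ _) (ler_pM (normrow_ge0 _) (normc_ge0 _) np nx).
  by rewrite -sumE -expr2; have := dual_closure_ge0 Kp cx'; lra.
have phi_ge : 1 <= B * pairing phi q.1 by rewrite -x1 boundB.
have dual_ge : r <= pairing q'.2 o by rewrite -[r]mulr1 -p1'; exact: dual_ball_ge Kp' r_gt0 ballK.
rewrite mulrC -ler_pdivlMl// (le_trans sum_le)//.
rewrite [leRHS](_ : _ = rho ^+ 2 * ((pairing q'.2 o / r) * (B * pairing phi q.1))); last first.
  by field; rewrite !gt_eqF.
rewrite ler_peMr ?sqr_ge0//; apply: le_trans (_ : 1 * 1 <= _); first by rewrite mulr1.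
by rewrite ler_pM// ler_pdivlMr// mul1r.
Qed.

Lemma cap_meets_near_flag (D : set 'cV[R]_n) p x (k : R) : D `<=` K -> closure D x ->
  pairing p x = 0 -> 0 < pairing p o -> 0 < pairing phi x -> 0 < k ->
  exists2 y, D y & cap phi K o p k y.
Proof.
move=> DK /closure_normcP cx px po fx k0.
have fo := cone_pairing_gt0 properK Ko.
pose c := k * pairing p o * normrow phi + normrow p * pairing phi o + 1.
have c0 : 0 < c.
  by rewrite ltr_wpDl// addr_ge0// mulr_ge0 ?normrow_ge0 ?mulr_ge0 ?ltW.
have [y Dy] := cx _ (divr_gt0 (mulr_gt0 (mulr_gt0 k0 po) fx) c0).
rewrite ltr_pdivlMr// => yx; exists y => //; split; first exact: DK.
have := ler_pairing p (y - x); rewrite pairingDr pairingNr px subr0.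
move=> /(ler_wpM2r (ltW fo)) py.
have := ler_wpM2l (ltW (mulr_gt0 k0 po)) (pairing_perturb phi x y).
rewrite normc_distC mulrBr => fy; move: yx; rewrite /c !mulrDr mulr1.
by have := normc_ge0 (y - x); move: py fy; lra.
Qed.

End Flags.

Section Shadows.
Variables (R : realType) (n : nat) (phi : 'rV[R]_n) (K : set 'cV[R]_n) (o : 'cV[R]_n).
Hypotheses (properK : proper_open_cone phi K) (Ko : K o).
Implicit Types (g : 'M[R]_n) (q : 'cV[R]_n * 'rV[R]_n).
Local Notation M := (gauge K).
Local Notation d := (cone_dist K).

Definition gap g : R := mu g 0 - mu g 1.

Definition shadow (D : R) g : set ('cV[R]_n * 'rV[R]_n) :=
  [set q | flags K q /\ exists t, [/\ 0 < t, t <= 1 & d (q.1 + t *: o) (g *m o) <= D]].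

Lemma shadow_point_in_cone q t : flags K q -> 0 < t -> K (q.1 + t *: o).
Proof.
move=> [_ _ cx _ _] t0; rewrite addrC; apply: (cone_add_closure properK) => //.
exact: (cone_scale properK).
Qed.

Lemma gauge_pullback_le D g w : cone_aut K g -> K w -> d w (g *m o) <= D ->
  M o (invmx g *m w) * M (invmx g *m w) o <= expR (2 * D).
Proof.
move=> autg Kw; have autgi := cone_aut_inv autg; have Kw' : K (invmx g *m w) by apply/autgi.2.
rewrite cone_distC cone_dist_aut_inv// (cone_dist_leE properK)//.
Qed.

(* With [w = x + t o], the vector [g^-1 x] is below [g^-1 w <= M (g^-1 w) o], while
   [g o] is below [M w], which bounds the norm of [g]. *)
Lemma shadow_expands_point D : exists2 c : R, 0 < c & forall g q, cone_aut K g ->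
  shadow D g q -> expR (mu g 0) * normc (invmx g *m q.1) <= c.
Proof.
have [B B0 boundB] := cone_closure_bounded properK.
have [c c0 expR_mu_le] := expR_mu0_le_pairing properK Ko.
have fo := cone_pairing_gt0 properK Ko; have nf := normrow_ge0 phi.
pose s := normrow phi + pairing phi o; have s0 : 0 < s by rewrite ltr_wpDl.
have k0 : 0 < c * s * (B * pairing phi o) by rewrite !mulr_gt0.
exists (c * s * (B * pairing phi o) * expR (2 * D)); first by rewrite mulr_gt0 ?expR_gt0.
move=> g q autg [flag_q [t [t0 t1 wD]]]; have autgi := cone_aut_inv autg.
set w := q.1 + t *: o in wD; have Kw : K w by exact: shadow_point_in_cone.
set w' := invmx g *m w; have Kw' : K w' by apply/autgi.2.
have MM := gauge_pullback_le autg Kw wD; rewrite -/w' in MM.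
have [x1 _ cx _ _] := flag_q; have dual_phi := cone_functional_dual properK.
have fw : pairing phi w <= s.
  rewrite pairingDr pairingZr lerD ?ler_piMl ?(ltW fo)//.
  by rewrite (le_trans (ler_pairing _ _))// x1 mulr1.
have mu_le : expR (mu g 0) <= c * s * M w' o.
  apply: le_trans (expR_mu_le g autg) _; rewrite -mulrA ler_pM2l//.
  have := gauge_pairing properK (g *m o) dual_phi ((autg.2 w').2 Kw').
  rewrite gauge_aut// => /le_trans; apply; rewrite /w' mulKVmx ?autg.1// mulrC.
  by rewrite ler_wpM2r// ltW// (gauge_gt0 properK).
have norm_le : normc (invmx g *m q.1) <= B * pairing phi o * M o w'.
  have cgx : closure K (invmx g *m q.1) by apply: closure_mulmx cx => v /autgi.2.
  apply: le_trans (boundB _ cgx) _; rewrite -mulrA ler_pM2l// mulrC.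
  apply: le_trans (gauge_pairing properK w' dual_phi Ko).
  rewrite /w' /w mulmxDr pairingDr lerDl dual_phi// -scalemxAr.
  by apply: (cone_scale properK) => //; apply/autgi.2.
have := ler_pM (expR_ge0 _) (normc_ge0 _) mu_le norm_le; rewrite mulrACA => /le_trans; apply.
by rewrite ler_pM2l// mulrC.
Qed.

Lemma shadow_expands_functional D : exists2 c : R, 0 < c & forall g q, cone_aut K g ->
  shadow D g q -> expR (mu (invmx g) 0) * normrow (q.2 *m g) <= c.
Proof.
have [r r0 ballK] := cone_ball properK Ko.
have [c c0 expR_mu_le] := expR_mu0_le_pairing properK Ko.
have fo := cone_pairing_gt0 properK Ko.
have no : 0 < normc o by rewrite normc_gt0 (cone_neq0 properK).
have k0 : 0 < c * pairing phi o * (normc o / r) by rewrite !mulr_gt0 ?invr_gt0.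
exists (c * pairing phi o * (normc o / r) * expR (2 * D)); first by rewrite mulr_gt0 ?expR_gt0.
move=> g q autg [flag_q [t [t0 t1 wD]]]; have autgi := cone_aut_inv autg.
set w := q.1 + t *: o in wD; have Kw : K w by exact: shadow_point_in_cone.
set w' := invmx g *m w; have Kw' : K w' by apply/autgi.2.
have MM := gauge_pullback_le autg Kw wD; rewrite -/w' in MM.
have [x1 p1 cx Kp px] := flag_q; have dual_phi := cone_functional_dual properK.
have mu_le : t * expR (mu (invmx g) 0) <= c * pairing phi o * M o w'.
  apply: (@le_trans _ _ (c * pairing phi w')).
    have := ler_wpM2l (ltW t0) (expR_mu_le _ autgi) => /le_trans; apply.
    rewrite mulrCA ler_pM2l// -pairingZr scalemxAr /w' /w mulmxDr pairingDr lerDr.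
    by apply: (dual_closure_ge0 dual_phi); apply: closure_mulmx cx => v /autgi.2.
  by rewrite -mulrA ler_pM2l// mulrC (gauge_pairing properK).
have norm_le : normrow (q.2 *m g) <= t * (normc o / r) * M w' o.
  have dual_pg : dual_cone K (q.2 *m g).
    by move=> v Kv; rewrite pairing_mulmx; apply/Kp/autg.2.
  rewrite -(ler_pM2l r0) (le_trans (dual_ball_ge dual_pg r0 ballK))//.
  apply: le_trans (gauge_pairing properK o dual_pg Kw') _.
  rewrite pairing_mulmx /w' mulKVmx ?autg.1// {2}/w pairingDr px add0r pairingZr.
  rewrite [leRHS](_ : _ = M w' o * (t * normc o)); last by field; rewrite gt_eqF.
  rewrite ler_pM2l ?(gauge_gt0 properK)// ler_pM2l//.
  by rewrite (le_trans (ler_pairing _ _))// p1 mul1r.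
rewrite -(ler_pM2l t0) [leLHS]mulrA.
have tmu0 : 0 <= t * expR (mu (invmx g) 0) by rewrite mulr_ge0 ?expR_ge0 ?ltW.
apply: le_trans (ler_pM tmu0 (normrow_ge0 _) mu_le norm_le) _.
rewrite [leLHS](_ : _ = t * (c * pairing phi o * (normc o / r)) * (M o w' * M w' o)); last by ring.
by rewrite [leRHS]mulrA ler_pM2l// mulr_gt0.
Qed.

Lemma shadow_diameter D : exists2 c : R, 0 < c & forall g q q', cone_aut K g ->
  shadow D g q -> shadow D g q' -> dsym q q' <= c * (expR (- gap g) + expR (- gap (invmx g))).
Proof.
have n0 := cone_dim_gt0 properK Ko.
have [c1 c10 point_le] := shadow_expands_point D.
have [c2 c20 functional_le] := shadow_expands_functional D.
exists (8 * c1 + 8 * c2) => [|g q q' autg shadow_q shadow_q']; first by rewrite addr_gt0 ?mulr_gt0.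
have gu := autg.1; have gTu : invmx g^T \in unitmx by rewrite unitmx_inv unitmx_tr.
have neq0 v : normc v = 1 -> v != 0 by move=> v1; rewrite -normc_gt0 v1.
have point_norm q1 : shadow D g q1 -> normc q1.1 = 1 by move=> [[]].
have functional_norm q1 : shadow D g q1 -> normc q1.2^T = 1.
  by move=> [[_ p1 _ _ _] _]; rewrite -normrowE.
have angle_x : angle_c q.1 q'.1 <= 8 * c1 * expR (- gap g).
  by apply: (angle_c_le_gap n0 gu); rewrite ?neq0 ?point_norm// mulr1 point_le.
have angle_p : angle_r q.2 q'.2 <= 8 * c2 * expR (- gap (invmx g)).
  rewrite angle_rE /gap -!(mu_tr _ (cone_aut_inv autg).1) trmx_inv.
  apply: (angle_c_le_gap n0 gTu); rewrite ?neq0 ?functional_norm// invmxK mulr1;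
    by rewrite -trmx_mul -normrowE -trmx_inv mu_tr ?functional_le// (cone_aut_inv autg).1.
apply: le_trans (dsym_le q q') _; rewrite mulrDr.
apply: le_trans (lerD angle_x angle_p) _.
have [c1_ge0 c2_ge0] := (ltW c10, ltW c20).
by rewrite lerD ?ler_wpM2r ?expR_ge0 ?lerDl ?lerDr ?mulr_ge0.
Qed.

End Shadows.

(** * Hausdorff dimension and Poincare series *)

Section HausdorffNullSets.
Variables (R : realType) (T : Type) (d : T -> T -> R).
Hypothesis d_ge0 : forall x y, 0 <= d x y.
Implicit Types (A B U : set T) (s eps rho : R).

Definition small_cover s eps A := exists (U : nat -> set T) (rho : nat -> R),
  [/\ A `<=` \bigcup_i U i, forall i, 0 <= rho i,
      forall i x y, U i x -> U i y -> d x y <= rho i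
    & forall N, \sum_(i < N) rho i `^ s <= eps].

Lemma hdiam_ge U x y : U x -> U y -> ((d x y)%:E <= hdiam d U)%E.
Proof. by move=> Ux Uy; apply: ereal_sup_ubound; exists (x, y). Qed.

Lemma hdiam_set0 : hdiam d set0 = -oo%E.
Proof. by rewrite /hdiam setX0 image_set0 ereal_sup0. Qed.

Lemma fine_hdiam_ge0 U : 0 <= fine (hdiam d U).
Proof.
have [->|/set0P[x Ux]] := eqVneq U set0; first by rewrite hdiam_set0.
by apply/fine_ge0/(le_trans _ (hdiam_ge Ux Ux)); rewrite lee_fin.
Qed.

Lemma fine_hdiam_le U rho : 0 <= rho -> (forall x y, U x -> U y -> d x y <= rho) ->
  fine (hdiam d U) <= rho.
Proof.
move=> rho0 dU; have [->|/set0P[x Ux]] := eqVneq U set0; first by rewrite hdiam_set0.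
have le_rho : (hdiam d U <= rho%:E)%E.
  by apply: ge_ereal_sup => _ [[y z] [Uy Uz] <-]; rewrite lee_fin dU.
rewrite -lee_fin fineK// ge0_fin_numE ?(le_lt_trans le_rho) ?ltry//.
by apply: (le_trans _ (hdiam_ge Ux Ux)); rewrite lee_fin.
Qed.

Lemma hcontrib_ge0 s U : (0 <= hcontrib d s U)%E.
Proof. by rewrite lee_fin powR_ge0. Qed.

Lemma hausdorff_null_small_cover s eps A : 0 < eps -> hausdorff_measure d s A = 0%E ->
  small_cover s eps A.
Proof.
move=> eps0 nullA; have : (hausdorff_pre d s 1 A < eps%:E)%E.
  apply: (@le_lt_trans _ _ 0%E); last by rewrite lte_fin.
  by rewrite -nullA; apply: ereal_sup_ubound; exists 1 => //=.
move=> /ereal_inf_lt[_ [U [AU dU] <-] sum_lt].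
exists U, (fun i => fine (hdiam d (U i))); split=> // [i|i x y Ux Uy|N].
- exact: fine_hdiam_ge0.
- rewrite -lee_fin fineK ?hdiam_ge// ge0_fin_numE ?(le_lt_trans (dU i)) ?ltry//.
  by apply: (le_trans _ (hdiam_ge Ux Uy)); rewrite lee_fin.
rewrite -lee_fin -sumEFin -(big_mkord xpredT (fun i => hcontrib d s (U i))).
by apply: le_trans (ltW sum_lt); apply: nneseries_lim_ge => i _ _; exact: hcontrib_ge0.
Qed.

Lemma ler_of_sum_powR_le s delta (rho : nat -> R) : 0 < s -> 0 <= delta ->
  (forall i, 0 <= rho i) -> (forall N, \sum_(i < N) rho i `^ s <= delta `^ s) ->
  forall i, rho i <= delta.
Proof.
move=> s0 delta0 rho0 sum_le i; rewrite leNgt; apply/negP => /(gt0_ltr_powR s0).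
rewrite !nnegrE => /(_ delta0 (rho0 i)); rewrite ltNge => /negP; apply.
rewrite (le_trans _ (sum_le i.+1))// big_ord_recr /= lerDr sumr_ge0// => j _.
exact: powR_ge0.
Qed.

Lemma small_cover_hausdorff_pre_le s eps delta A : 0 < s -> 0 < delta -> eps <= delta `^ s ->
  small_cover s eps A -> (hausdorff_pre d s delta A <= eps%:E)%E.
Proof.
move=> s0 delta0 eps_delta [U [rho [AU rho0 dU sum_le]]].
have rho_le i : rho i <= delta.
  apply: (ler_of_sum_powR_le s0 (ltW delta0) rho0) => N; exact: le_trans (sum_le N) eps_delta.
apply: (@le_trans _ _ (\sum_(i <oo) hcontrib d s (U i))%E).
  apply: ereal_inf_lbound; exists U => //; split=> // i.
  by apply: ge_ereal_sup => _ [[x y] [Ux Uy] <-]; rewrite lee_fin (le_trans (dU i x y Ux Uy)).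
apply: lime_le; first by apply: is_cvg_nneseries => i _ _; exact: hcontrib_ge0.
apply: nearW => N; rewrite big_mkord sumEFin lee_fin (le_trans _ (sum_le N))//.
apply: ler_sum => i _; rewrite ge0_ler_powR ?nnegrE ?(ltW s0) ?fine_hdiam_ge0//.
exact: fine_hdiam_le (rho0 i) (dU i).
Qed.

Lemma hausdorff_measure_eq0P s A : 0 < s ->
  hausdorff_measure d s A = 0%E <-> forall eps, 0 < eps -> small_cover s eps A.
Proof.
move=> s0; split=> [nullA eps eps0|coverA]; first exact: hausdorff_null_small_cover.
have pre_ge0 delta : (0 <= hausdorff_pre d s delta A)%E.
  by apply: le_ereal_inf_tmp => _ [U _ <-]; apply: nneseries_ge0 => i _ _; exact: hcontrib_ge0.
apply/le_anti/andP; split; last first.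
  by apply: le_trans (pre_ge0 1) _; apply: ereal_sup_ubound; exists 1 => //=.
apply: ge_ereal_sup => _ [delta /= delta0 <-].
apply/lee_addgt0Pr => eps eps0; rewrite add0e.
pose eps' := Num.min eps (delta `^ s).
have eps'0 : 0 < eps' by rewrite lt_min eps0 powR_gt0.
apply: (@le_trans _ _ eps'%:E); last by rewrite lee_fin ge_min lexx.
apply: (small_cover_hausdorff_pre_le s0 delta0); last exact: coverA.
by rewrite ge_min lexx orbT.
Qed.

Lemma hausdorff_dim_isometry_le A B (f : T -> T) : (forall x, A x -> B (f x)) ->
  (forall x y, A x -> A y -> d (f x) (f y) = d x y) ->
  (hausdorff_dim d A <= hausdorff_dim d B)%E.
Proof.
move=> fAB isom; apply: ereal_inf_le_tmp => _ [s [s0 nullB] <-]; exists s => //; split=> //.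
apply/hausdorff_measure_eq0P => // eps eps0.
have [U [rho [BU rho0 dU sum_le]]] := hausdorff_null_small_cover eps0 nullB.
exists (fun i => A `&` f @^-1` U i), rho; split=> // [x Ax|i x y [Ax Ux] [Ay Uy]].
  by have [i _ Ui] := BU _ (fAB x Ax); exists i.
by rewrite -isom//; exact: dU Ux Uy.
Qed.

Lemma small_cover_gt0 s eps A : 0 < s -> 0 < eps -> small_cover s eps A ->
  exists (U : nat -> set T) (rho : nat -> R),
  [/\ A `<=` \bigcup_i U i, forall i, 0 < rho i,
      forall i x y, U i x -> U i y -> d x y <= rho i
    & forall N, \sum_(i < N) rho i `^ s <= 2 * eps].
Proof.
move=> s0 eps0 [U [rho [AU rho0 dU sum_le]]].
pose X i := rho i `^ s + eps / 2 * 2^-1 ^+ i.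
have X0 i : 0 < X i by rewrite ltr_wpDl ?powR_ge0// mulr_gt0 ?divr_gt0// exprn_gt0// invr_gt0.
have powK x : 0 <= x -> (x `^ s) `^ s^-1 = x.
  by move=> x0; rewrite -powRrM divff ?gt_eqF// powRr1.
have powVK x : 0 <= x -> (x `^ s^-1) `^ s = x.
  by move=> x0; rewrite -powRrM mulVf ?gt_eqF// powRr1.
exists U, (fun i => X i `^ s^-1); split=> // [i|i x y Ux Uy|N]; first exact: powR_gt0.
  rewrite (le_trans (dU i x y Ux Uy))// -{1}[rho i]powK//.
  rewrite ge0_ler_powR ?nnegrE ?invr_ge0 ?powR_ge0 ?(ltW s0) ?(ltW (X0 i))//.
  by rewrite lerDl mulr_ge0 ?divr_ge0 ?(ltW eps0)// exprn_ge0// invr_ge0.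
under eq_bigr do rewrite powVK ?ltW//.
rewrite big_split /= [2 * eps]mulr_natl mulr2n lerD ?sum_le//.
have half_gt0 : 0 < (2^-1 : R) by rewrite invr_gt0.
have half_lt1 : `|2^-1 : R| < 1 by rewrite gtr0_norm// invf_lt1// ltr1n.
have := geometric_le_lim N (divr_ge0 (ltW eps0) (ler0n R 2)) half_gt0 half_lt1.
rewrite /series /= big_mkord => /le_trans; apply.
by rewrite le_eqVlt; apply/orP; left; apply/eqP; field.
Qed.

Lemma countable_small_cover (I : choiceType) (E : set I) (V : I -> set T) (r : I -> R) s eps A :
  0 < s -> 0 <= eps -> countable E -> A `<=` \bigcup_(i in E) V i -> (forall i, 0 <= r i) ->
  (forall i x y, E i -> V i x -> V i y -> d x y <= r i) ->
  (forall l : seq I, uniq l -> (forall i, i \in l -> E i) -> \sum_(i <- l) r i `^ s <= eps) ->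
  small_cover s eps A.
Proof.
move=> s0 eps0 /countable_injP[f injf] AV r0 dV sum_le.
have [E0|/set0P[i0 Ei0]] := eqVneq E set0.
  exists (fun=> set0), (fun=> 0); split=> // [x /AV[i]|N]; first by rewrite E0.
  by rewrite big1// => i _; rewrite powR0// gt_eqF.
pose fiber n := [set i | E i /\ f i = n]; pose pick n := xget i0 (fiber n).
have pickP i : E i -> pick (f i) = i.
  move=> Ei; apply: xget_unique => // j [Ej fj].
  by apply: injf; rewrite ?inE.
pose used n := `[< fiber n !=set0 >].
have usedP n : used n -> E (pick n) /\ f (pick n) = n.
  by move=> /asboolP fiber_n; exact: (xgetPex i0 fiber_n).
exists (fun n => [set x | exists i, [/\ E i, f i = n & V i x]]).
exists (fun n => if used n then r (pick n) else 0); split.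
- by move=> x /AV[i Ei Vx]; exists (f i) => //; exists i.
- by move=> n; case: ifP.
- move=> n x y [i [Ei <- Vx]] [j [Ej ij Vy]].
  have used_i : used (f i) by apply/asboolP; exists i.
  rewrite used_i pickP//; apply: dV => //; suff -> : i = j by [].
  by apply: injf; rewrite ?inE.
move=> N; pose l := [seq pick n | n <- iota 0 N & used n].
have uniq_l : uniq l.
  rewrite map_inj_in_uniq ?filter_uniq ?iota_uniq// => m n.
  rewrite !mem_filter => /andP[/usedP[_ fm] _] /andP[/usedP[_ fn] _] pick_eq.
  by rewrite -fm -fn pick_eq.
have l_sub i : i \in l -> E i.
  by move=> /mapP[n]; rewrite mem_filter => /andP[/usedP[] + _ _ ->].
apply: le_trans (sum_le l uniq_l l_sub); rewrite big_map big_filter.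
rewrite -(big_mkord xpredT (fun n => (if used n then r (pick n) else 0) `^ s)) /index_iota subn0.
rewrite [leRHS]big_mkcond /=; apply: ler_sum => n _; case: ifP => // _.
by rewrite powR0// gt_eqF.
Qed.

End HausdorffNullSets.

Section SumsOverSets.
Variables (R : realType) (T : choiceType).
Implicit Types (E : set T) (w : T -> R) (l : seq T).

Lemma ler_sum_uniq_sub l l' w : uniq l -> uniq l' -> {subset l <= l'} ->
  (forall x, 0 <= w x) -> \sum_(x <- l) w x <= \sum_(x <- l') w x.
Proof.
move=> uniq_l uniq_l' ll' w0.
have /(perm_big _)-> : perm_eq l [seq x <- l' | x \in l].
  apply: uniq_perm => //; first exact: filter_uniq.
  by move=> x; rewrite mem_filter; case: (boolP (x \in l)) => // /ll' ->.
by rewrite big_filter big_mkcond /=; apply: ler_sum => x _; case: ifP.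
Qed.

Lemma sumr1_size l : \sum_(x <- l) (1 : R) = (size l)%:R.
Proof. by rewrite big_const_seq count_predT iter_addr_0. Qed.

Lemma esum_leP E w (P : R) : (forall x, 0 <= w x) ->
  (\esum_(x in E) (w x)%:E <= P%:E)%E <->
  forall l, uniq l -> (forall x, x \in l -> E x) -> \sum_(x <- l) w x <= P.
Proof.
move=> w0; split=> [sum_le l uniq_l lE|sum_le].
  rewrite -lee_fin -sumEFin; apply: le_trans sum_le; rewrite fsbig_seq//.
  by apply: esum_ge; exists [set` l]; first by split=> [|x /= /lE//]; exact: finite_seq.
apply: ge_ereal_sup => _ [F [finF FE] <-].
rewrite fsbig_finite//= sumEFin lee_fin sum_le ?finmap.fset_uniq// => x.
by rewrite in_fset_set// inE; exact: FE.
Qed.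

Lemma esum_lt_pinfty_bounded E w : (forall x, 0 <= w x) ->
  (\esum_(x in E) (w x)%:E < +oo)%E ->
  exists P, forall l, uniq l -> (forall x, x \in l -> E x) -> \sum_(x <- l) w x <= P.
Proof.
move=> w0 sum_lt; exists (fine (\esum_(x in E) (w x)%:E)); apply/esum_leP => //.
by rewrite fineK// ge0_fin_numE// esum_ge0// => x _; rewrite lee_fin.
Qed.

Lemma esum_tail_le E w (eps : R) : (forall x, 0 <= w x) -> 0 < eps ->
  (\esum_(x in E) (w x)%:E < +oo)%E ->
  exists F, [/\ finite_set F, F `<=` E & forall l, uniq l ->
    (forall x, x \in l -> E x /\ ~ F x) -> \sum_(x <- l) w x <= eps].
Proof.
move=> w0 eps0 sum_lt; have sum_fin : \esum_(x in E) (w x)%:E \is a fin_num.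
  by rewrite ge0_fin_numE// esum_ge0// => x _; rewrite lee_fin.
have [_ [F [finF FE] <-]] := ub_ereal_sup_adherent eps0 sum_fin.
rewrite fsbig_finite//= sumEFin -[ereal_sup _]fineK// -EFinB lte_fin => F_gt.
exists F; split=> // l uniq_l lEF.
have /esum_leP sum_le : (\esum_(x in E) (w x)%:E <= (fine (\esum_(x in E) (w x)%:E))%:E)%E.
  by rewrite fineK.
have := sum_le w0 (l ++ finmap.enum_fset (fset_set F)); rewrite big_cat /= => cat_le.
have : \sum_(x <- l) w x + \sum_(x <- finmap.enum_fset (fset_set F)) w x <=
    fine (\esum_(x in E) (w x)%:E).
  apply: cat_le => [|x].
    rewrite cat_uniq uniq_l finmap.fset_uniq andbT /=; apply/hasPn => x.
    by rewrite in_fset_set// inE => Fx; apply/negP => /lEF[].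
  by rewrite mem_cat => /orP[/lEF[]//|]; rewrite in_fset_set// inE; exact: FE.
by move: F_gt; rewrite /esum; lra.
Qed.

Lemma esum_involution_lt_pinfty E w (i : T -> T) : (forall x, 0 <= w x) -> involutive i ->
  (forall x, E x -> E (i x)) -> (\esum_(x in E) (w x)%:E < +oo)%E ->
  (\esum_(x in E) (w x + w (i x))%:E < +oo)%E.
Proof.
move=> w0 iK iE /(esum_lt_pinfty_bounded w0)[P sum_le]; apply: le_lt_trans (ltry (P + P)).
apply/esum_leP => [x|l uniq_l lE]; first exact: addr_ge0.
rewrite big_split /= lerD ?sum_le// -(big_map i xpredT w) sum_le ?(map_inj_uniq (inv_inj iK))//.
by move=> _ /mapP[x /lE Ex ->]; exact: iE.
Qed.

Lemma finite_set_upper_bound E (f : T -> R) : finite_set E ->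
  exists B : R, forall x, E x -> f x <= B.
Proof.
move=> /finite_seqP[l ->]; elim: l => [|x l [B boundB]]; first by exists 0.
exists (Num.max (f x) B) => y /=; rewrite inE le_max => /orP[/eqP->|/boundB ->].
  by rewrite lexx.
by rewrite orbT.
Qed.

Lemma finite_set_of_bounded_size E (B : R) :
  (forall l, uniq l -> (forall x, x \in l -> E x) -> (size l)%:R <= B) -> finite_set E.
Proof.
move=> size_le; apply: contrapT => /(infinite_set_fset (Num.truncn B).+1)[F FE size_F].
have := size_le (finmap.enum_fset F) (finmap.fset_uniq F) (fun x => FE x).
by move=> /le_lt_trans/(_ (truncnS_gt B)); rewrite ltr_nat ltnNge size_F.
Qed.

End SumsOverSets.

Section PoincareSeries.
Variable R : realType.

Definition poincare_series (T : choiceType) (E : set T) (f : T -> R) (s : R) : \bar R :=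
  \esum_(x in E) (expR (- (s * f x)))%:E.

Lemma poincare_series_comparison (T : choiceType) (E : set T) (f f' : T -> R) (s s' c : R) :
  (forall x, E x -> s * f x <= s' * f' x + c) ->
  (poincare_series E f s < +oo)%E -> (poincare_series E f' s' < +oo)%E.
Proof.
move=> ff' /(esum_lt_pinfty_bounded (fun x => expR_ge0 _))[P sum_le].
apply: le_lt_trans (ltry (expR c * P)); apply/esum_leP => [x|l uniq_l lE]; first exact: expR_ge0.
apply: le_trans (ler_wpM2l (expR_ge0 c) (sum_le l uniq_l lE)); rewrite mulr_sumr.
rewrite big_seq [leRHS]big_seq; apply: ler_sum => x /lE Ex.
by rewrite -expRD ler_expR; have := ff' x Ex; lra.
Qed.

Lemma elog_le (x : \bar R) (c : R) : 1 <= c -> (0 <= x)%E -> (x <= c%:E)%E ->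
  (elog x <= (ln c)%:E)%E.
Proof.
case: x => [x| |] //= c1; rewrite !lee_fin le0r => /orP[/eqP-> _|x0 xc].
  by rewrite ln0// ln_ge0.
by rewrite ler_ln ?posrE// (lt_le_trans x0).
Qed.

Lemma count_le_ge0 n (G : set 'M[R]_n) f r : (0 <= count_le G f r)%E.
Proof. by apply: esum_ge0 => g _; rewrite lee_fin. Qed.

Lemma size_le_count n (G : set 'M[R]_n) f r l : uniq l ->
  (forall g, g \in l -> G g /\ f g <= r) -> (((size l)%:R)%:E <= count_le G f r)%E.
Proof.
move=> uniq_l lG; rewrite -sumr1_size -sumEFin fsbig_seq//.
by apply: esum_ge; exists [set` l]; first by split=> [|g /= /lG//]; exact: finite_seq.
Qed.

Lemma crit_exp_ge0 n (G : set 'M[R]_n) f : G !=set0 -> (0 <= crit_exp G f)%E.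
Proof.
move=> [g Gg]; apply: le_ereal_inf_tmp => _ [T _ <-].
pose r := Num.max T (Num.max 1 (f g)); have r0 : 0 < r by rewrite !lt_max ltr01 orbT.
apply: (@le_trans _ _ ((r^-1)%:E * elog (count_le G f r))%E); last first.
  by apply: ereal_sup_ubound; exists r => //=; rewrite le_max lexx.
have : (1%:E <= count_le G f r)%E.
  apply: (@size_le_count n G f r [:: g] isT) => h.
  by rewrite inE => /eqP ->; split=> //; rewrite !le_max lexx !orbT.
case: (count_le G f r) => [c| |] //=; rewrite ?lee_fin => c1.
  by rewrite mulr_ge0 ?invr_ge0 ?(ltW r0)// ln_ge0.
by rewrite mule_ge0// lee_fin invr_ge0 ltW.
Qed.

Lemma crit_exp_le_of_poincare n (G : set 'M[R]_n) f (s : R) : 0 <= s ->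
  (poincare_series G f s < +oo)%E -> (crit_exp G f <= s%:E)%E.
Proof.
move=> s0 /(esum_lt_pinfty_bounded (fun g => expR_ge0 _))[P0 sum_le].
pose P := Num.max P0 1; have P1 : 1 <= P by rewrite le_max lexx orbT.
have P_gt0 : 0 < P by exact: lt_le_trans P1.
have count_bound r : (count_le G f r <= (P * expR (s * r))%:E)%E.
  apply/(@esum_leP _ _ _ (fun=> 1) _ (fun=> ler01)) => l uniq_l lG.
  rewrite sumr1_size -ler_pdivrMr ?expR_gt0// -expRN (le_trans _ (_ : P0 <= P)) ?le_max ?lexx//.
  have := sum_le l uniq_l (fun g gl => (lG g gl).1); apply: le_trans.
  rewrite -sumr1_size mulr_suml big_seq [leRHS]big_seq; apply: ler_sum => g /lG[_ gr].
  by rewrite mul1r ler_expR lerN2 ler_wpM2l.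
apply/lee_addgt0Pr => e e0; pose T := Num.max 1 (ln P / e).
have T1 : 1 <= T by rewrite le_max lexx.
apply: (@le_trans _ _ (ereal_sup
    [set ((r^-1)%:E * elog (count_le G f r))%E | r in [set r : R | T <= r]])).
  by apply: ereal_inf_lbound; exists T.
apply: ge_ereal_sup => _ [r /= Tr <-].
have r0 : 0 < r by rewrite (lt_le_trans _ Tr)// (lt_le_trans _ T1).
have bound1 : 1 <= P * expR (s * r).
  by rewrite -[leLHS]mulr1 ler_pM// -expR0 ler_expR mulr_ge0// ltW.
have elog_bound := elog_le bound1 (count_le_ge0 _ _ _) (count_bound r).
apply: (@le_trans _ _ ((r^-1)%:E * (ln (P * expR (s * r)))%:E)%E).
  by rewrite lee_pmul2l// lte_fin invr_gt0.
rewrite -EFinM -EFinD lee_fin ler_pdivrMl// lnM ?posrE ?expR_gt0// expRK.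
have : ln P <= r * e by rewrite -ler_pdivrMr// (le_trans _ Tr)// le_max lexx orbT.
by lra.
Qed.

Lemma crit_exp_lt_size n (G : set 'M[R]_n) f (s : R) : (crit_exp G f < s%:E)%E ->
  exists T : R, forall r l, T <= r -> uniq l -> (forall g, g \in l -> G g /\ f g <= r) ->
    (size l)%:R <= expR (s * r).
Proof.
move=> /ereal_inf_lt[_ [T _ <-]] sup_lt; exists (Num.max T 1) => r l.
rewrite ge_max => /andP[Tr r1] uniq_l lG; have r0 : 0 < r by exact: lt_le_trans r1.
have : ((r^-1)%:E * elog (count_le G f r) < s%:E)%E.
  by apply: le_lt_trans sup_lt; apply: ereal_sup_ubound; exists r.
have := size_le_count uniq_l lG; case: (count_le G f r) => [c| |] //=; last first.
  by rewrite gt0_muley ?lte_fin ?invr_gt0.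
rewrite lee_fin -EFinM lte_fin ltr_pdivrMl// => size_le ln_c; apply: le_trans size_le _.
have [c0|c0] := leP c 0; first exact: le_trans c0 (expR_ge0 _).
by rewrite -[leLHS]lnK ?posrE// ler_expR mulrC ltW.
Qed.

Lemma sum_if_count (T : Type) (l : seq T) (P : pred T) (c : R) :
  \sum_(x <- l) (if P x then c else 0) = c * (count P l)%:R.
Proof. by rewrite -big_mkcond /= big_const_seq iter_addr_0 mulr_natr. Qed.

Lemma sum_expR_levels (T : eqType) (l : seq T) (f : T -> R) (s s' : R) : 0 <= s -> s' < s ->
  (forall x, x \in l -> 0 <= f x) ->
  (forall j, (count (fun x => Num.truncn (f x) == j) l)%:R <= expR (s' * j.+1%:R)) ->
  \sum_(x <- l) expR (- (s * f x)) <= expR s' / (1 - expR (s' - s)).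
Proof.
move=> s0 s's f0 count_le; set z := expR (s' - s).
have z0 : 0 < z by exact: expR_gt0.
have z1 : `|z| < 1 by rewrite gtr0_norm// -expR0 ltr_expR subr_lt0.
pose N := (\max_(x <- l) Num.truncn (f x)).+1.
apply: (@le_trans _ _ (\sum_(x <- l) \sum_(0 <= j < N)
    (if Num.truncn (f x) == j then expR (- (s * j%:R)) else 0))).
  rewrite big_seq [leRHS]big_seq; apply: ler_sum => x xl.
  have xN : (Num.truncn (f x) < N)%N by rewrite ltnS; exact: leq_bigmax_seq.
  rewrite (bigD1_seq (Num.truncn (f x))) ?iota_uniq ?mem_index_iota ?xN//= eqxx.
  apply: ler_wpDr; first by apply: sumr_ge0 => j _; case: ifP => // _; exact: expR_ge0.
  by rewrite ler_expR lerN2 ler_wpM2l// truncn_le// f0.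
rewrite exchange_big /=; under eq_bigr do rewrite sum_if_count.
apply: (@le_trans _ _ (\sum_(0 <= j < N) expR s' * z ^+ j)).
  apply: ler_sum => j _; apply: le_trans (ler_wpM2l (expR_ge0 _) (count_le j)) _.
  by rewrite /z -expRM_natl -!expRD ler_expR -natr1; lra.
exact: geometric_le_lim (ltW (expR_gt0 _)) z0 z1.
Qed.

Lemma poincare_series_lt_pinfty n (G : set 'M[R]_n) f (s : R) : 0 <= s ->
  (crit_exp G f < s%:E)%E -> (poincare_series G f s < +oo)%E.
Proof.
move=> s0 crit_lt.
have [s' s's crit_lt'] : exists2 s' : R, s' < s & (crit_exp G f < s'%:E)%E.
  case: (crit_exp G f) crit_lt => [x| |] //=; rewrite ?lte_fin => xs.
    by exists ((x + s) / 2); rewrite ?lte_fin; lra.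
  by exists (s - 1); rewrite ?ltNyr// ltrBlDr ltrDl.
have [T size_le] := crit_exp_lt_size crit_lt'.
pose T0 := (Num.truncn T).+1; have T_lt : T < T0%:R by exact: truncnS_gt.
pose low := [set g | G g /\ f g <= T0%:R]; pose w g := expR (- (s * f g)).
have fin_low : finite_set low.
  apply: (@finite_set_of_bounded_size R _ low (expR (s' * T0%:R))) => l.
  exact: size_le (ltW T_lt).
set low_sum := \sum_(g <- finmap.enum_fset (fset_set low)) w g.
apply: le_lt_trans (ltry (low_sum + expR s' / (1 - expR (s' - s)))).
apply/esum_leP => [g|l uniq_l lG]; first exact: expR_ge0.
rewrite (bigID (fun g => f g <= T0%:R)) /=; apply: lerD; rewrite -big_filter.
  apply: ler_sum_uniq_sub; rewrite ?filter_uniq ?finmap.fset_uniq// => g; rewrite ?expR_ge0//.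
  by rewrite mem_filter in_fset_set// inE => /andP[gT /lG Gg].
have above g : g \in [seq g <- l | ~~ (f g <= T0%:R)] -> [/\ g \in l, T0%:R < f g & 0 <= f g].
  rewrite mem_filter -ltNge => /andP[gT gl]; split=> //.
  by rewrite (le_trans _ (ltW gT)).
apply: sum_expR_levels => // [g /above[]//|j].
rewrite -size_filter; set lj := [seq _ <- _ | _ == j].
have ljP g : g \in lj -> [/\ g \in l, T0%:R < f g & f g < j.+1%:R].
  rewrite mem_filter => /andP[/eqP <- /above[gl gT g0]]; split=> //.
  by have /andP[] := truncn_itv g0.
have [->|lj_neq0] := eqVneq lj [::]; first exact: expR_ge0.
have /ljP[_ gT gj] : head 0 lj \in lj by case: (lj) lj_neq0 => // g ? _; exact: mem_head.
apply: size_le; rewrite ?filter_uniq//; first by rewrite ltW// (lt_trans T_lt)// (lt_trans gT).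
by move=> h /ljP[hl _ /ltW]; split=> //; exact: lG.
Qed.

Lemma ler_sum_inj (T : choiceType) (l : seq T) (h : T -> T) (w : T -> R) : uniq l ->
  injective h -> (forall x, 0 <= w x) ->
  \sum_(x <- l) (if h x \in l then w (h x) else 0) <= \sum_(x <- l) w x.
Proof.
move=> uniq_l inj_h w0; rewrite -big_mkcond /= -big_filter -(big_map h xpredT w).
apply: ler_sum_uniq_sub => //; first by rewrite map_inj_uniq ?filter_uniq.
by move=> x /mapP[y]; rewrite mem_filter => /andP[hy _] ->.
Qed.

(* Each truncated sum is at most the sum over the finite exceptional set plus half
   of itself. *)
Lemma poincare_series_contraction (T : choiceType) (E : set T) (f : T -> R) (s N0 : R)
    (N : nat) (a : nat -> R) (h : nat -> T -> T) :
  (forall r, finite_set [set x | E x /\ f x <= r]) ->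
  (forall i, injective (h i)) -> (forall i x, E x -> E (h i x)) ->
  (forall i, 0 <= a i) -> \sum_(i < N) a i <= 1 / 2 ->
  (forall x, E x -> f x <= N0 \/ exists2 i, (i < N)%N & f (h i x) <= f x /\
     expR (- (s * f x)) <= a i * expR (- (s * f (h i x)))) ->
  (poincare_series E f s < +oo)%E.
Proof.
move=> fin_sub inj_h hE a0 sum_a contract; pose w x := expR (- (s * f x)).
have w0 x : 0 <= w x by exact: expR_ge0.
pose sub r := finmap.enum_fset (fset_set [set x | E x /\ f x <= r]).
have uniq_sub r : uniq (sub r) by exact: finmap.fset_uniq.
have subP r x : x \in sub r <-> E x /\ f x <= r by rewrite in_fset_set// inE.
have pointwise r x : x \in sub r -> w x <= (if f x <= N0 then w x else 0) +
    \sum_(i < N) a i * (if h i x \in sub r then w (h i x) else 0).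
  move=> /subP[Ex xr]; have term0 i : 0 <= a i * (if h i x \in sub r then w (h i x) else 0).
    by rewrite mulr_ge0//; case: ifP.
  have [xN|[i iN [hx_le wx]]] := contract x Ex; first by rewrite xN lerDl sumr_ge0.
  rewrite ler_wpDl//; first by case: ifP.
  rewrite (bigD1 (Ordinal iN))//= ler_wpDr ?sumr_ge0// ifT//.
  by apply/subP; split; [exact: hE|exact: le_trans xr].
have half r : \sum_(x <- sub r) w x <= \sum_(x <- sub N0) w x + 1 / 2 * \sum_(x <- sub r) w x.
  apply: (@le_trans _ _ (\sum_(x <- sub r) ((if f x <= N0 then w x else 0) +
      \sum_(i < N) a i * (if h i x \in sub r then w (h i x) else 0)))).
    by rewrite big_seq [leRHS]big_seq; apply: ler_sum => x; exact: pointwise.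
  rewrite big_split /= lerD//.
    rewrite -big_mkcond -big_filter; apply: ler_sum_uniq_sub; rewrite ?filter_uniq//.
    by move=> x; rewrite mem_filter => /andP[xN /subP[Ex _]]; exact/subP.
  rewrite exchange_big /=; apply: le_trans (ler_wpM2r (sumr_ge0 _ _) sum_a) => //.
  rewrite mulr_suml; apply: ler_sum => i _; rewrite -mulr_sumr ler_wpM2l//.
  exact: ler_sum_inj.
apply: le_lt_trans (ltry (2 * \sum_(x <- sub N0) w x)); apply/esum_leP => // l uniq_l lE.
have [r l_le] := finite_set_upper_bound f (finite_seq l).
apply: (@le_trans _ _ (\sum_(x <- sub r) w x)).
  by apply: ler_sum_uniq_sub => // x xl; apply/subP; split; [exact: lE|exact: l_le].
by have := half r; lra.
Qed.

End PoincareSeries.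

(** * Convex cocompact groups *)

Section FlagRay.
Variables (R : realType) (n : nat) (phi : 'rV[R]_n) (K D : set 'cV[R]_n) (o : 'cV[R]_n).
Hypotheses (properK : proper_open_cone phi K) (coneD : convex_cone D) (DK : D `<=` K) (Do : D o).
Implicit Types q : 'cV[R]_n * 'rV[R]_n.
Local Notation d := (cone_dist K).

(* The point [q.1 + t o] lies in the cap of [q.2] of parameter [k] once
   [t phi(o) <= k phi(q.1)]. *)
Lemma flag_ray_far q (N : R) : flags K q -> closure D q.1 ->
  exists t z, [/\ 0 < t, t <= 1, D z, d (q.1 + t *: o) z <= 1 & N <= d o (q.1 + t *: o)].
Proof.
move=> flag_q cDx; have [x1 p1 cx Kp px] := flag_q; have Ko := DK Do.
have fx := flag_functional_gt0 properK flag_q; have fo := cone_pairing_gt0 properK Ko.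
have p0 := flag_dual_neq0 flag_q; have po := dual_gt0 properK p0 Kp Ko.
pose k := expR (- (2 * N)); have k0 : 0 < k by exact: expR_gt0.
pose t := Num.min 1 (k * pairing phi q.1 / pairing phi o).
have t0 : 0 < t by rewrite lt_min ltr01 divr_gt0// mulr_gt0.
have t1 : t <= 1 by rewrite ge_min lexx.
have t_small : t * pairing phi o <= k * pairing phi q.1.
  by rewrite -ler_pdivlMr// ge_min lexx orbT.
have Kw : K (q.1 + t *: o) by exact: (shadow_point_in_cone properK Ko).
have cap_w : cap phi K o q.2 k (q.1 + t *: o).
  split=> //; rewrite pairingDr px add0r pairingZr [leLHS]mulrAC [leLHS]mulrC [leRHS]mulrCA.
  rewrite ler_pM2l// pairingDr pairingZr mulrDr (le_trans t_small)//.
  by rewrite lerDl !mulr_ge0 ?(ltW k0) ?(ltW t0) ?(ltW fo).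
have [r r0 ballK] := cone_dist_locally_le1 properK Kw.
move: cDx => /closure_normcP/(_ r r0)[y Dy yx].
exists t, (y + t *: o); split=> //.
- by apply: coneD.2 => //; exact: coneD.1.
- apply: (ballK _ _).2; rewrite opprD addrACA subrr addr0; exact: ltW.
apply: le_trans (cap_dist_ge properK Ko p0 Kp k0 cap_w).
by rewrite expRK; lra.
Qed.

End FlagRay.

Section ConvexCocompactGroup.
Variables (R : realType) (n : nat) (G : set 'M[R]_n) (Om C : set 'cV[R]_n).
Hypothesis ccG : strongly_proj_convex_cocompact G Om C.
Implicit Types (v x : 'cV[R]_n) (g h : 'M[R]_n) (q : 'cV[R]_n * 'rV[R]_n).

Lemma convex_cocompact_domain : properly_convex_open Om. Proof. by case: ccG => _ []. Qed.
Lemma convex_cocompact_discrete : discrete_subgroup G. Proof. by case: ccG. Qed.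

Let convexOm := convex_cocompact_domain.
Local Notation phi := (chart Om).
Local Notation K := (positive_cone Om).
Local Notation d := (cone_dist K).

Lemma ccgroup1 : G 1%:M. Proof. by case: convex_cocompact_discrete => -[]. Qed.
Lemma ccgroupM g h : G g -> G h -> G (g *m h).
Proof. by case: convex_cocompact_discrete => -[_ [mulG _]] _; exact: mulG. Qed.
Lemma ccgroupV g : G g -> G (invmx g).
Proof. by case: convex_cocompact_discrete => -[_ [_ [invG _]]] _; exact: invG. Qed.
Lemma ccgroup_unit g : G g -> g \in unitmx.
Proof. by move=> Gg; exact: subgroup_unitmx convex_cocompact_discrete.1 Gg. Qed.
Lemma ccgroup_domain g v : G g -> Om v -> Om (g *m v).
Proof. by case: ccG => _ [_ [stabOm _]]; exact: stabOm. Qed.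

Lemma ccgroup_cone_proper : proper_open_cone phi K.
Proof. exact: positive_cone_proper. Qed.
Local Notation properK := ccgroup_cone_proper.

Definition core : set 'cV[R]_n := positive_part phi C.

Lemma core_convex_cone : convex_cone core.
Proof.
have [_ [_ [_ [_ [[_ scaleC] [_ [_ [convC _]]]]]]]] := ccG.
exact: positive_part_convex_cone.
Qed.

Lemma core_sub_cone : core `<=` K.
Proof. by case: ccG => _ [_ [_ [_ [_ [_ [COm _]]]]]] v [Cv pv]; split=> //; exact: COm. Qed.

Lemma hull_scale v (t : R) : C v -> t != 0 -> C (t *: v).
Proof. by case: ccG => _ [_ [_ [_ [[_ scaleC] _]]]]; exact: scaleC. Qed.

Lemma hullN v : C v -> C (- v).
Proof. by rewrite -scaleN1r => Cv; apply: hull_scale; rewrite // oppr_eq0 oner_eq0. Qed.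

Lemma hull_core v : C v -> core v \/ core (- v).
Proof.
move=> Cv; have COm : C `<=` Om by case: ccG => _ [_ [_ [_ [_ [_ []]]]]].
have [[_ pv]|[_ pv]] := domain_positive_cone convexOm (COm v Cv); [left|right]; split=> //.
exact: hullN.
Qed.

Lemma core_nonempty : exists o, core o.
Proof.
have [v /hull_core[]] : exists v, C v by case: ccG => _ [_ [_ [_ [_ []]]]].
  by exists v.
by exists (- v).
Qed.

Lemma positive_coneN v : K v -> ~ K (- v).
Proof. by move=> [_ pv] [_]; rewrite pairingNr oppr_gt0 ltNge ltW. Qed.

(* The group acts on [P(R^n)]; [positive_lift g] is the one of [g], [- g] that
   preserves the cone over [Om] rather than exchanging it with its opposite. *)
Definition positive_lift g : 'M[R]_n :=
  if `[< forall v, K v -> K (g *m v) >] then g else - g.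

Lemma positive_lift_sign g : positive_lift g = g \/ positive_lift g = - g.
Proof. by rewrite /positive_lift; case: ifP; [left|right]. Qed.

Lemma positive_lift_cone g v : G g -> K v -> K (positive_lift g *m v).
Proof.
move=> Gg Kv; rewrite /positive_lift; case: asboolP => [Kg|not_Kg]; first exact: Kg.
have phig_neq0 w : K w -> pairing (phi *m g) w != 0.
  by move=> [Ow _]; rewrite pairing_mulmx (chart_neq0 convexOm)//; exact: ccgroup_domain.
have [pos|neg] := nonvanishing_functional_sign (cone_convex properK) phig_neq0.
  exfalso; apply: not_Kg => w Kw; split; first exact: ccgroup_domain Gg Kw.1.
  by rewrite -pairing_mulmx pos.
rewrite mulNmx; split; last by rewrite pairingNr -pairing_mulmx -pairingNl neg.
exact/(domainN convexOm)/(ccgroup_domain Gg Kv.1).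
Qed.

Lemma positive_lift_unit g : G g -> positive_lift g \in unitmx.
Proof.
move=> /ccgroup_unit gu; case: (positive_lift_sign g) => -> //.
by rewrite -scaleN1r unitmxZ// unitrN1.
Qed.

Lemma positive_lift_aut g : G g -> cone_aut K (positive_lift g).
Proof.
move=> Gg; split=> [|v]; first exact: positive_lift_unit.
split=> [Kgv|]; last exact: positive_lift_cone.
have Ov : Om v.
  have := ccgroup_domain (ccgroupV Gg) Kgv.1.
  case: (positive_lift_sign g) => ->; first by rewrite mulKmx// ccgroup_unit.
  rewrite mulNmx mulmxN mulKmx ?ccgroup_unit// => Ov.
  by rewrite -[v]opprK; exact: domainN.
have [//|KNv] := domain_positive_cone convexOm Ov; exfalso.
by apply: (positive_coneN Kgv); rewrite -mulmxN; exact: positive_lift_cone.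
Qed.

Lemma mu_positive_lift g i : mu (positive_lift g) i = mu g i.
Proof. by case: (positive_lift_sign g) => ->; rewrite ?muN. Qed.

Lemma invmx_positive_lift_sign g : G g ->
  invmx (positive_lift g) = invmx g \/ invmx (positive_lift g) = - invmx g.
Proof.
move=> Gg; have := positive_lift_unit Gg.
case: (positive_lift_sign g) => -> Ngu; [by left|right].
by rewrite -scaleN1r invmxZ ?invrN1 ?scaleN1r.
Qed.

Lemma mu_invmx_positive_lift g i : G g -> mu (invmx (positive_lift g)) i = mu (invmx g) i.
Proof. by move=> /invmx_positive_lift_sign[] ->; rewrite ?muN. Qed.

Lemma cone_aut_sign_inj A A' : cone_aut K A -> cone_aut K A' -> A = A' \/ A = - A' -> A = A'.
Proof.
have [ o core_o] := core_nonempty => autA autA' [//|AE]; exfalso.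
have Ko := core_sub_cone core_o.
apply: (@positive_coneN (A' *m o)); first exact/autA'.2.
by rewrite -mulNmx -AE; exact/autA.2.
Qed.

Lemma positive_lift_invM g h : G g -> G h ->
  positive_lift (invmx h *m g) = invmx (positive_lift h) *m positive_lift g.
Proof.
move=> Gg Gh; have Ghg := ccgroupM (ccgroupV Gh) Gg.
apply: cone_aut_sign_inj; first exact: positive_lift_aut.
  by apply: cone_aut_mul; [apply: cone_aut_inv|]; exact: positive_lift_aut.
case: (positive_lift_sign (invmx h *m g)) (invmx_positive_lift_sign Gh) (positive_lift_sign g)
    => -> [] -> [] ->; rewrite ?mulNmx ?mulmxN ?opprK; first [by left|by right].
Qed.

Lemma core_positive_lift g v : G g -> core v -> core (positive_lift g *m v).
Proof.
move=> Gg core_v; split; last exact: (positive_lift_cone Gg (core_sub_cone core_v)).2.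
have stabC : forall g v, G g -> C v -> C (g *m v).
  by case: ccG => _ [_ [_ [_ [_ [_ [_ [_ []]]]]]]].
have Cgv := stabC g v Gg core_v.1; case: (positive_lift_sign g) => -> //.
by rewrite mulNmx; exact: hullN.
Qed.

Lemma cone_dist_delta_hyperbolic : exists delta : R, delta_hyperbolic K d delta.
Proof.
have [delta [_ hypOm]] : gromov_hyperbolic Om (hilbert_dist Om) by case: ccG => _ [_ [_ []]].
exists delta => x y z w Kx Ky Kz Kw; have := hypOm x y z w Kx.1 Ky.1 Kz.1 Kw.1.
by rewrite /gromov_product !(hilbert_distE convexOm).
Qed.

Lemma orbit_finite o (N : R) : core o ->
  finite_set [set g | G g /\ d o (positive_lift g *m o) <= N].
Proof.
move=> core_o; have Ko := core_sub_cone core_o; have n0 := cone_dim_gt0 properK Ko.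
have [c mu_le] := mu_le_cone_dist properK Ko.
apply: sub_finite_set (discrete_mu_bounded_finite (2 * N + c) n0 convex_cocompact_discrete).
have mu_ge0 h : G h -> 0 <= mu h 0.
  by move=> Gh; rewrite mu0_ge0// convex_cocompact_discrete.1.2.2.2// normr1.
move=> g [Gg orbit_le]; have := mu_le _ (positive_lift_aut Gg).
rewrite mu_positive_lift mu_invmx_positive_lift//.
move=> /le_trans/(_ (_ : _ <= 2 * N + c)) sum_le; split; first exact: Gg.
  by apply: le_trans (sum_le _); rewrite ?lerDl ?mu_ge0 ?lerD2r ?ler_pM2l//; exact: ccgroupV.
by apply: le_trans (sum_le _); rewrite ?lerDr ?mu_ge0 ?lerD2r ?ler_pM2l.
Qed.

Lemma hull_bounded o : core o -> exists N : nat, forall v, C v -> exists2 g, G g &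
  exists t u, [/\ g *m u = t *: v, K u & d o u <= N%:R].
Proof.
move=> core_o; have Ko := core_sub_cone core_o.
have [L [[L0 scaleL] [LC [compactL coverL]]]] : acts_cocompactly G C.
  by case: ccG => _ [_ [_ [_ [_ [_ [_ [_ [_ []]]]]]]]].
have COm : C `<=` Om by case: ccG => _ [_ [_ [_ [_ [_ []]]]]].
pose bounded N := [set v | exists2 e : R, e = 1 \/ e = -1 & K (e *: v) /\ d o (e *: v) <= N%:R].
have [|v [Lv _]|N boundL] := @compact_increasing_cover _ _ bounded compactL.
- move=> i j ij v [e e1 [Kv dv]]; exists e => //; split=> //.
  by rewrite (le_trans dv)// ler_nat.
- have [e e1 Kev] : exists2 e : R, e = 1 \/ e = -1 & K (e *: v).
    have [Kv|KNv] := domain_positive_cone convexOm (COm _ (LC _ Lv)).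
      by exists 1; [left|rewrite scale1r].
    by exists (-1); [right|rewrite scaleN1r].
  have [N /nbhs_normcP[r r0 ballN]] := cone_dist_locally_bounded properK Ko Kev.
  exists N; apply/nbhs_normcP; exists r => // u uv; exists e => //; apply: ballN.
  by rewrite -scalerBr normcZ; case: e1 => ->; rewrite ?normrN normr1 mul1r.
exists N => v /coverL[g [l [Gg [Ll vE]]]]; exists g => //.
have l0 : l != 0 by apply: contra_notN L0 => /eqP <-.
have [|e _ [Ku du]] := boundL ((normc l)^-1 *: l).
  by split; [apply: scaleL; rewrite // invr_eq0 normc_eq0|exact: normc_normalize].
exists (e * (normc l)^-1), (e *: ((normc l)^-1 *: l)); split=> //.
by rewrite scalerA -scalemxAr -vE.
Qed.

Lemma orbit_cobounded o : core o -> exists r : R, forall v, core v ->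
  exists2 g, G g & d v (positive_lift g *m o) <= r.
Proof.
move=> core_o; have Ko := core_sub_cone core_o.
have [N boundN] := hull_bounded core_o; exists N%:R => v core_v.
have [g Gg [t [u [guE Ku du]]]] := boundN v core_v.1; exists g; first exact: Gg.
have autg := positive_lift_aut Gg; have Kv := core_sub_cone core_v.
have [c cE] : exists c : R, positive_lift g *m u = c *: v.
  by case: (positive_lift_sign g) => ->; [exists t|exists (- t); rewrite mulNmx guE scaleNr].
have Kcv : K (c *: v) by rewrite -cE; apply/autg.2.
have c0 : 0 < c.
  by have := Kcv.2; rewrite pairingZr pmulr_lgt0//; case: Kv.
rewrite -(cone_dist_scale properK c0 ltr01 Kv) ?scale1r; last exact/autg.2.
by rewrite -cE (cone_dist_aut _ _ autg) cone_distC.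
Qed.

Definition limit_flags : set ('cV[R]_n * 'rV[R]_n) :=
  flags K `&` [set q | closure core q.1].

Lemma limit_flags_xi_sym : limit_flags `<=` xi_sym_image Om C.
Proof.
move=> q [flag_q cDx]; have p0 := flag_dual_neq0 flag_q; have [x1 p1 cx Kp px] := flag_q.
have pairing_neq0 v : Om v -> pairing q.2 v != 0.
  move=> /(domain_positive_cone convexOm)[Kv|Kv]; have := dual_gt0 properK p0 Kp Kv.
    exact: lt0r_neq0.
  by rewrite pairingNr oppr_gt0; exact: ltr0_neq0.
split; last by [].
split; first by rewrite -normc_gt0 x1.
split; first by apply: closure_subset cDx => v [].
by move=> /pairing_neq0; rewrite px eqxx.
Qed.

Lemma closure_hull_core x : closure C x -> closure core x \/ closure core (- x).
Proof.
have hull_sub : C `<=` core `|` -%R @` core.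
  by move=> v /hull_core[]; [left|right; exists (- v); rewrite ?opprK].
move=> /(closure_subset hull_sub); rewrite closureU => -[|cNx]; [by left|right].
rewrite -scaleN1r -mul_scalar_mx; apply: closure_mulmx cNx => _ [v core_v <-].
by rewrite mul_scalar_mx scaleN1r opprK.
Qed.

Lemma xi_sym_rescale q : xi_sym_image Om C q -> exists a b : R,
  [/\ a != 0, b != 0 & limit_flags (a *: q.1, b *: q.2)].
Proof.
case: q => x p [/= [x0 [cx nOx]] [p0 [px pOm]]].
have nx : 0 < normc x by rewrite normc_gt0.
have np : 0 < normrow p by rewrite normrow_gt0.
have sign_x : exists2 e : R, `|e| = 1 & closure core (e *: x).
  have [cDx|cDx] := closure_hull_core cx.
    by exists 1; [rewrite normr1|rewrite scale1r].
  by exists (-1); [rewrite normrN normr1|rewrite scaleN1r].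
have sign_p : exists2 e : R, `|e| = 1 & dual_cone K (e *: p).
  have [|pos|neg] := nonvanishing_functional_sign (p := p) (cone_convex properK).
  - by move=> v [Ov _]; exact: pOm.
  - by exists 1; [rewrite normr1|rewrite scale1r => v /pos/ltW].
  by exists (-1); [rewrite normrN normr1|rewrite scaleN1r => v /neg/ltW].
have [[e e1 cDx] [e' e'1 Kp]] := (sign_x, sign_p).
have e0 : e != 0 by rewrite -normr_gt0 e1.
have e'0 : e' != 0 by rewrite -normr_gt0 e'1.
have cDx' : closure core (((normc x)^-1 * e) *: x).
  by rewrite -scalerA; apply: (convex_cone_closure core_convex_cone).1; rewrite ?invr_gt0.
exists ((normc x)^-1 * e), ((normrow p)^-1 * e'); split.
- by rewrite mulf_neq0// invr_eq0 gt_eqF.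
- by rewrite mulf_neq0// invr_eq0 gt_eqF.
split; last exact: cDx'.
split.
- by rewrite normcZ normrM e1 mulr1 gtr0_norm ?invr_gt0// mulVf// gt_eqF.
- by rewrite normrowZ normrM e'1 mulr1 gtr0_norm ?invr_gt0// mulVf// gt_eqF.
- exact: (closure_subset core_sub_cone cDx').
- move=> v Kv; rewrite /= -scalerA pairingZl; apply: mulr_ge0; last exact: Kp.
  by rewrite invr_ge0 ltW.
- by rewrite pairingZl pairingZr px !mulr0.
Qed.

Lemma hausdorff_dim_limit_flags :
  hausdorff_dim (@dsym R n) (xi_sym_image Om C) = hausdorff_dim (@dsym R n) limit_flags.
Proof.
have /choice[f fP] q : exists q', xi_sym_image Om C q ->
    limit_flags q' /\ exists a b : R, [/\ a != 0, b != 0 & q' = (a *: q.1, b *: q.2)].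
  have [/xi_sym_rescale[a [b [a0 b0 flag_q]]]|] := pselect (xi_sym_image Om C q); last by exists q.
  by exists (a *: q.1, b *: q.2) => _; split=> //; exists a, b.
apply/le_anti/andP; split.
  apply: (hausdorff_dim_isometry_le (@dsym_ge0 R n) (f := f)) => [q /fP[]//|q q' xi_q xi_q'].
  have [_ [a [b [a0 b0 ->]]]] := fP q xi_q; have [_ [a' [b' [a'0 b'0 ->]]]] := fP q' xi_q'.
  exact: dsym_scale.
exact: (hausdorff_dim_isometry_le (@dsym_ge0 R n) (f := id)) limit_flags_xi_sym _.
Qed.

Lemma limit_flag_exists x : normc x = 1 -> closure core x -> ~ K x ->
  exists p, limit_flags (x, p).
Proof.
move=> x1 cDx nKx; have cx : closure K x := closure_subset core_sub_cone cDx.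
have [p [Kp p1 px]] := supporting_functional properK cx nKx.
by exists p.
Qed.

End ConvexCocompactGroup.

(** * The lower bound *)

Section LowerBound.
Variables (R : realType) (n : nat) (G : set 'M[R]_n) (Om C : set 'cV[R]_n).
Hypothesis ccG : strongly_proj_convex_cocompact G Om C.
Implicit Types (z : 'cV[R]_n) (p : 'rV[R]_n) (q : 'cV[R]_n * 'rV[R]_n) (g : 'M[R]_n).
Local Notation phi := (chart Om).
Local Notation K := (positive_cone Om).
Local Notation D := (core Om C).
Local Notation flag := (limit_flags Om C).
Local Notation lift := (positive_lift Om).
Local Notation d := (cone_dist K).

Local Notation properK := (ccgroup_cone_proper ccG).

Section Basepoint.
Variable o : 'cV[R]_n.
Hypothesis core_o : D o.

Let Ko : K o := core_sub_cone ccG core_o.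

Lemma cap_shadow : exists b : R, forall q (k : R), flag q -> 0 < k -> k <= 1 ->
  exists2 g, G g & forall z, cap phi K o q.2 k z -> d (lift g *m o) z <= d o z + ln k / 2 + b.
Proof.
have [delta hypK] := cone_dist_delta_hyperbolic ccG.
have [r cobounded] := orbit_cobounded ccG core_o.
exists (6 * delta + r) => q k [flag_q cDx] k0 k1; have [_ _ _ Kp px] := flag_q.
have p0 := flag_dual_neq0 flag_q; have po := dual_gt0 properK p0 Kp Ko.
have fx := flag_functional_gt0 properK flag_q.
have [y Dy cap_y] := cap_meets_near_flag properK Ko (@core_sub_cone _ _ _ _ _ ccG) cDx px po fx k0.
have [s s01 center] := cap_center properK Ko hypK p0 Kp k0 k1 cap_y.
set m := _ + _ in center.
have Dm : D m by exact: convex_cone_segment (core_convex_cone ccG) s01 core_o Dy.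
have [g Gg mg] := cobounded m Dm; exists g => // z cap_z.
have Kgo : K (lift g *m o) by apply/(positive_lift_aut ccG Gg).2.
have := cone_dist_triangle properK Kgo (core_sub_cone ccG Dm) cap_z.1.
have := center z cap_z; move: mg; rewrite (cone_distC _ _ m).
by move: (d _ z) (d o z) (d m z) (d m _) (ln k) => *; lra.
Qed.

Lemma flag_ball_shadow : exists2 rho0 : R, 0 < rho0 & exists b : R, forall q (rho : R),
  flag q -> 0 < rho -> rho <= rho0 -> exists k : R,
  (forall q', flag q' -> dsym q' q <= rho ->
    pairing q.2 q'.1 * pairing phi o < k * (pairing q.2 o * pairing phi q'.1)) /\
  exists2 g, G g & forall z, cap phi K o q.2 k z -> d (lift g *m o) z <= d o z + ln rho + b.
Proof.
have [r0 r00 [c c0 pairing_le]] := flag_pairing_le properK Ko.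
have [b shadow_b] := cap_shadow; have c1 : 0 < c + 1 by rewrite ltr_wpDl ?ltW.
exists (Num.min (r0 / 2) (Num.sqrt (c + 1))^-1).
  by rewrite lt_min divr_gt0//= invr_gt0 sqrtr_gt0.
exists (ln (c + 1) / 2 + b) => q rho flag_q rho_gt0; rewrite le_min => /andP[rho_r0 rho_c].
have rho2 : 0 < rho ^+ 2 by rewrite exprn_gt0.
exists ((c + 1) * rho ^+ 2); split=> [q' flag_q' qq'|].
  have rho_lt : rho < r0 by rewrite (le_lt_trans rho_r0)// ltr_pdivrMr// ltr_pMr// ltr1n.
  apply: le_lt_trans (pairing_le q' q rho flag_q'.1 flag_q.1 qq' rho_lt) _.
  have [_ _ _ Kp _] := flag_q.1.
  have po := dual_gt0 properK (flag_dual_neq0 flag_q.1) Kp Ko.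
  have fx := flag_functional_gt0 properK flag_q'.1.
  by rewrite ltr_pM2r ?(mulr_gt0 po fx)// ltr_pM2r// ltrDl.
have [||g Gg shadow_g] := shadow_b q ((c + 1) * rho ^+ 2) flag_q; first by rewrite mulr_gt0.
  rewrite -(sqr_sqrtr (ltW c1)) -exprMn exprn_ile1 ?mulr_ge0 ?sqrtr_ge0 ?(ltW rho_gt0)//.
  by rewrite -ler_pdivlMl ?sqrtr_gt0// mulr1.
exists g => // z /shadow_g; rewrite lnM ?posrE// lnXn//.
by move: (d _ z) (d o z) (ln _) (ln rho) => *; lra.
Qed.

Lemma finite_cap_cover (p : nat -> 'rV[R]_n) (k : nat -> R) :
  (forall q, flag q -> exists i,
    pairing (p i) q.1 * pairing phi o < k i * (pairing (p i) o * pairing phi q.1)) ->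
  exists N : nat, forall v, D v ->
    d o v <= N%:R \/ exists2 i, (i < N)%N & cap phi K o (p i) (k i) v.
Proof.
move=> cover; pose A := closure D `&` [set v | normc v = 1].
pose strip i := [set v | pairing (p i) v * pairing phi o < k i * (pairing (p i) o * pairing phi v)].
have open_strip i : open (strip i).
  pose l := pairing phi o *: p i - (k i * pairing (p i) o) *: phi.
  rewrite (_ : strip i = pairing l @^-1` [set r | r < 0]).
    by apply: open_comp => [v _|]; [exact: pairing_continuous|exact: open_lt].
  by apply/funext => v; rewrite /strip /= !pairing_linear subr_lt0 mulrC mulrA.
have compactA : compact A.
  apply: (@closed_normc_bounded_compact _ _ _ 1); last by move=> v [_ ->].
  by apply: closedI; [exact: closed_closure|exact: closed_unit_sphere].
pose covered N := [set v | K v /\ d o v <= N%:R] `|` [set v | exists2 i, (i < N)%N & strip i v].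
have [||N coverN] := @compact_increasing_cover _ _ covered compactA.
- move=> i j ij v [[Kv dv]|[l li strip_v]]; [left; split=> //|right].
    by rewrite (le_trans dv)// ler_nat.
  by exists l => //; exact: leq_trans li ij.
- move=> x [cDx x1]; have [Kx|nKx] := pselect (K x).
    have [N nbhsN] := cone_dist_locally_bounded properK Ko Kx.
    by exists N; apply: filterS nbhsN; left.
  have [q2 /cover[i strip_x]] := limit_flag_exists ccG x1 cDx nKx.
  exists i.+1; apply: filterS (open_nbhs_nbhs (conj (open_strip i) strip_x)) => v strip_v.
  by right; exists i.
exists N => v Dv; have Kv := core_sub_cone ccG Dv; have v0 := cone_neq0 properK Kv.
have nv : 0 < (normc v)^-1 by rewrite invr_gt0 normc_gt0.
have [|[_]|[i iN strip_v]] := coverN ((normc v)^-1 *: v).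
- split; last exact: normc_normalize.
  by apply: subset_closure; apply: (core_convex_cone ccG).1.
- by rewrite -{1}(scale1r o) (cone_dist_scale properK _ _ Ko Kv)//; left.
right; exists i => //; split=> //; move: strip_v; rewrite /strip /= !pairingZr.
by rewrite -mulrA !(mulrCA _ _^-1) ltr_pM2l// => /ltW.
Qed.

Lemma small_set_cap_shadow : exists2 rho0 : R, 0 < rho0 & exists b : R,
  forall (U : set ('cV[R]_n * 'rV[R]_n)) (rho : R), 0 < rho -> rho <= rho0 ->
  (forall q q', U q -> U q' -> dsym q q' <= rho) -> exists p k g, [/\ G g,
    forall q, flag q -> U q -> pairing p q.1 * pairing phi o < k * (pairing p o * pairing phi q.1)
  & forall z, cap phi K o p k z -> d (lift g *m o) z <= d o z + ln rho + b].
Proof.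
have [rho0 rho00 [b ball_shadow]] := flag_ball_shadow.
exists rho0 => //; exists b => U rho rho_gt0 rho_le dU.
have [[q [flag_q Uq]]|no_flag] := pselect (exists q, flag q /\ U q).
  have [k [ball_cap [g Gg cap_g]]] := ball_shadow q rho flag_q rho_gt0 rho_le.
  by exists q.2, k, g; split=> // q' flag_q' Uq'; apply: ball_cap; rewrite ?dU.
(* For [k = 0] the cap of [phi] is empty. *)
exists phi, 0, 1%:M; split=> [|q flag_q Uq|z [Kz]].
- exact: ccgroup1 ccG.
- by case: no_flag; exists q.
have fz := cone_pairing_gt0 properK Kz; have fo := cone_pairing_gt0 properK Ko.
by rewrite mul0r leNgt mulr_gt0.
Qed.

Lemma hausdorff_null_orbit_poincare (s : R) : 0 < s ->
  hausdorff_measure (@dsym R n) s flag = 0%E ->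
  (poincare_series G (fun g => d o (lift g *m o)) s < +oo)%E.
Proof.
move=> s0 null_flag; have [rho0 rho00 [b cap_shadow_b]] := small_set_cap_shadow.
pose eps := Num.min (rho0 `^ s / 2) (expR (- (s * b)) / 4).
have eps0 : 0 < eps by rewrite lt_min !divr_gt0 ?powR_gt0 ?expR_gt0.
have [U [rho [cover rho_gt0 dU sum_le]]] := small_cover_gt0 s0 eps0
  (hausdorff_null_small_cover (@dsym_ge0 R n) eps0 null_flag).
have rho_le i : rho i <= rho0.
  apply: (ler_of_sum_powR_le s0 (ltW rho00)) => [j|N]; first exact: ltW.
  by rewrite (le_trans (sum_le N))// -ler_pdivlMl// mulrC ge_min lexx.
have /choice[p /choice[k /choice[h hP]]] i :=
  cap_shadow_b (U i) (rho i) (rho_gt0 i) (rho_le i) (dU i).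
have [|N coverN] := @finite_cap_cover p k.
  by move=> q flag_q; have [i _ Uq] := cover q flag_q; exists i; have [_ + _] := hP i; exact.
have Gh i : G (h i) by have [] := hP i.
pose a i := expR (s * b) * rho i `^ s.
have a_ge0 i : 0 <= a i by rewrite mulr_ge0 ?expR_ge0 ?powR_ge0.
have aE i : a i = expR (s * (ln (rho i) + b)).
  by rewrite /a /powR gt_eqF// -expRD; congr expR; ring.
have sum_a : \sum_(i < N) a i <= 1 / 2.
  rewrite -mulr_sumr -ler_pdivlMl ?expR_gt0// -expRN (le_trans (sum_le N))//.
  have : eps <= expR (- (s * b)) / 4 by rewrite ge_min lexx orbT.
  by lra.
apply: (@poincare_series_contraction _ _ _ _ _ N%:R N a (fun i g => invmx (h i) *m g)).
- by move=> r; exact: (orbit_finite ccG r core_o).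
- by move=> i; apply: (can_inj (mulKVmx _)); exact: (ccgroup_unit ccG).
- by move=> i g Gg; apply: (ccgroupM ccG) => //; exact: (ccgroupV ccG).
- exact: a_ge0.
- exact: sum_a.
move=> g Gg; have [|near_o|[i iN cap_g]] := coverN (lift g *m o).
- exact: (core_positive_lift ccG Gg core_o).
- by left.
right; exists i; first exact: iN; have [_ _ /(_ _ cap_g)] := hP i.
rewrite (positive_lift_invM ccG Gg (Gh i)) -mulmxA.
rewrite (cone_dist_aut_inv _ _ (positive_lift_aut ccG (Gh i))) aE.
have : a i <= 1.
  apply: le_trans (_ : 1 / 2 <= _); last by lra.
  by apply: le_trans sum_a; rewrite (bigD1 (Ordinal iN))//= lerDl sumr_ge0.
move: (d o _) (d o _) => x y; rewrite aE -expR0 ler_expR pmulr_rle0// -expRD ler_expR.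
move=> rho_b xy; split; first by lra.
by have := ler_wpM2l (ltW s0) xy; lra.
Qed.

End Basepoint.

Lemma crit_exp_le_hausdorff_dim :
  (2%:E * delta1n G <= hausdorff_dim (@dsym R n) (xi_sym_image Om C))%E.
Proof.
rewrite (hausdorff_dim_limit_flags ccG); apply: le_ereal_inf_tmp => _ [s [s0 null_flag] <-].
have [ o core_o] := core_nonempty ccG; have Ko := core_sub_cone ccG core_o.
have [c dist_le] := cone_dist_le_mu properK Ko.
have crit_le : (delta1n G <= (s / 2)%:E)%E.
  apply: crit_exp_le_of_poincare; first by rewrite divr_ge0// ltW.
  have series_lt := hausdorff_null_orbit_poincare core_o s0 null_flag.
  apply: (poincare_series_comparison (c := s * c) _ series_lt).
  move=> g Gg; have := dist_le _ (positive_lift_aut ccG Gg); rewrite !mu_positive_lift.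
  by move: (d _ _) (mu g 0) (mu g n.-1) => x y z; move=> /(ler_wpM2l (ltW s0)); lra.
have -> : s%:E = (2%:E * (s / 2)%:E)%E by rewrite -EFinM; congr EFin; field.
by rewrite lee_pmul2l ?lte_fin.
Qed.

End LowerBound.

(** * The upper bound *)

Lemma powR_add_le (R : realType) (a b s : R) : 0 <= a -> 0 <= b -> 0 <= s ->
  (a + b) `^ s <= 2 `^ s * (a `^ s + b `^ s).
Proof.
move=> + + s0; wlog ab : a b / a <= b => [wlog_ab|] a0 b0.
  have [ab|/ltW ba] := leP a b; first exact: wlog_ab.
  by rewrite addrC [a `^ s + _]addrC wlog_ab.
apply: (@le_trans _ _ ((2 * b) `^ s)).
  by rewrite ge0_ler_powR ?nnegrE ?addr_ge0 ?mulr_ge0// mulr_natl mulr2n lerD2r.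
by rewrite powRM// ler_wpM2l ?powR_ge0// lerDr powR_ge0.
Qed.

Section UpperBound.
Variables (R : realType) (n : nat) (G : set 'M[R]_n) (Om C : set 'cV[R]_n).
Hypothesis ccG : strongly_proj_convex_cocompact G Om C.
Implicit Types (q : 'cV[R]_n * 'rV[R]_n) (g : 'M[R]_n).
Local Notation K := (positive_cone Om).
Local Notation D := (core Om C).
Local Notation flag := (limit_flags Om C).
Local Notation lift := (positive_lift Om).
Local Notation d := (cone_dist K).
Local Notation properK := (ccgroup_cone_proper ccG).

Lemma limit_flag_shadow o : D o -> exists r : R, forall q (N : R), flag q ->
  exists g, [/\ G g, shadow K o r (lift g) q & N < d o (lift g *m o)].
Proof.
move=> core_o; have [r cobounded] := orbit_cobounded ccG core_o.
have Ko := core_sub_cone ccG core_o; exists (r + 1) => q N [flag_q cDx].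
have [t [z [t0 t1 Dz wz far]]] := flag_ray_far properK (core_convex_cone ccG)
  (core_sub_cone ccG) core_o (N + r + 2) flag_q cDx.
have [g Gg zg] := cobounded z Dz; exists g.
have Kw := shadow_point_in_cone properK Ko flag_q t0.
have Kgo : K (lift g *m o) by apply/(positive_lift_aut ccG Gg).2.
have wg := cone_dist_triangle properK Kw (core_sub_cone ccG Dz) Kgo.
split; first exact: Gg.
  split; [exact: flag_q|exists t; split; [exact: t0|exact: t1|]].
  by move: zg wz wg; do 3 move: (d _ _) => ?; lra.
have := cone_dist_triangle properK Ko Kgo Kw; rewrite (cone_distC _ (lift g *m o)).
by move: far zg wz wg; do 5 move: (d _ _) => ?; lra.
Qed.

Lemma ccgroup_countable : countable G.
Proof.
have [ o core_o] := core_nonempty ccG.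
have cover_G : G `<=` \bigcup_(N : nat) [set g | G g /\ d o (lift g *m o) <= N%:R].
  move=> g Gg; exists (Num.truncn (d o (lift g *m o))).+1 => //; split; first exact: Gg.
  exact/ltW/truncnS_gt.
apply: sub_countable (subset_card_le cover_G) _; apply: bigcup_countable => // N _.
exact/finite_set_countable/(orbit_finite ccG _ core_o).
Qed.

Lemma hausdorff_null_of_delta12_lt (s : R) : 0 < s -> (delta12 G < s%:E)%E ->
  hausdorff_measure (@dsym R n) s flag = 0%E.
Proof.
move=> s0 /(poincare_series_lt_pinfty (ltW s0)) series_lt.
have [ o core_o] := core_nonempty ccG; have Ko := core_sub_cone ccG core_o.
have [r cover] := limit_flag_shadow core_o; have [c c0 diameter_le] := shadow_diameter properK Ko r.
apply/(hausdorff_measure_eq0P (@dsym_ge0 R n) _ s0) => eps eps0.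
pose w g := expR (- (s * gap g)); have w0 g : 0 <= w g by exact: expR_ge0.
pose k := c `^ s * 2 `^ s; have k0 : 0 < k by rewrite mulr_gt0 ?powR_gt0.
have [F [finF _ tail]] := esum_tail_le (fun g => addr_ge0 (w0 g) (w0 (invmx g)))
  (divr_gt0 eps0 k0) (esum_involution_lt_pinfty w0 (@invmxK _ _) (ccgroupV ccG) series_lt).
have [N boundN] := finite_set_upper_bound (fun g => d o (lift g *m o)) finF.
pose radius g := c * (expR (- gap g) + expR (- gap (invmx g))).
have wE g : expR (- gap g) `^ s = w g by rewrite -expRM mulNr mulrC.
have radius_powR g : radius g `^ s <= k * (w g + w (invmx g)).
  rewrite /radius powRM ?addr_ge0 ?expR_ge0 ?(ltW c0)// -mulrA ler_wpM2l ?powR_ge0//.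
  by rewrite -!wE powR_add_le ?expR_ge0 ?(ltW s0).
apply: (@countable_small_cover _ _ _ _ (G `\` F) (fun g => shadow K o r (lift g)) radius).
- exact: s0.
- exact: ltW.
- exact: sub_countable (subset_card_le (@subDsetl _ _ _)) ccgroup_countable.
- move=> q flag_q; have [g [Gg shadow_g far]] := cover q N flag_q.
  by exists g => //; split=> // Fg; have := boundN g Fg; rewrite leNgt far.
- by move=> g; rewrite mulr_ge0 ?addr_ge0 ?expR_ge0 ?(ltW c0).
- move=> g q q' [Gg _] shadow_q shadow_q'.
  have := diameter_le _ q q' (positive_lift_aut ccG Gg) shadow_q shadow_q'.
  by rewrite /gap !mu_positive_lift !(mu_invmx_positive_lift ccG _ Gg).
move=> l uniq_l lGF; apply: le_trans (ler_sum _ (fun g _ => radius_powR g)) _.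
by rewrite -mulr_sumr -ler_pdivlMl// mulrC tail.
Qed.

Lemma hausdorff_dim_le_crit_exp :
  (hausdorff_dim (@dsym R n) (xi_sym_image Om C) <= delta12 G)%E.
Proof.
have crit_ge0 : (0 <= delta12 G)%E by apply: crit_exp_ge0; exists 1%:M; exact: ccgroup1 ccG.
rewrite (hausdorff_dim_limit_flags ccG); apply/lee_addgt0Pr => e e0.
case critE : (delta12 G) crit_ge0 => [x| |] //; last by rewrite addye ?leey.
rewrite lee_fin -EFinD => x0; have s0 : 0 < x + e by rewrite ltr_wpDl.
apply: ereal_inf_lbound; exists (x + e) => //; split; first exact: s0.
by apply: hausdorff_null_of_delta12_lt; rewrite // critE lte_fin ltrDl.
Qed.

End UpperBound.

Unset Implicit Arguments. Set Strict Implicit. Set Printing Implicit Defensive.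

Theorem theorem1p1 (R : realType) (n : nat) (Gamma : set 'M[R]_n)
    (Om C : set 'cV[R]_n) :
  strongly_proj_convex_cocompact Gamma Om C ->
  (2%:E * delta1n Gamma <= hausdorff_dim (@dsym R n) (xi_sym_image Om C)
     <= delta12 Gamma)%E.
Proof.
by move=> ccG; rewrite (crit_exp_le_hausdorff_dim ccG) (hausdorff_dim_le_crit_exp ccG).
Qed.
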